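(* For every connected oriented Legendrian knot $K\subset J^1\mathbb{R}$ and every $n\ge1$, $$R^1_{n,K}=\frac{1}{c_n}R^1_{S(K,L_n)}.$$
   Context: Conventions. $J^1\mathbb{R}=\mathbb{R}^3$ and $J^1[0,1]=[0,1]\times\mathbb{R}^2$ carry coordinates $(x,y,z)$ and contact form $dz-y\,dx$; Legendrian curves are represented by front projections to the $(x,z)$-plane (only cusps and transverse crossings). A left (resp. right) cusp has both branches leaving to the right (resp. left). Tangles. A Legendrian $n$-tangle is a compact Legendrian $\alpha\subset J^1[0,1]$ with $\partial\alpha\subset\partial J^1[0,1]$ whose front coincides near $x=0,1$ with the lines $z=i$, $1\le i\le n$, up to Legendrian isotopy fixed near the boundary. Strands over a generic $x$ are numbered $1,2,\dots$ from top to bottom. The product $\alpha\cdot\beta$ places $\beta$ to the left of $\alpha$. An $m$-tangle with $m<n$ is regarded as an $n$-tangle by adding $n-m$ horizontal strands below. For $\beta\in S_n$, the positive permutation braid $\beta$ is the cusp-free $n$-tangle joining left endpoint $i$ to right endpoint $\beta(i)$ with exactly one crossing between the strands starting at $i<j$ if $\beta(i)>\beta(j)$ and none otherwise; $\lambda(\beta)$ is its number of crossings. $\sigma_i$ is the positive permutation braid of $(i\ i{+}1)$; $e_i$ consists of horizontal strands at heights $j\ne i,i+1$ plus a right cusp joining left endpoints $i,i+1$ and a left cusp joining right endpoints $i,i+1$; $1$ is the identity tangle. $\mathcal{R}=\mathbb{Z}[s^{\pm1}]$ localized at all $s^k-s^{-k}$, $z=s-s^{-1}$; $\mathcal{R}\mathfrak{Leg}_n$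 is the free $\mathcal{R}$-module on Legendrian isotopy classes of $n$-tangles with bilinearly extended product. Elements $L_n$. $\gamma_n=1+\sum_{j=1}^{n-1}s^j\sigma_{n-1}\sigma_{n-2}\cdots\sigma_{n-j}$. $\alpha_{2,n}=e_{n-1}$ and for $3\le k\le n$, $\alpha_{k,n}=\sigma_{n-k+1}\alpha_{k-1,n}\sigma_{n-k+1}-z\sigma_{n-k+1}\alpha_{k-1,n}-z\alpha_{k-1,n}\sigma_{n-k+1}+z^2\alpha_{k-1,n}$. $\beta_n=\big(1-z\sum_{k=2}^n\alpha_{k,n}\big)\gamma_n$, $L_1=1$, $L_n=L_{n-1}\beta_n$ ($L_{n-1}$ extended by a strand below). Normal rulings. For a generic front, a normal ruling $\rho$ is a set of crossings (switches) together with, at each $x$ not the coordinate of a crossing or cusp, a fixed-point-free pairing of the strands, such that: the pairing is locally constant; strands meeting at a cusp are paired near it; the two strands of a crossing are never paired with each other immediately left or right of it; at a non-switch crossing each strand keeps its partner through the crossing, while at a switch partners stay with the heights; and (normality) at each switch, on both sides, the two pairs containing the crossing strands span nested or disjoint (never interlaced) height intervals. $j(\rho)=\#\text{switches}-\#\text{right cusps}$; $R^1_K(z)=\sum_\rho z^{j(\rho)}$. Satellites. For $K$ and an $n$-tangle $L$, $S(K,L)$ has front obtained from the $n$-copy of $K$ ($n$ copies of $K$'s front shifted by distinct small amounts in $z$) by replacing, inside a small rectangle $J$ around an arc on which $K$ is oriented left-to-right, the $n$ parallel strands by a rescaled front of $L$. A normal ruling of $S(K,L)$ is reduced if outside $J$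 it never pairs two of the parallel strands corresponding to the same point of $K$; $\widetilde R_{S(K,L)}=\sum_{\rho\text{ reduced}}z^{j(\rho)}$. For $\eta=\sum r_i\alpha_i\in\mathcal{R}\mathfrak{Leg}_n$, $R^1_{S(K,\eta)}=\sum r_iR^1_{S(K,\alpha_i)}$. $R^1_{n,K}(s)=\frac{1}{c_n}\sum_{\beta\in S_n}s^{\lambda(\beta)}\widetilde R_{S(K,\beta)}(z)$ with $c_n=s^{n(n-1)/2}\prod_{i=1}^n\frac{s^i-s^{-i}}{s-s^{-1}}$. *)

(* Defs.v *)
From HB Require Import structures.
From mathcomp Require Import all_boot all_order all_algebra all_fingroup.
Set Implicit Arguments. Unset Strict Implicit. Unset Printing Implicit Defensive.
Import Order.TTheory GRing.Theory Num.Theory.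

(* Fronts as words.  A generic front is read from left to right (increasing  *)
(* x); between consecutive singular x-values the strands are numbered       *)
(* 0,1,2,... from top to bottom (0-indexed).  Events:                        *)
(*   Cr i      : transverse crossing of strands i and i+1                    *)
(*   LC i a b  : left cusp; two new strands appear at positions i, i+1       *)
(*               (a, b are bookkeeping labels, used only for reducedness)    *)
(*   RC i      : right cusp joining strands i and i+1                        *)
(*   Mk i k o  : no geometric event; relabels strands i..i+k-1 with o        *)
(*               (bookkeeping marker for the boundary of the rectangle J)    *)
Inductive fev : Type :=
| Cr of nat
| LC of nat & option nat & option nat
| RC of nat
| Mk of nat & nat & option nat.

Definition fword := seq fev.

Definition step_count (m : option nat) (e : fev) : option nat :=
  match m with
  | None => None
  | Some m =>
    match e with
    | Cr i => if i.+1 < m then Some m else None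
    | LC i _ _ => if i <= m then Some m.+2 else None
    | RC i => if i.+1 < m then Some (m - 2) else None
    | Mk i k _ => if i + k <= m then Some m else None
    end
  end.

Definition count_after (m : nat) (w : fword) : option nat := foldl step_count (Some m) w.

Definition closed_front (w : fword) : bool := count_after 0 w == Some 0.

Definition indexed (w : fword) : seq (nat * fev) := zip (iota 0 (size w)) w.

Definition tr (i k : nat) : nat := if k == i then i.+1 else if k == i.+1 then i else k.

Definition swap_at {T : Type} (x0 : T) (i : nat) (l : seq T) : seq T :=
  mkseq (fun k => nth x0 l (tr i k)) (size l).

(* arcs of a front: the left cusp with event index t creates the upper arc 2t
   and the lower arc 2t+1; an arc ends at a right cusp.  Two strands at the
   same x carrying the same arc are the same point of the knot. *)
Definition arc_step (st : seq nat) (te : nat * fev) : seq nat :=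
  let: (t, e) := te in
  match e with
  | Cr i => swap_at 0 i st
  | LC i _ _ => take i st ++ (2 * t)%N :: (2 * t).+1 :: drop i st
  | RC i => take i st ++ drop i.+2 st
  | Mk _ _ _ => st
  end.

Definition arcs_at (w : fword) (t : nat) : seq nat := foldl arc_step [::] (take t (indexed w)).

Definition rc_joins (w : fword) : seq (nat * nat) :=
  flatten [seq (let: (u, e) := ue in
                if e is RC i then [:: (nth 0 (arcs_at w u) i, nth 0 (arcs_at w u) i.+1)]
                else [::]) | ue <- indexed w].

Definition is_lc_at (w : fword) (t : nat) : bool :=
  if nth (Mk 0 0 None) w t is LC _ _ _ then true else false.

Definition arc_edge (w : fword) : rel nat := fun a b =>
  [|| (a./2 == b./2) && (a != b) && is_lc_at w a./2,
      (a, b) \in rc_joins w | (b, a) \in rc_joins w].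

Definition connected_front (w : fword) : bool :=
  [exists a : 'I_(2 * size w), is_lc_at w (a : nat)./2] &&
  [forall a : 'I_(2 * size w), forall b : 'I_(2 * size w),
     (is_lc_at w (a : nat)./2 && is_lc_at w (b : nat)./2) ==>
     connect (fun x y : 'I_(2 * size w) => arc_edge w x y) a b].

(* Normal rulings.  A pairing of m strands is a seq p of length m with       *)
(* p`_k the partner of strand k.                                             *)
Definition pswap (i : nat) (p : seq nat) : seq nat :=
  mkseq (fun k => tr i (nth 0 p (tr i k))) (size p).

Definition pins (i : nat) (p : seq nat) : seq nat :=
  let f k := if k < i then k else k.+2 in
  mkseq (fun k => if k < i then f (nth 0 p k)
                  else if k == i then i.+1
                  else if k == i.+1 then i
                  else f (nth 0 p (k - 2))) (size p).+2.

Definition prem (i : nat) (p : seq nat) : seq nat :=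
  let g k := if k < i then k else k - 2 in
  mkseq (fun k => g (nth 0 p (if k < i then k else k.+2))) (size p - 2).

Definition interlaced (l1 r1 l2 r2 : nat) : bool :=
  ((l1 < l2 < r1) && (r1 < r2)) || ((l2 < l1 < r2) && (r2 < r1)).

Definition normal_at (p : seq nat) (i : nat) : bool :=
  let a := nth 0 p i in let b := nth 0 p i.+1 in
  ~~ interlaced (minn i a) (maxn i a) (minn i.+1 b) (maxn i.+1 b).

Definition red_ok (p : seq nat) (l : seq (option nat)) : bool :=
  all (fun k => (nth None l k == None) || (nth None l k != nth None l (nth 0 p k)))
      (iota 0 (size p)).

Definition rstate := option (seq nat * seq (option nat)).

(* one event; sw = "this crossing is a switch"; red = impose reducedness *)
Definition rstep (red : bool) (st : rstate) (x : bool * fev) : rstate :=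
  match st with
  | None => None
  | Some (p, l) =>
    let: (sw, e) := x in
    let res :=
      match e with
      | Cr i =>
          if (i.+1 < size p) && (nth 0 p i != i.+1) then
            if sw then (if normal_at p i then Some (p, swap_at None i l) else None)
            else (let p' := pswap i p in
                  if nth 0 p' i != i.+1 then Some (p', swap_at None i l) else None)
          else None
      | LC i a b =>
          if ~~ sw && (i <= size p) then Some (pins i p, take i l ++ a :: b :: drop i l)
          else None
      | RC i =>
          if [&& ~~ sw, i.+1 < size p & nth 0 p i == i.+1]
          then Some (prem i p, take i l ++ drop i.+2 l) else None
      | Mk i k o =>
          if ~~ sw then Some (p, take i l ++ nseq k o ++ drop (i + k) l) else None
      end in
    match res with
    | Some (p', l') => if red && ~~ red_ok p' l' then None else Some (p', l')
    | None => None
    end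
  end.

(* S (a set of event indices, the switches) determines a (reduced, if red)
   normal ruling of the closed front w *)
Definition ruling_ok (red : bool) (w : fword) (S : {set 'I_(size w)}) : bool :=
  if foldl (rstep red) (Some ([::], [::]))
       (zip [seq (i \in S) | i <- enum 'I_(size w)] w) is Some (p, _)
  then p == [::] else false.

Arguments ruling_ok : clear implicits.

Definition num_rc (w : fword) : nat := count (fun e => if e is RC _ then true else false) w.

Section Poly.
Variable F : fieldType.
Variable s : F.

Definition zz : F := (s - s^-1)%R.

Definition ruling_poly (red : bool) (w : fword) : F :=
  (\sum_(S : {set 'I_(size w)} | ruling_ok red w S) zz ^ ((#|S|)%:Z - (num_rc w)%:Z))%R.

(* crossing of K strands i, i+1: the two blocks of n strands pass through each other *)
Definition cross_gadget (n i : nat) : fword :=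
  let b := (i * n)%N in
  flatten [seq [seq Cr (b + n.-1 + d - k) | k <- iota 0 n] | d <- iota 0 n].

Definition lc_gadget (n i u l : nat) : fword :=
  let b := (i * n)%N in
  [seq LC (b + 2 * c) (Some u) (Some l) | c <- iota 0 n] ++
  flatten [seq [seq Cr (b + 2 * d - 1 - k) | k <- iota 0 d] | d <- iota 1 n.-1].

Definition rc_gadget (n i : nat) : fword :=
  let b := (i * n)%N in
  flatten [seq [seq Cr (b + d + k) | k <- iota 0 d] | d <- rev (iota 1 n.-1)] ++
  [seq RC (b + 2 * c) | c <- rev (iota 0 n)].

Definition ncopy_ev (n : nat) (te : nat * fev) : fword :=
  let: (t, e) := te in
  match e with
  | Cr i => cross_gadget n i
  | LC i _ _ => lc_gadget n i (2 * t) (2 * t).+1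
  | RC i => rc_gadget n i
  | Mk _ _ _ => [::]
  end.

Definition ncopy_part (n : nat) (tes : seq (nat * fev)) : fword :=
  flatten (map (ncopy_ev n) tes).

Definition shift_ev (d : nat) (e : fev) : fev :=
  match e with
  | Cr i => Cr (i + d)
  | LC i _ _ => LC (i + d) None None
  | RC i => RC (i + d)
  | Mk i k o => Mk (i + d) k o
  end.

(* S(K,L): the n-copy of the front w of K, with the n parallel copies of the
   strand p at the slice after the first t events replaced by the n-tangle L *)
Definition satellite (n : nat) (w : fword) (t p : nat) (L : fword) : fword :=
  ncopy_part n (take t (indexed w)) ++
  Mk (p * n) n None :: map (shift_ev (p * n)) L ++
  Mk (p * n) n (Some (nth 0 (arcs_at w t) p)) :: ncopy_part n (drop t (indexed w)).

(* Formal R-linear combinations of tangles (front words).                    *)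
Definition comb := seq (F * fword).

(* a * b places b to the LEFT of a *)
Definition cmul (a b : comb) : comb := [seq ((x.1 * y.1)%R, y.2 ++ x.2) | x <- a, y <- b].
Definition cscale (r : F) (a : comb) : comb := [seq ((r * x.1)%R, x.2) | x <- a].
Definition cone : comb := [:: (1%R, [::])].

(* sigma_i and e_i, 1-indexed as in the paper *)
Definition csigma (i : nat) : comb := [:: (1%R, [:: Cr i.-1])].
Definition ce (i : nat) : comb := [:: (1%R, [:: RC i.-1; LC i.-1 None None])].

Definition cgamma (n : nat) : comb :=
  cone ++ flatten [seq cscale (s ^+ j)%R (foldl cmul cone [seq csigma (n - m) | m <- iota 1 j])
                  | j <- iota 1 n.-1].

(* calpha_aux n j = alpha_{j+2,n} *)
Fixpoint calpha_aux (n j : nat) : comb :=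
  match j with
  | 0 => ce n.-1
  | j'.+1 =>
      let sg := csigma (n - j.+2 + 1) in
      let a := calpha_aux n j' in
      cmul (cmul sg a) sg ++ cscale (- zz)%R (cmul sg a) ++
      cscale (- zz)%R (cmul a sg) ++ cscale (zz ^+ 2)%R a
  end.

Definition calpha (k n : nat) : comb := calpha_aux n (k - 2).

Definition cbeta (n : nat) : comb :=
  cmul (cone ++ cscale (- zz)%R (flatten [seq calpha k n | k <- iota 2 n.-1])) (cgamma n).

Fixpoint cL_aux (m : nat) : comb :=
  match m with
  | 0 => cone
  | m'.+1 => cmul (cL_aux m') (cbeta m'.+2)
  end.

Definition cL (n : nat) : comb := cL_aux n.-1.

(* simulate a crossing word on strands labelled by their left endpoints;
   returns the list of crossed (unordered) pairs and the final arrangement *)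
Fixpoint braid_sim (st : seq nat) (w : seq nat) : seq (nat * nat) * seq nat :=
  match w with
  | [::] => ([::], st)
  | i :: w' =>
      let r := braid_sim (swap_at 0 i st) w' in
      ((nth 0 st i, nth 0 st i.+1) :: r.1, r.2)
  end.

(* w (a sequence of crossings Cr i) is a front of the positive permutation
   braid of b : left endpoint i joined to right endpoint b i, exactly one
   crossing between strands i<j if b i > b j and none otherwise *)
Definition ppb_word (n : nat) (b : 'S_n) (w : seq nat) : bool :=
  let r := braid_sim (iota 0 n) w in
  [&& all (fun i => i.+1 < n) w,
      [forall i : 'I_n, nth 0 r.2 (b i) == i] &
      [forall i : 'I_n, forall j : 'I_n, (i < j) ==>
         (count (fun pr => (pr == (i : nat, j : nat)) || (pr == (j : nat, i : nat))) r.1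
          == (b j < b i))]].

Definition lam (n : nat) (b : 'S_n) : nat :=
  #|[set ij : 'I_n * 'I_n | (ij.1 < ij.2) && (b ij.2 < b ij.1)]|.

Definition c_n (n : nat) : F :=
  (s ^+ (n * n.-1)./2 * \prod_(1 <= i < n.+1) ((s ^+ i - s ^- i) / (s - s^-1)))%R.

(* R^1_{n,K}, with pb b a chosen front of the positive permutation braid b *)
Definition R1n (n : nat) (w : fword) (t p : nat) (pb : 'S_n -> seq nat) : F :=
  ((c_n n)^-1 * \sum_(b : 'S_n) s ^+ lam b * ruling_poly true (satellite n w t p (map Cr (pb b))))%R.

Definition R1sat (n : nat) (w : fword) (t p : nat) (eta : comb) : F :=
  (\sum_(x <- eta) x.1 * ruling_poly false (satellite n w t p x.2))%R.

End Poly.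

(* Main.v *)
(* A normal ruling moves a pairing of the strands from left to right, so each tangle acts linearly
   on functions of pairings.  A crossing T_i kills pairings where i, i+1 are paired; on the others
   exactly one of p and its image p' under the crossing is normal, and T_i satisfies the Hecke
   relation T_i^2 = z T_i + 1.  The tangle e_i is z^-1 times the projection onto pairings with
   i, i+1 paired.

   Only pairs inside the n-strand block at J matter.  If just one pair lies in the block and it
   joins strand m to the last strand n, then z alpha_{k,n} fixes the pairing for k = n-m+1 and
   kills it for the other k; if n is paired outside the block, every alpha_{k,n} kills it.
   Inductively L_n therefore kills every pairing with a pair inside the block and acts as
   gamma_2 ... gamma_n on the others.  There the partners of the block strands, taken in the
   cyclic order of the outside points, span a regular representation of the Hecke algebra, and
   gamma_2 ... gamma_n = sum_b s^lambda(b) T_b; reduced words of the same permutation agree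
   because right multiplications are determined by their value at 1.

   Finally, for a braid in J, a ruling is reduced as soon as it has no pair inside the block at J.
   Passing the n-copy of a crossing or of a cusp, normality forbids the creation of a pair of
   parallel strands out of a state without such pairs, in both reading directions, and at a cusp
   the two branches have such pairs simultaneously since all strands there are paired among
   themselves.  Connectedness of K spreads the property from J to the whole knot. *)
Require Import Defs.
From HB Require Import structures.
From mathcomp Require Import all_boot all_order all_algebra all_fingroup.
From mathcomp Require Import zify ring.
Set Implicit Arguments. Unset Strict Implicit. Unset Printing Implicit Defensive.
Import GRing.Theory.

Local Notation pt p k := (nth 0%N p k).
Local Notation lb l k := (nth None l k).
Local Notation ev0 := (Mk 0 0 None).

(** * Pairings and fronts *)

(** Words act on arbitrary lists through default values, whereas the operator identities need a
    genuine pairing that contains the whole block. They are therefore pointwise and conditional, and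
    the two sides are compared only at states that the prefix of the satellite can reach. The cyclic
    order arises because, for two block strands paired outside, normality of their crossing depends
    only on which partner is met first going down from the block and round through the top. Ranking
    the partners in this order turns normality into a descent of a list. At the increasing list a
    word in which no pair crosses twice meets no descent, so no braid relation has to be proved. For
    reducedness, the absence of pairs inside a block is not inductive within a gadget: a switch can
    turn a pair joining the two blocks into a pair inside one. The invariant therefore also records
    which end of a joining pair is on top. A run read from right to left exchanges the two blocks,
    so one crossing lemma serves both directions. *)

Definition pairing (p : seq nat) : Prop :=
  [/\ forall k, k < size p -> pt p k < size p,
      forall k, k < size p -> pt p k != k &
      forall k, k < size p -> pt p (pt p k) = k].

Lemma pairing_lt p k : pairing p -> k < size p -> pt p k < size p.
Proof. by case=> + _ _; apply. Qed.

Lemma pairing_neq p k : pairing p -> k < size p -> pt p k != k.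
Proof. by case=> _ + _; apply. Qed.

Lemma pairingK p k : pairing p -> k < size p -> pt p (pt p k) = k.
Proof. by case=> _ _; apply. Qed.

Variant tr_spec i k : nat -> Prop :=
| TrLo of k = i : tr_spec i k i.+1
| TrHi of k = i.+1 : tr_spec i k i
| TrOther of k != i & k != i.+1 : tr_spec i k k.

Lemma trP i k : tr_spec i k (tr i k).
Proof. by rewrite /tr; case: eqVneq => ?; [constructor|case: eqVneq => ?; constructor]. Qed.

Ltac tr_cases := repeat match goal with |- context [tr ?i ?k] =>
  lazymatch k with context [tr _ _] => fail | _ => case: (trP i k) => ? end end.

Lemma trK i : involutive (tr i).
Proof. by move=> k; tr_cases; try lia. Qed.

Lemma tr_lt i k m : i.+1 < m -> (tr i k < m) = (k < m).
Proof. by tr_cases; lia. Qed.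

Lemma nth_swap (T : Type) (x0 : T) i l k : i.+1 < size l ->
  nth x0 (swap_at x0 i l) k = nth x0 l (tr i k).
Proof.
move=> Hi; have [Hk|Hk] := ltnP k (size l); first by rewrite nth_mkseq.
by rewrite !nth_default ?size_mkseq // leqNgt tr_lt // -leqNgt.
Qed.

Lemma size_swap (T : Type) (x0 : T) i l : size (swap_at x0 i l) = size l.
Proof. by rewrite size_mkseq. Qed.

Lemma swap_cat (T : Type) (x0 : T) P x y S :
  swap_at x0 (size P) (P ++ x :: y :: S) = P ++ y :: x :: S.
Proof.
apply: (@eq_from_nth _ x0); first by rewrite size_swap !size_cat.
move=> k _; rewrite nth_swap ?size_cat /=; last lia.
rewrite !nth_cat /tr; case: eqVneq => [->|H1].
  by rewrite ltnn subnn ltnNge leqnSn /= subSnn.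
case: eqVneq => [->|H2]; first by rewrite ltnn subnn ltnNge leqnSn /= subSnn.
by case: ltnP => // H; have -> : k - size P = (k - size P - 2).+2 by lia.
Qed.

Lemma size_pswap i p : size (pswap i p) = size p.
Proof. by rewrite size_mkseq. Qed.

Lemma nth_pswap i p k : k < size p -> pt (pswap i p) k = tr i (pt p (tr i k)).
Proof. by move=> Hk; rewrite nth_mkseq. Qed.

Lemma pairing_pswap i p : i.+1 < size p -> pairing p -> pairing (pswap i p).
Proof.
move=> Hi Hp; split=> k; rewrite size_pswap => Hk; have Hk' : tr i k < size p by rewrite tr_lt.
- by rewrite nth_pswap // tr_lt // pairing_lt.
- by rewrite nth_pswap // -(inj_eq (inv_inj (trK i))) trK pairing_neq.
- by rewrite !nth_pswap // ?tr_lt ?pairing_lt // trK pairingK // trK.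
Qed.

Lemma pswapK i p : i.+1 < size p -> pswap i (pswap i p) = p.
Proof.
move=> Hi; apply: (@eq_from_nth _ 0); rewrite !size_pswap // => k Hk.
by rewrite !nth_pswap ?size_pswap ?tr_lt // !trK.
Qed.

(** The two ways a pairing passes a crossing. At a switch the pairing by heights is the same on both
    sides, so one normality test covers both. The relation is symmetric, which allows runs to be
    read from right to left. *)
Definition xrel i p q : Prop :=
  [/\ i.+1 < size p, pt p i != i.+1 & (q = p /\ normal_at p i) \/ q = pswap i p].

Lemma pswap_npair i p : pairing p -> i.+1 < size p -> pt p i != i.+1 ->
  pt (pswap i p) i != i.+1.
Proof.
move=> Hp Hi H; rewrite nth_pswap; last lia.
have -> : tr i i = i.+1 by rewrite /tr eqxx.
have : pt p i.+1 <> i by move=> E; have := pairingK Hp Hi; rewrite E; lia.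
by have := pairing_neq Hp Hi; tr_cases; lia.
Qed.

Lemma xrel_sym i p q : pairing p -> xrel i p q -> xrel i q p.
Proof.
move=> Hp [Hi Hn [[-> H]|->]]; first by split=> //; left.
split; rewrite ?size_pswap //; first exact: pswap_npair.
by right; rewrite pswapK.
Qed.

Lemma xrel_size i p q : xrel i p q -> size q = size p.
Proof. by case=> _ _ [[-> _]|->] //; rewrite size_pswap. Qed.

Lemma xrel_pairing i p q : pairing p -> xrel i p q -> pairing q.
Proof. by move=> Hp [Hi _ [[-> _]|->]] //; apply: pairing_pswap. Qed.

Lemma size_pins i p : size (pins i p) = (size p).+2.
Proof. by rewrite size_mkseq. Qed.

(** The position, right of a left cusp at i, of the strand that was at k. *)
Definition lift2 i k := if k < i then k else k.+2.

Lemma nth_pins_new i p : i <= size p -> pt (pins i p) i = i.+1 /\ pt (pins i p) i.+1 = i.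
Proof.
move=> Hi; split; rewrite nth_mkseq; try lia; first by rewrite ltnn eqxx.
by do ![case: ifP => ?]; lia.
Qed.

Lemma nth_pins_lift i p k : i <= size p -> k < size p ->
  pt (pins i p) (lift2 i k) = lift2 i (pt p k).
Proof.
move=> Hi Hk; rewrite nth_mkseq /lift2; last by case: ifP => ?; lia.
case: (ltnP k i) => H1; first by rewrite H1.
have -> : k.+2 < i = false by lia.
have -> : (k.+2 == i) = false by lia.
have -> : (k.+2 == i.+1) = false by lia.
by have -> : k.+2 - 2 = k by lia.
Qed.

Lemma lift2P i k : [\/ k = i, k = i.+1 | exists2 j, k = lift2 i j & k < i \/ i.+1 < k].
Proof.
case: (ltnP k i) => H; first by constructor 3; exists k; [rewrite /lift2 H | left].
case: (eqVneq k i) => H1; first by constructor 1.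
case: (eqVneq k i.+1) => H2; first by constructor 2.
constructor 3; exists (k - 2); last by right; lia.
by rewrite /lift2; case: ifP => ?; lia.
Qed.

Lemma lift2_lt i k m : i <= m -> (lift2 i k < m.+2) = (k < m).
Proof. by rewrite /lift2; case: ifP; lia. Qed.

Lemma lift2_inj i : injective (lift2 i).
Proof. by move=> a b; rewrite /lift2; do ![case: ifP => ?]; lia. Qed.

Lemma pairing_pins i p : i <= size p -> pairing p -> pairing (pins i p).
Proof.
move=> Hi Hp; have [e1 e2] := nth_pins_new Hi.
split=> k; rewrite ?size_pins => Hk; case: (lift2P i k) => [Ek|Ek|[j Ek _]]; subst k;
  rewrite ?e1 ?e2 //; try lia; move: Hk; rewrite lift2_lt // => Hj; rewrite nth_pins_lift //.
- by rewrite lift2_lt // pairing_lt.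
- by rewrite (inj_eq (@lift2_inj i)) pairing_neq.
- by rewrite nth_pins_lift ?pairingK // pairing_lt.
Qed.

Lemma size_prem i p : size (prem i p) = size p - 2.
Proof. by rewrite size_mkseq. Qed.

(** This makes e_i a multiple of a projection, and lets a right cusp read backwards be treated as a
    left cusp. *)
Lemma pinsK i p : pairing p -> i.+1 < size p -> pt p i = i.+1 -> pins i (prem i p) = p.
Proof.
move=> Hp Hi E; have E' : pt p i.+1 = i by rewrite -E pairingK //; lia.
apply: (@eq_from_nth _ 0); rewrite size_pins size_prem; first lia.
move=> k Hk; have Hk' : k < size p by lia.
case: (lift2P i k) => [Ek|Ek|[j Ek ne]].
- by rewrite Ek (nth_pins_new _).1 ?E // size_prem; lia.
- by rewrite Ek (nth_pins_new _).2 ?E' // size_prem; lia.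
have Hj : j < size p - 2 by move: Ek; rewrite /lift2; case: ifP; lia.
rewrite Ek nth_pins_lift ?size_prem //; last lia.
rewrite nth_mkseq // -/(lift2 i j) -Ek.
have n1 : pt p k <> i by move=> H; have := pairingK Hp Hk'; rewrite H E; lia.
have n2 : pt p k <> i.+1 by move=> H; have := pairingK Hp Hk'; rewrite H E'; lia.
by case: (ltnP (pt p k) i) => H /=; rewrite /lift2; case: ifP => ?; lia.
Qed.

Lemma pairing_prem i p : i.+1 < size p -> pt p i = i.+1 -> pairing p -> pairing (prem i p).
Proof.
move=> Hi E Hp; have Ep := pinsK Hp Hi E; have sz : size (prem i p) = size p - 2 by rewrite size_prem.
have Hi' : i <= size (prem i p) by lia.
have key k : k < size (prem i p) -> pt p (lift2 i k) = lift2 i (pt (prem i p) k).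
  by move=> Hk; rewrite -{1}Ep nth_pins_lift.
have lt k : k < size (prem i p) -> lift2 i k < size p.
  by move=> Hk; rewrite -Ep size_pins lift2_lt.
have lt' k : k < size (prem i p) -> pt (prem i p) k < size (prem i p).
  by move=> Hk; rewrite -(@lift2_lt i) // -key // -(size_pins i) Ep pairing_lt // lt.
split=> k Hk; first exact: lt'.
- by rewrite -(inj_eq (@lift2_inj i)) -key // pairing_neq // lt.
- by apply: (@lift2_inj i); rewrite -key ?lt' // -key // pairingK // lt.
Qed.

(** * Transfer operators *)

Definition block_pairs (o m : nat) (p : seq nat) : bool :=
  has (fun k => o <= pt p k < o + m)%N (iota o m).

Lemma block_pairsP o m p :
  reflect (exists k, (o <= k < o + m)%N /\ (o <= pt p k < o + m)%N) (block_pairs o m p).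
Proof.
apply: (iffP hasP) => [[k] | [k [Hk H]]]; first by rewrite mem_iota; exists k.
by exists k; rewrite ?mem_iota.
Qed.

Lemma block_pairs_pswap_imp o m i p : (o <= i)%N -> (i.+1 < o + m)%N -> (o + m <= size p)%N ->
  block_pairs o m p -> block_pairs o m (pswap i p).
Proof.
move=> oi im isz /block_pairsP[k [Hk Hpk]]; apply/block_pairsP.
have tr_in x : (o <= x < o + m)%N -> (o <= tr i x < o + m)%N by tr_cases; lia.
exists (tr i k); split; first exact: tr_in.
by rewrite nth_pswap; [rewrite trK tr_in|rewrite tr_lt; lia].
Qed.

Lemma block_pairs_pswap o m i p : (o <= i)%N -> (i.+1 < o + m)%N -> (o + m <= size p)%N ->
  block_pairs o m (pswap i p) = block_pairs o m p.
Proof.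
move=> oi im isz; apply/idP/idP => H; last exact: block_pairs_pswap_imp.
have := @block_pairs_pswap_imp o m i (pswap i p); rewrite size_pswap pswapK; last lia.
by apply.
Qed.

Section Transfer.
Local Open Scope ring_scope.
Variables (F : fieldType) (s : F).
Local Notation z := (zz s).

(* Events act on functions of the pairing to their right, so the word read first acts last;
   the z^-1 is the right-cusp term of the exponent j. *)
Definition bev (e : fev) (f : seq nat -> F) (p : seq nat) : F :=
  match e with
  | Cr i => if (i.+1 < size p)%N && (pt p i != i.+1)
            then (if normal_at p i then z * f p else 0) +
                 (if pt (pswap i p) i != i.+1 then f (pswap i p) else 0)
            else 0
  | LC i _ _ => if (i <= size p)%N then f (pins i p) else 0
  | RC i => if (i.+1 < size p)%N && (pt p i == i.+1) then z^-1 * f (prem i p) else 0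
  | Mk _ _ _ => f p
  end.

Definition bword (w : fword) (f : seq nat -> F) : seq nat -> F := foldr bev f w.

Definition bcomb (o : nat) (c : comb F) (f : seq nat -> F) (p : seq nat) : F :=
  \sum_(x <- c) x.1 * bword (map (shift_ev o) x.2) f p.

Lemma bev_cr i f p : pairing p -> (i.+1 < size p)%N ->
  bev (Cr i) f p = if pt p i == i.+1 then 0
                   else (if normal_at p i then z * f p else 0) + f (pswap i p).
Proof.
move=> Hp Hi; rewrite /= Hi /=; case: eqVneq => //= H.
by rewrite pswap_npair.
Qed.

Lemma bword_cat u v f : bword (u ++ v) f = bword u (bword v f).
Proof. exact: foldr_cat. Qed.

Lemma bev_lin (I : Type) (r : seq I) (c : I -> F) (f : I -> seq nat -> F) e p :
  bev e (fun q => \sum_(i <- r) c i * f i q) p = \sum_(i <- r) c i * bev e (f i) p.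
Proof.
have S0 : 0 = \sum_(j <- r) c j * 0 by rewrite big1 // => j _; rewrite mulr0.
have SM x q : x * (\sum_(j <- r) c j * f j q) = \sum_(j <- r) c j * (x * f j q).
  by rewrite mulr_sumr; apply: eq_bigr => j _; rewrite mulrCA.
case: e => [i|i a b|i|i k o] //=; case: ifP => _ //.
under [RHS]eq_bigr => j _ do rewrite mulrDr.
by rewrite big_split /=; congr (_ + _); case: ifP => _.
Qed.

Lemma bev_ext e f g : f =1 g -> bev e f =1 bev e g.
Proof. by move=> fg p; case: e => [i|i a b|i|i k o] /=; rewrite !fg. Qed.

Lemma bword_ext w f g : f =1 g -> bword w f =1 bword w g.
Proof. by move=> fg; elim: w => //= e w; apply: bev_ext. Qed.

Lemma bword_lin (I : Type) (r : seq I) (c : I -> F) (f : I -> seq nat -> F) w p :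
  bword w (fun q => \sum_(i <- r) c i * f i q) p = \sum_(i <- r) c i * bword w (f i) p.
Proof.
elim: w p => //= e w IH p; rewrite -bev_lin; exact: bev_ext.
Qed.

Lemma bcomb_ext o c f g : f =1 g -> bcomb o c f =1 bcomb o c g.
Proof. by move=> fg p; apply: eq_bigr => x _; rewrite (bword_ext _ fg). Qed.

Lemma bcomb_cat o c d f p : bcomb o (c ++ d) f p = bcomb o c f p + bcomb o d f p.
Proof. exact: big_cat. Qed.

Lemma bcomb_scale o r c f p : bcomb o (cscale r c) f p = r * bcomb o c f p.
Proof. by rewrite /bcomb big_map mulr_sumr; apply: eq_bigr => x _; rewrite mulrA. Qed.

Lemma bcomb_one o f p : bcomb o (cone F) f p = f p.
Proof. by rewrite /bcomb big_seq1 mul1r. Qed.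

(** In the product a·b the tangle b stands on the left, so a acts first. *)
Lemma bcomb_mul o a b f p : bcomb o (cmul a b) f p = bcomb o b (bcomb o a f) p.
Proof.
rewrite /bcomb /cmul big_allpairs_dep exchange_big; apply: eq_bigr => y _ /=.
rewrite bword_lin mulr_sumr; apply: eq_bigr => x _ /=.
by rewrite map_cat bword_cat mulrCA mulrA.
Qed.

Lemma bcomb_flatten o (cs : seq (comb F)) f p :
  bcomb o (flatten cs) f p = \sum_(c <- cs) bcomb o c f p.
Proof. exact: big_flatten. Qed.

(* T_i - z, which is the inverse of T_i on pairings where i and i+1 are not paired. *)
Definition hecke_inv i (f : seq nat -> F) p := bev (Cr i) f p - z * f p.

Lemma hecke_inv_normal i f p : pairing p -> (i.+1 < size p)%N -> pt p i != i.+1 ->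
  normal_at p i -> hecke_inv i f p = f (pswap i p).
Proof. by move=> Hp Hi /negPf H N; rewrite /hecke_inv bev_cr // H N addrC addKr. Qed.

Lemma hecke_inv_nnormal i f p : pairing p -> (i.+1 < size p)%N -> pt p i != i.+1 ->
  ~~ normal_at p i -> hecke_inv i f p = f (pswap i p) - z * f p.
Proof.
by move=> Hp Hi /negPf H /negPf N; rewrite /hecke_inv bev_cr // H N add0r.
Qed.

Lemma hecke_inv0 i f p : pairing p -> (i.+1 < size p)%N -> f p = 0 ->
  f (pswap i p) = 0 -> hecke_inv i f p = 0.
Proof.
move=> Hp Hi H1 H2; rewrite /hecke_inv bev_cr // H1 H2 mulr0 addr0 subr0.
by do ![case: ifP => _].
Qed.

(** The four terms of the recursion factor as (sigma - z) alpha (sigma - z). For k = j + 3 the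
    1-indexed sigma_{n-k+1} is the 0-indexed crossing n - j - 3 of the block. *)
Lemma calpha_step o n j h q : (j.+3 <= n)%N ->
  bcomb o (calpha_aux s n j.+1) h q =
  hecke_inv (o + (n - j.+3)) (bcomb o (calpha_aux s n j) (hecke_inv (o + (n - j.+3)) h)) q.
Proof.
move=> Hj /=; set a := calpha_aux s n j; set i := (n - j.+3 + 1)%N.
have sgE f p : bcomb o (csigma F i) f p = bev (Cr (o + (n - j.+3))) f p.
  by rewrite /bcomb big_seq1 mul1r /i addn1 /= addnC.
have lin2 f g p : bcomb o a (fun p => f p - z * g p) p = bcomb o a f p - z * bcomb o a g p.
  rewrite /bcomb mulr_sumr -sumrN -big_split; apply: eq_bigr => x _ /=.
  (* The difference is a sum over the two Booleans with coefficients 1 and -z. *)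
  have := @bword_lin bool [:: true; false] (fun b => if b then 1 else - z)
    (fun b => if b then f else g) (map (shift_ev o) x.2) p.
  rewrite !big_cons !big_nil !mul1r !addr0 => H.
  rewrite mulrCA -mulrN -mulrDr -[in RHS]mulNr -H; congr (_ * _); apply: bword_ext => r.
  by rewrite !big_cons big_nil mul1r addr0 mulNr.
have blin2 f g p : bev (Cr (o + (n - j.+3))) (fun p => f p - z * g p) p
   = bev (Cr (o + (n - j.+3))) f p - z * bev (Cr (o + (n - j.+3))) g p.
  have := @bev_lin bool [:: true; false] (fun b => if b then 1 else - z)
    (fun b => if b then f else g) (Cr (o + (n - j.+3))) p.
  rewrite !big_cons !big_nil !mul1r !addr0 mulNr => <-; apply: bev_ext => r.
  by rewrite !big_cons big_nil mul1r addr0 mulNr.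
rewrite !bcomb_cat !bcomb_scale !bcomb_mul /hecke_inv lin2.
rewrite (bev_ext _ (g := fun p => bcomb o a (bev (Cr (o + (n - j.+3))) h) p
  - z * bcomb o a h p)); last by move=> p; rewrite lin2.
have sgA p : bcomb o a (bcomb o (csigma F i) h) p = bcomb o a (bev (Cr (o + (n - j.+3))) h) p.
  by apply: bcomb_ext => r; rewrite sgE.
rewrite blin2 !sgE sgA.
rewrite (bev_ext _ (g := bcomb o a (bev (Cr (o + (n - j.+3))) h))); last first.
  by move=> p; rewrite bcomb_mul.
by rewrite /a; ring.
Qed.

End Transfer.

(** * The elements alpha *)

Lemma nth_pswap_out i p k : (k < size p)%N -> k != i -> k != i.+1 ->
  pt (pswap i p) k = tr i (pt p k).
Proof. by move=> Hk H1 H2; rewrite nth_pswap //; congr (tr i (pt p _)); tr_cases; lia. Qed.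

Section Alpha.
Local Open Scope ring_scope.
Variables (F : fieldType) (s : F).
Local Notation z := (zz s).

(** A right cusp followed by a left cusp at the same height closes a pair and reopens it, at the
    price of one cusp weight z^-1. *)
Lemma calpha_base o n h q : pairing q -> (2 <= n)%N -> (o + n <= size q)%N ->
  bcomb s o (calpha_aux s n 0) h q =
  if pt q (o + n).-1 == (o + n - 2)%N then z^-1 * h q else 0.
Proof.
move=> Hq Hn sz; rewrite /bcomb /= big_seq1 mul1r /=.
have -> : (n.-1.-1 + o = o + n - 2)%N by lia.
set i := (o + n - 2)%N; have Ei : (o + n).-1 = i.+1 by lia.
have Hi : (i.+1 < size q)%N by lia.
rewrite Ei Hi /= size_prem.
have -> : (pt q i.+1 == i) = (pt q i == i.+1).
  by apply/eqP/eqP => E; rewrite -{1}E pairingK //; lia.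
case: eqVneq => // E; rewrite pinsK // ifT //; lia.
Qed.

(** Each conjugation can move the partner of the last strand by one height only, so alpha_k reacts
    only to partners among the k - 1 strands just above the last. *)
Lemma calpha_eq0 o n j h q : (j.+2 <= n)%N -> pairing q -> (o + n <= size q)%N ->
  ~~ (o + (n - j.+2) <= pt q (o + n).-1 < (o + n).-1)%N ->
  bcomb s o (calpha_aux s n j) h q = 0.
Proof.
elim: j h q => [|j IH] h q Hj Hq sz out.
  by rewrite calpha_base // ifF //; apply/negP => /eqP E; move: out; rewrite E; lia.
rewrite calpha_step // hecke_inv0 //; first lia.
  by apply: IH => //; [lia|move: out; lia].
apply: IH; rewrite ?size_pswap //; first lia.
  by apply: pairing_pswap => //; lia.
by rewrite nth_pswap_out; [move: out; tr_cases; lia|lia|lia|lia].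
Qed.

(** The conjugating crossings stay among the first n - 1 strands and e_{n-1} changes no pairing, so
    the class of pairings with a pair there is preserved. *)
Lemma calpha_vanish o n j h q : (j.+2 <= n)%N -> pairing q -> (o + n <= size q)%N ->
  (forall q', pairing q' -> size q' = size q -> block_pairs o n.-1 q' -> h q' = 0) ->
  block_pairs o n.-1 q -> bcomb s o (calpha_aux s n j) h q = 0.
Proof.
elim: j h q => [|j IH] h q Hj Hq sz Hh Hin.
  by rewrite calpha_base // Hh // mulr0 if_same.
have Hi : ((o + (n - j.+3)).+1 < size q)%N by lia.
have Hps q' : pairing q' -> size q' = size q -> block_pairs o n.-1 q' ->
   [/\ pairing (pswap (o + (n - j.+3)) q'), size (pswap (o + (n - j.+3)) q') = size q &
       block_pairs o n.-1 (pswap (o + (n - j.+3)) q')].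
  move=> Hq' sz' H'; split; rewrite ?size_pswap //; first by apply: pairing_pswap => //; lia.
  by rewrite block_pairs_pswap //; lia.
have step q' : pairing q' -> size q' = size q -> block_pairs o n.-1 q' ->
    hecke_inv s (o + (n - j.+3)) h q' = 0.
  move=> Hq' sz' H'; have [P1' P2' P3'] := Hps q' Hq' sz' H'.
  by apply: hecke_inv0; rewrite ?sz' // Hh.
have [P1' P2' P3'] := Hps q Hq erefl Hin.
rewrite calpha_step // hecke_inv0 //; first by apply: IH => //; lia.
by apply: IH => //; rewrite ?P2' //; lia.
Qed.

(** Since all other partners lie outside the block, the pairing with last partner i + 1 is normal at
    i and the one with last partner i is not. On the normal one sigma - z is a pure exchange, so
    conjugation shifts the detected partner from i + 1 to i. *)
Lemma calpha_single o n j h q : (j.+2 <= n)%N -> pairing q -> (o + n <= size q)%N ->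
  (o <= pt q (o + n).-1 < (o + n).-1)%N -> ~~ block_pairs o n.-1 q ->
  bcomb s o (calpha_aux s n j) h q =
  if pt q (o + n).-1 == (o + (n - j.+2))%N then z^-1 * h q else 0.
Proof.
elim: j h q => [|j IH] h q Hj Hq sz Hm Hin.
  by rewrite calpha_base //; congr (if _ == _ then _ else _); lia.
set i := (o + (n - j.+3))%N; set N := (o + n).-1 in Hm *.
have Ei : (o + (n - j.+2))%N = i.+1 by rewrite /i; lia.
have Hi : (i.+1 < size q)%N by rewrite /i; lia.
have iN : (i.+1 < N)%N by rewrite /i /N; lia.
have oi : (o <= i)%N by rewrite /i; lia.
have Nsz : (N < size q)%N by rewrite /N; lia.
have NE : N = (o + n.-1)%N by rewrite /N; lia.
have out k : (o <= k < N)%N -> k != pt q N -> (pt q k < o)%N || (N < pt q k)%N.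
  move=> Hk kn; apply/orP; case: (ltnP (pt q k) o) => H1; first by left.
  right; rewrite ltn_neqAle; apply/andP; split.
    by apply/eqP => E; move: kn; rewrite E pairingK ?eqxx //; lia.
  rewrite leqNgt; apply/negP => H2; move/negP: Hin; apply; apply/block_pairsP; exists k.
  by rewrite -NE Hk H1 H2.
have Hq' : pairing (pswap i q) by apply: pairing_pswap.
have Hin' : ~~ block_pairs o n.-1 (pswap i q) by rewrite block_pairs_pswap //; lia.
have qN' : pt (pswap i q) N = tr i (pt q N) by rewrite nth_pswap_out //; lia.
have qK : pt q (pt q N) = N by rewrite pairingK.
rewrite calpha_step // -/i.
set A := bcomb s o (calpha_aux s n j).
have A0 f p : pairing p -> size p = size q -> ~~ (i.+1 <= pt p N < N)%N -> A f p = 0.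
  by move=> Hp Ep H; rewrite /A calpha_eq0 ?Ep ?Ei //; lia.
case: (ltngtP (pt q N) i) => cmp.
- by apply: hecke_inv0 => //; apply: A0; rewrite ?size_pswap // ?qN'; tr_cases; lia.
- case: (eqVneq (pt q N) i.+1) => cmp1.
    (* Last partner i + 1: the two pairs are nested or disjoint, and the exchange moves the partner
       to i, beyond the reach of the previous alpha. *)
    have xo : (pt q i < o)%N || (N < pt q i)%N by apply: out; lia.
    rewrite hecke_inv_normal //.
    + by apply: A0; rewrite ?size_pswap // qN'; tr_cases; lia.
    + by lia.
    + by rewrite /normal_at /interlaced -cmp1 qK cmp1; lia.
  rewrite hecke_inv0 // /A IH ?size_pswap //; try lia.
  + by rewrite ifF // Ei; apply/negbTE.
  + by rewrite ifF // Ei qN'; apply/negbTE; tr_cases; lia.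
  + by rewrite -/N qN'; tr_cases; lia.
(* Last partner i: the two pairs interlace. The outer factor moves the partner to i + 1, where the
   induction hypothesis applies, and the inner factor moves it back to give h at q. *)
have xo : (pt q i.+1 < o)%N || (N < pt q i.+1)%N by apply: out; lia.
have qi : pt q i = N by rewrite -cmp.
rewrite hecke_inv_nnormal ?qi //; try lia; last first.
  by rewrite /normal_at /interlaced qi; lia.
rewrite (A0 _ q) ?cmp //; last lia.
rewrite mulr0 subr0 /A IH ?size_pswap //; try lia; last first.
  by rewrite -/N qN' cmp /tr eqxx; lia.
rewrite -/N qN' cmp Ei {1}/tr eqxx eqxx; congr (_ * _).
rewrite hecke_inv_normal ?size_pswap // ?pswapK //.
  by rewrite pswap_npair // qi; lia.
have e1 : pt (pswap i q) i = pt q i.+1.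
  by rewrite nth_pswap //; [rewrite {2}/tr eqxx; tr_cases; lia|lia].
have e2 : pt (pswap i q) i.+1 = N.
  rewrite nth_pswap // {2}/tr ifF ?eqxx ?qi; last lia.
  by tr_cases; lia.
by rewrite /normal_at /interlaced e1 e2; lia.
Qed.

(** At most one alpha_k reacts, the one selected by the partner of the last strand. So z times the
    sum is the projection onto pairings joining the last strand to the block, for functions already
    killing pairs among the other strands. *)
Lemma calpha_sum o n h q : zz s != 0 -> (1 <= n)%N -> pairing q -> (o + n <= size q)%N ->
  (forall q', pairing q' -> size q' = size q -> block_pairs o n.-1 q' -> h q' = 0) ->
  h q - z * \sum_(0 <= j < n.-1) bcomb s o (calpha_aux s n j) h q =
  if block_pairs o n q then 0 else h q.
Proof.
move=> z0 Hn Hq sz Hh; set N := (o + n).-1.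
have Nsz : (N < size q)%N by rewrite /N; lia.
have Nb : (o <= N < o + n)%N by rewrite /N; lia.
case: (boolP (block_pairs o n.-1 q)) => Hin.
  rewrite big1_seq ?Hh ?mulr0 ?subr0 ?if_same // => j.
  by rewrite mem_index_iota /= => Hj; apply: calpha_vanish => //; lia.
case: (boolP (o <= pt q N < N)%N) => HN.
  rewrite ifT; last first.
    by apply/block_pairsP; exists N; split=> //; move: HN; rewrite /N; lia.
  (* The element with index j detects the partner o + n - (j + 2) = N - 1 - j, which is solved for
     j. *)
  have Hj0 : ((N - pt q N).-1 < n.-1)%N by move: HN; rewrite /N; lia.
  have J0 (j : nat) : j != (N - pt q N).-1 -> (j < n.-1)%N ->
      bcomb s o (calpha_aux s n j) h q = 0.
    move=> jn Hj; have Hj2 : (j.+2 <= n)%N by lia.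
    rewrite calpha_single // ifF //.
    by apply/negbTE; move: HN jn; rewrite -/N /N; lia.
  rewrite (bigD1_seq (N - pt q N).-1) ?iota_uniq ?mem_index_iota //=.
  rewrite big1_seq => [|j /andP[jn]]; last by rewrite mem_index_iota => /andP[_]; apply: J0.
  have Hj2 : ((N - pt q N).-1.+2 <= n)%N by lia.
  rewrite calpha_single // ifT; last by move: HN; rewrite -/N /N; lia.
  by rewrite addr0 mulVKf ?subrr.
rewrite big1_seq ?mulr0 ?subr0 => [|j]; last first.
  rewrite mem_index_iota => /andP[_ Hj]; apply: calpha_eq0 => //; first lia.
  by move: HN; rewrite -/N; lia.
rewrite ifF //; apply/negbTE/negP => /block_pairsP[k [Hk Hpk]].
have Npk : pt q N != N by apply: pairing_neq.
have [kN|kN] := eqVneq k N; first by move: HN Hpk Npk; rewrite kN /N; lia.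
have [pkN|pkN] := eqVneq (pt q k) N.
  have EN : pt q N = k by rewrite -pkN pairingK //; lia.
  by move: HN kN; rewrite EN /N; lia.
by move/negP: Hin; apply; apply/block_pairsP; exists k; move: kN pkN; rewrite /N; lia.
Qed.

End Alpha.

(** * The symmetrizer L *)

Definition braid_at (o : nat) (v : seq nat) : fword := [seq Cr (i + o) | i <- v].

Lemma shift_braid o v : map (shift_ev o) (map Cr v) = braid_at o v.
Proof. by rewrite -map_comp. Qed.

Section Gamma.
Local Open Scope ring_scope.
Variables (F : fieldType) (s : F).
Local Notation z := (zz s).

(** Crossings inside the block do not change whether it contains a pair, so a braid word only
    evaluates its argument on pairings of the same kind as q. *)
Lemma bword_braid_eq_in o n v b f g q : all (fun i => i.+1 < n)%N v -> pairing q ->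
  (o + n <= size q)%N -> block_pairs o n q = b ->
  (forall q', pairing q' -> size q' = size q -> block_pairs o n q' = b -> f q' = g q') ->
  bword s (braid_at o v) f q = bword s (braid_at o v) g q.
Proof.
elim: v q => [|i v IH] q /=; first by move=> _ Hq _ Hb; apply.
move=> /andP[Hi Hv] Hq sz Hb fg.
have Hi' : ((i + o).+1 < size q)%N by lia.
have IHp : bword s (braid_at o v) f (pswap (i + o) q) =
           bword s (braid_at o v) g (pswap (i + o) q).
  apply: IH => //; rewrite ?size_pswap //; first exact: pairing_pswap.
  by rewrite block_pairs_pswap //; lia.
by rewrite -![if _ then _ else 0]/(bev s (Cr (i + o)) _ q) !bev_cr // IHp IH.
Qed.

Lemma bword0 w q : bword s w (fun=> 0) q = 0.
Proof.
elim: w q => //= e w IH q; rewrite (bev_ext s e (g := fun=> 0)) //.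
by case: e => [i|i a b|i|i k o] /=; rewrite ?mulr0 ?addr0 ?if_same ?addr0 ?if_same.
Qed.

(** Later factors stand further left, so the crossings are read with increasing heights: one strand
    descends to the bottom across j others. *)
Lemma sigma_prod n j : (j < n)%N ->
  foldl (@cmul F) (cone F) [seq csigma F (n - m) | m <- iota 1 j] =
  [:: (1, map Cr (iota (n.-1 - j) j))].
Proof.
elim: j => // j IH Hj.
rewrite -[X in iota 1 X]addn1 iotaD map_cat foldl_cat IH /=; last lia.
rewrite /cmul /= mulr1; congr [:: (_, _)].
have -> : (n.-1 - j = (n.-1 - j.+1).+1)%N by lia.
by congr (Cr _ :: _); lia.
Qed.

Lemma cgammaE o n f q : (0 < n)%N -> bcomb s o (cgamma s n) f q =
  \sum_(0 <= j < n) s ^+ j * bword s (braid_at o (iota (n.-1 - j) j)) f q.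
Proof.
move=> Hn; rewrite bcomb_cat bcomb_one bcomb_flatten big_map.
rewrite big_ltn // expr0 mul1r; congr (_ + _).
rewrite /index_iota subn1; apply: eq_big_seq => j; rewrite mem_iota => Hj.
rewrite bcomb_scale sigma_prod; last lia.
by rewrite /bcomb big_seq1 mul1r shift_braid.
Qed.

(** The action of gamma_2 ... gamma_{m+1}; the last factor is leftmost in the front and hence
    outermost here. *)
Fixpoint bsym (o m : nat) (g : seq nat -> F) : seq nat -> F :=
  if m is m'.+1 then bcomb s o (cgamma s m'.+2) (bsym o m' g) else g.

(** By induction L_{m+1} already kills pairs among the first m + 1 strands, and the next beta
    projects off those of the new strand. The crossings of gamma respect this class of pairings, so
    the projection passes through them. *)
Lemma cL_auxE o m g q : z != 0 -> pairing q -> (o + m.+1 <= size q)%N ->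
  bcomb s o (cL_aux s m) g q = if block_pairs o m.+1 q then 0 else bsym o m g q.
Proof.
move=> z0; elim: m g q => [|m IH] g q Hq sz.
  rewrite bcomb_one ifF //; apply/negbTE/negP => /block_pairsP[k [Hk Hpk]].
  by have := pairing_neq Hq (k := k); lia.
rewrite /= bcomb_mul /cbeta bcomb_mul !cgammaE //.
set h := bcomb s o (cL_aux s m) g; set G := bcomb s o _ h.
have hE q' : pairing q' -> (o + m.+2 <= size q')%N ->
    h q' = if block_pairs o m.+1 q' then 0 else bsym o m g q'.
  by move=> Hq' sz'; apply: IH => //; lia.
have GE q' : pairing q' -> size q' = size q ->
    G q' = if block_pairs o m.+2 q' then 0 else bsym o m g q'.
  move=> Hq' sz'; rewrite /G bcomb_cat bcomb_one bcomb_scale bcomb_flatten big_map mulNr.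
  rewrite -[X in iota X _](addn0 2) iotaDl big_map.
  under eq_bigr => j _ do rewrite /calpha addKn.
  have := @calpha_sum F s o m.+2 h q' z0 isT Hq'; rewrite sz' /index_iota subn0 => -> //.
    case: (boolP (block_pairs o m.+2 q')) => // H; rewrite hE ?sz' // ifF //.
    apply/negbTE; apply: contra H => /block_pairsP[k [Hk Hpk]].
    by apply/block_pairsP; exists k; lia.
  by move=> q2 Hq2 sz2 H2; rewrite hE ?sz2 // H2.
have Hv j : (j < m.+2)%N -> all (fun i => i.+1 < m.+2)%N (iota (m.+1 - j) j).
  by move=> Hj; apply/allP => i; rewrite mem_iota; lia.
case: (boolP (block_pairs o m.+2 q)) => Hb.
  rewrite big1_seq // => j; rewrite mem_index_iota => /andP[_ Hj].
  rewrite (bword_braid_eq_in (n := m.+2) (b := true) (g := fun=> 0)) ?bword0 ?mulr0 ?Hv //.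
  by move=> q' Hq' sz' H'; rewrite GE // H'.
apply: eq_big_seq => j; rewrite mem_index_iota => /andP[_ Hj]; congr (_ * _).
apply: (bword_braid_eq_in (n := m.+2) (b := false)); rewrite ?Hv //; first exact/negbTE.
by move=> q' Hq' sz' H'; rewrite GE // H'.
Qed.

End Gamma.

(** * Hecke algebra action on arrangements *)

Lemma swap_split (T : Type) (x0 : T) i l : i.+1 < size l ->
  exists P x y S, [/\ l = P ++ x :: y :: S, size P = i & swap_at x0 i l = P ++ y :: x :: S].
Proof.
move=> Hi; have E : l = take i l ++ nth x0 l i :: nth x0 l i.+1 :: drop i.+2 l.
  by rewrite -!drop_nth ?cat_take_drop //; lia.
have Es : size (take i l) = i by rewrite size_takel //; lia.
exists (take i l), (nth x0 l i), (nth x0 l i.+1), (drop i.+2 l); split=> //.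
by rewrite [in LHS]E -[X in swap_at _ X _]Es swap_cat.
Qed.

Lemma swap_perm (T : eqType) (x0 : T) i l : i.+1 < size l -> perm_eq (swap_at x0 i l) l.
Proof.
move=> Hi; have [P [x [y [S [E _ ->]]]]] := swap_split x0 Hi; rewrite E.
by rewrite perm_cat2l; apply/permPl; apply: (perm_catCA [:: y] [:: x] S).
Qed.

Lemma index_swap (l : seq nat) i x : uniq l -> i.+1 < size l -> x \in l ->
  index x (swap_at 0 i l) = tr i (index x l).
Proof.
move=> Ul Hi xl; have Us : uniq (swap_at 0 i l) by rewrite (perm_uniq (swap_perm _ Hi)).
have xi : index x l < size l by rewrite index_mem.
have {1}-> : x = nth 0 (swap_at 0 i l) (tr i (index x l)).
  by rewrite nth_swap // trK nth_index.
by rewrite index_uniq // size_swap tr_lt.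
Qed.

Lemma trLo i : tr i i = i.+1. Proof. by tr_cases; lia. Qed.

Lemma trHi i : tr i i.+1 = i. Proof. by tr_cases; lia. Qed.

Lemma tr_inj i : injective (tr i). Proof. exact: inv_inj (trK i). Qed.

Lemma index_map_tr j (l : seq nat) x : index x (map (tr j) l) = index (tr j x) l.
Proof. by rewrite -{1}[x](trK j) index_map //; apply: tr_inj. Qed.

Lemma iota_permP n (r : seq nat) : perm_eq r (iota 0 n) ->
  [/\ size r = n, uniq r & forall x : nat, (x \in r) = (x < n)].
Proof.
move=> H; split; first by rewrite (perm_size H) size_iota.
  by rewrite (perm_uniq H) iota_uniq.
by move=> x; rewrite (perm_mem H) mem_iota.
Qed.

Lemma map_tr_perm n j (r : seq nat) : j.+1 < n -> perm_eq r (iota 0 n) -> perm_eq (map (tr j) r) (iota 0 n).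
Proof.
move=> Hj Hr; have [sz U M] := iota_permP Hr; apply: uniq_perm; rewrite ?iota_uniq //.
  by rewrite map_inj_uniq //; apply: tr_inj.
by move=> x; rewrite -{1}[x](trK j) mem_map ?M ?tr_lt ?mem_iota //; apply: tr_inj.
Qed.

Lemma swap_iota_perm n i (r : seq nat) : i.+1 < n -> perm_eq r (iota 0 n) ->
  perm_eq (swap_at 0 i r) (iota 0 n).
Proof.
move=> Hi Hr; have [sz _ _] := iota_permP Hr.
by apply: perm_trans Hr; apply: swap_perm; rewrite sz.
Qed.

Section Hecke.
Local Open Scope ring_scope.
Variables (F : fieldType) (z : F) (n : nat).

(* hev and lev are the two regular actions of the Hecke algebra; they commute. *)
Definition hev i (f : seq nat -> F) r :=
  f (swap_at 0%N i r) + (if (pt r i.+1 < pt r i)%N then z * f r else 0).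
Definition lev j (f : seq nat -> F) r :=
  f (map (tr j) r) + (if (index j.+1 r < index j r)%N then z * f r else 0).
Definition hword v (f : seq nat -> F) := foldr hev f v.

Lemma hev_lev i j f r : (i.+1 < n)%N -> (j.+1 < n)%N -> perm_eq r (iota 0 n) ->
  hev i (lev j f) r = lev j (hev i f) r.
Proof.
move=> Hi Hj Hr; have [sz U M] := iota_permP Hr.
have Hi' : (i.+1 < size r)%N by rewrite sz.
have E1 : map (tr j) (swap_at 0%N i r) = swap_at 0%N i (map (tr j) r).
  apply: (@eq_from_nth _ 0%N); rewrite !(size_swap, size_map) // => k Hk.
  rewrite [RHS]nth_swap ?size_map // [RHS](nth_map 0%N) ?tr_lt //.
  by rewrite (nth_map 0%N) ?nth_swap ?size_swap.
have jr : j \in r by rewrite M; lia.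
have j1r : j.+1 \in r by rewrite M.
have n1 : nth 0%N (map (tr j) r) i = tr j (pt r i) by rewrite (nth_map 0%N) //; lia.
have n2 : nth 0%N (map (tr j) r) i.+1 = tr j (pt r i.+1) by rewrite (nth_map 0%N).
rewrite /hev /lev E1 !index_swap // n1 n2.
have ab : pt r i != pt r i.+1 by rewrite nth_uniq //; lia.
have [H|H] := boolP (((pt r i == j) && (pt r i.+1 == j.+1)) ||
                     ((pt r i == j.+1) && (pt r i.+1 == j))).
  (* Here exchanging positions and exchanging values are the same move, and both descent tests look
     at the same two entries. *)
  have E2 : swap_at 0%N i r = map (tr j) r.
    apply: (@eq_from_nth _ 0%N); rewrite !(size_swap, size_map) // => k Hk.
    rewrite nth_swap // (nth_map 0%N) //.
    case: (trP i k) => [->|->|k1 k2]; [move: H; tr_cases; lia|move: H; tr_cases; lia|].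
    have a1 : pt r k != pt r i by rewrite nth_uniq //; lia.
    have a2 : pt r k != pt r i.+1 by rewrite nth_uniq.
    by move: H; tr_cases; lia.
  have i1 : (i < size r)%N by lia.
  have := index_uniq 0%N i1 U; have := index_uniq 0%N Hi' U.
  have e1 k : (k.+1 < k)%N = false by rewrite ltnNge leqnSn.
  case/orP: H => /andP[/eqP-> /eqP->] -> ->; rewrite E2 !trLo !trHi !ltnSn !e1; ring.
(* In all other cases neither exchange affects the descent test of the other. *)
have H1 : (tr i (index j.+1 r) < tr i (index j r))%N = (index j.+1 r < index j r)%N.
  have q1 : (index j r = i -> pt r i = j)%N by move=> <-; rewrite nth_index.
  have q2 : (index j r = i.+1 -> pt r i.+1 = j)%N by move=> <-; rewrite nth_index.
  have q3 : (index j.+1 r = i -> pt r i = j.+1)%N by move=> <-; rewrite nth_index.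
  have q4 : (index j.+1 r = i.+1 -> pt r i.+1 = j.+1)%N by move=> <-; rewrite nth_index.
  by move: H q1 q2 q3 q4; tr_cases; lia.
have H2 : (tr j (pt r i.+1) < tr j (pt r i))%N = (pt r i.+1 < pt r i)%N.
  by move: H ab; tr_cases; lia.
by rewrite H1 H2; do ![case: ifP => _]; ring.
Qed.

Lemma hword_eq_in v f g r : all (fun i => i.+1 < n)%N v -> perm_eq r (iota 0 n) ->
  (forall r', perm_eq r' (iota 0 n) -> f r' = g r') -> hword v f r = hword v g r.
Proof.
elim: v r => [|i v IH] r /=; first by move=> _ + ; move=> Hr; apply.
by move=> /andP[Hi Hv] Hr fg; rewrite /hev !IH //; apply: swap_iota_perm.
Qed.

(** Commuting with the action on values is the abstract form of being a multiplication from the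
    other side. *)
Definition lcomm (X : (seq nat -> F) -> seq nat -> F) := forall j f r,
  (j.+1 < n)%N -> perm_eq r (iota 0 n) -> X (lev j f) r = lev j (X f) r.

Lemma lcomm_hword v : all (fun i => i.+1 < n)%N v -> lcomm (hword v).
Proof.
elim: v => [|i v IH] // /andP[Hi Hv] j f r Hj Hr.
rewrite -[LHS]/(hev i (hword v (lev j f)) r) -[hword (i :: v) f]/(hev i (hword v f)).
by rewrite -hev_lev // /hev !(IH Hv) //; apply: swap_iota_perm.
Qed.

Lemma lev_sum (I : eqType) (l : seq I) (c : I -> F) (f : I -> seq nat -> F) j r :
  lev j (fun r => \sum_(k <- l) c k * f k r) r = \sum_(k <- l) c k * lev j (f k) r.
Proof.
rewrite /lev; under [RHS]eq_bigr => k _ do rewrite mulrDr.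
rewrite big_split /=; congr (_ + _); case: ifP => _.
  by rewrite mulr_sumr; apply: eq_bigr => k _; rewrite mulrCA.
by rewrite big1 // => k _; rewrite mulr0.
Qed.

Lemma index_mono_iota r : perm_eq r (iota 0 n) ->
  (forall j, (j.+1 < n)%N -> (index j r < index j.+1 r)%N) -> r = iota 0 n.
Proof.
move=> Hr H; have [sz U M] := iota_permP Hr.
(* The index of x is at least x because the smaller values precede it, and at most x because n - 1 -
   x larger values follow. *)
have ge x : (x < n)%N -> (x <= index x r)%N.
  elim: x => // x IH Hx; apply: leq_ltn_trans (H x Hx); apply: IH; lia.
have le d x : (x + d < n)%N -> (index x r + d <= index (x + d) r)%N.
  elim: d => [|d IH] Hx; first by rewrite !addn0.
  by have := H (x + d)%N; have := IH; rewrite !addnS; move: Hx; lia.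
apply: (@eq_from_nth _ 0%N); rewrite ?size_iota // => x; rewrite sz => Hx.
have e : x = index x r.
  have ni : (index n.-1 r < n)%N by rewrite -{2}sz index_mem M; lia.
  have e : (x + (n.-1 - x))%N = n.-1 by lia.
  by have := le (n.-1 - x)%N x; rewrite e; have := ge x Hx; lia.
by rewrite nth_iota // add0n {1}e nth_index ?M.
Qed.

(** If j + 1 precedes j in r, then f at r is [lev j f] at the list with j and j + 1 exchanged, since
    the z term is absent there. Repeating this leads from r to the increasing list. *)
Lemma lcomm_determined X Y : lcomm X -> lcomm Y ->
  (forall f, X f (iota 0 n) = Y f (iota 0 n)) ->
  forall f r, perm_eq r (iota 0 n) -> X f r = Y f r.
Proof.
(* Putting j in front of j + 1 lowers this weight by the distance between their positions. *)
move=> cX cY XY f r; pose mu r := (\sum_(x < n) x * (n - index (x : nat) r))%N.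
have [m] := ubnP (mu r); elim: m f r => // m IH f r Hm Hr.
have [sz U M] := iota_permP Hr.
case: (boolP (has (fun j => index j.+1 r < index j r)%N (iota 0 n.-1))) => [/hasP[j]|/hasPn H].
  rewrite mem_iota add0n /= => Hj0 Hlt; have Hj : (j.+1 < n)%N by lia.
  have Hr' := map_tr_perm Hj Hr.
  have Er : map (tr j) (map (tr j) r) = r by rewrite -map_comp map_id_in // => x _ /=; rewrite trK.
  have key Z : lcomm Z -> Z f r = Z (lev j f) (map (tr j) r).
    move=> cZ; rewrite cZ // /lev Er ifF ?addr0 // !index_map_tr.
    by apply/negbTE; move: Hlt; tr_cases; lia.
  rewrite (key X) // (key Y) //; apply: IH => //.
  rewrite ltnS in Hm; apply: leq_trans Hm; rewrite /mu.
  have jn : (j < n)%N by lia.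
  have lt1 : (index j r < n)%N by rewrite -sz index_mem M.
  have ji : Ordinal Hj != Ordinal jn by rewrite -val_eqE /=; lia.
  rewrite (bigD1 (Ordinal jn)) // (bigD1 (Ordinal Hj)) //=.
  rewrite [X in (_ < X)%N](bigD1 (Ordinal jn)) // [X in (_ < _ + X)%N](bigD1 (Ordinal Hj)) //=.
  rewrite !index_map_tr; rewrite trLo trHi.
  set A := (\sum_(_ < _ | _) _)%N; set B := (\sum_(_ < _ | _) _)%N.
  have -> : A = B.
    apply: eq_bigr => x; rewrite -!val_eqE /= => /andP[x1 x2].
    by rewrite index_map_tr; congr (_ * (_ - index _ _))%N; tr_cases; lia.
  by move: Hlt lt1; nia.
suff -> : r = iota 0 n by [].
apply: index_mono_iota => // j Hj.
have ne : index j r != index j.+1 r.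
  apply/eqP => /(congr1 (nth 0%N r)); rewrite !nth_index ?M //; lia.
have := H j; rewrite mem_iota add0n => /(_ ltac:(lia)); lia.
Qed.

End Hecke.

(** * Inversions, reduced words and the symmetrizer on lists *)

Fixpoint inversions (u : seq nat) : nat :=
  if u is x :: u' then count (fun y => y < x) u' + inversions u' else 0.

Lemma inversions_rcons u x :
  inversions (rcons u x) = inversions u + count (fun y => x < y) u.
Proof.
elim: u => //= y u ->; rewrite -cats1 count_cat /=; lia.
Qed.

Lemma inversionsE u : inversions u =
  \sum_(0 <= k < size u) \sum_(0 <= l < size u) ((k < l) && (pt u l < pt u k)).
Proof.
elim: u => [|x u IH]; first by rewrite big_nil.
rewrite [size _]/= big_nat_recl // big_nat_recl //= add0n; congr (_ + _).
  rewrite -sum1_count (big_nth 0) big_mkcond /=.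
  by apply: eq_bigr => l _; case: ifP.
by rewrite IH; apply: eq_bigr => k _; rewrite big_nat_recl //= add0n.
Qed.

(** The bound counts an inversion already present in [st] as a crossing that has been made. It
    excludes a descent at the next crossing and is inherited by the rest of the word, so no z term
    ever appears. *)
Lemma hword_reduced (F : fieldType) (z : F) v g (st : seq nat) : uniq st ->
  all (fun i => i.+1 < size st) v ->
  (forall a b, a \in st -> b \in st -> a < b ->
     count (fun pr => (pr == (a, b)) || (pr == (b, a))) (braid_sim st v).1 +
       (index b st < index a st) <= 1) ->
  hword z v g st = g (braid_sim st v).2.
Proof.
elim: v st => [|i v IH] st // U /andP[Hi Hv] H.
rewrite -[LHS]/(hev z i (hword z v g) st) /hev.
have i1 : i < size st by lia.
have [xs ys] : pt st i \in st /\ pt st i.+1 \in st by rewrite !mem_nth.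
have xy : pt st i != pt st i.+1 by rewrite nth_uniq //; lia.
have ltxy : pt st i < pt st i.+1.
  rewrite ltn_neqAle xy leqNgt; apply/negP => lt.
  have := H _ _ ys xs lt; rewrite /= !index_uniq // eqxx orbT ltnSn; lia.
rewrite ltnNge ltnW //= addr0 IH //.
- by rewrite (perm_uniq (swap_perm _ Hi)).
- by rewrite size_swap.
move=> a b; rewrite !(perm_mem (swap_perm _ Hi)) => sa sb ab.
rewrite !index_swap //; move: (H a b sa sb ab) => {H IH Hv} /=.
have [/orP Hp|/norP[n1 n2]] := boolP (_ || _).
  have [-> ->] : a = pt st i /\ b = pt st i.+1.
    by case: Hp => /eqP[E1 E2]; move: ab ltxy; rewrite ?E1 ?E2; lia.
  by rewrite !index_uniq // trLo trHi ltnS leqnn; lia.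
have ni x : x \in st -> index x st = i -> x = pt st i by move=> xst <-; rewrite nth_index.
have nj x : x \in st -> index x st = i.+1 -> x = pt st i.+1.
  by move=> xst <-; rewrite nth_index.
have [/eqP A1|A1] := boolP (index a st == i).
  have {}A1 := ni _ sa A1; have [/eqP B1|B1] := boolP (index b st == i.+1).
    by move: n1; rewrite A1 (nj _ sb B1) eqxx.
  by rewrite A1 index_uniq // trLo; case: (trP i (index b st)) => ?; lia.
have [/eqP A2|A2] := boolP (index a st == i.+1).
  have {}A2 := nj _ sa A2; have [/eqP B1|B1] := boolP (index b st == i).
    by move: n2; rewrite A2 (ni _ sb B1) eqxx.
  by rewrite A2 index_uniq // trHi; case: (trP i (index b st)) => ?; lia.
by move: A1 A2; case: (trP i (index b st)) => ?; case: (trP i (index a st)) => ?; lia.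
Qed.

Section Symmetrizer.
Local Open Scope ring_scope.
Variables (F : fieldType) (s z : F).

Fixpoint hsym (m : nat) (g : seq nat -> F) (r : seq nat) : F :=
  if m is m'.+1 then \sum_(0 <= j < m'.+2) s ^+ j * hword z (iota (m'.+1 - j) j) (hsym m' g) r
  else g r.

(** The entry x only passes larger ones, so no descent is met. *)
Lemma hword_move k j g P x U W : size P = k -> size U = j -> all (fun y => x < y)%N U ->
  hword z (iota k j) g (P ++ x :: U ++ W) = g (P ++ U ++ x :: W).
Proof.
elim: U k j P => [|y U IH] k j P EP EU; first by rewrite -EU.
rewrite -EU -EP => /andP[xy HU] {k j EP EU}.
rewrite -[LHS]/(hev z (size P) (hword z (iota (size P).+1 (size U)) g)
  (P ++ x :: y :: U ++ W)) /hev swap_cat.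
have -> : pt (P ++ x :: y :: U ++ W) (size P) = x by rewrite nth_cat ltnn subnn.
have -> : pt (P ++ x :: y :: U ++ W) (size P).+1 = y.
  by rewrite nth_cat ltnNge leqnSn /= subSnn.
rewrite ltnNge ltnW //= addr0.
by rewrite -cat_rcons (IH (size P).+1) ?size_rcons // cat_rcons.
Qed.

(** Permutations of u grouped by their last entry, which is the entry that a term of gamma carries
    to the end. *)
Definition decap (u : seq nat) : seq (seq nat) :=
  [seq rcons u' (pt u k) | k <- iota 0 (size u), u' <- permutations (take k u ++ drop k.+1 u)].

Lemma perm_decap u : uniq u -> u != [::] -> perm_eq (permutations u) (decap u).
Proof.
move=> U u0; have split k : (k < size u)%N -> u = take k u ++ pt u k :: drop k.+1 u.
  by move=> Hk; rewrite -drop_nth // cat_take_drop.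
have splitp k : (k < size u)%N -> perm_eq u (pt u k :: take k u ++ drop k.+1 u).
  move=> Hk; rewrite {1}(split k Hk); apply/permPl.
  exact: (perm_catCA (take k u) [:: pt u k]).
apply: uniq_perm; first exact: permutations_uniq.
  apply: allpairs_uniq_dep; first exact: iota_uniq.
    by move=> k _; apply: permutations_uniq.
  move=> x y /allpairsPdep[k [u1 [Hk Hu1 ->]]] /allpairsPdep[l [u2 [Hl Hu2 ->]]] /=.
  move=> /rcons_inj[-> /eqP]; rewrite nth_uniq //; first by move/eqP->.
    by move: Hk; rewrite mem_iota.
  by move: Hl; rewrite mem_iota.
move=> v; rewrite mem_permutations; apply/idP/allpairsPdep.
  case/lastP: v => [|v x]; first by rewrite perm_sym => /perm_nilP E; rewrite E in u0.
  move=> Hv; have xu : x \in u by rewrite -(perm_mem Hv) mem_rcons mem_head.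
  have Hk : (index x u < size u)%N by rewrite index_mem.
  exists (index x u), v; split; rewrite ?mem_iota ?nth_index // mem_permutations.
  rewrite -(perm_cons x) -perm_rcons; apply: perm_trans Hv _.
  by have := splitp _ Hk; rewrite nth_index.
move=> [k [v' [Hk Hv ->]]]; rewrite mem_iota /= add0n in Hk; rewrite mem_permutations in Hv.
by rewrite perm_rcons perm_sym; apply: perm_trans (splitp _ Hk) _; rewrite perm_cons perm_sym.
Qed.

(** In a sorted list, carrying an entry to the end passes exactly the larger entries: each gives a
    factor s and one inversion with the last entry. The remaining list is still sorted, so the next
    gamma acts in the same way. *)
Lemma hsymE m g u w : size u = m.+1 -> sorted ltn u ->
  hsym m g (u ++ w) = \sum_(u' <- permutations u) s ^+ inversions u' * g (u' ++ w).
Proof.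
elim: m u w => [|m IH] u w Eu Su.
  case: u Eu Su => [|x [|y u]] //= _ _.
  by rewrite -[permutations _]/[:: [:: x]] big_seq1 mul1r.
have U : uniq u by apply: sorted_uniq Su; [exact: ltn_trans|exact: ltnn].
rewrite (perm_big _ (perm_decap U _)); last by case: u Eu {Su U}.
rewrite /decap big_allpairs_dep Eu -[iota 0 m.+2]/(index_iota 0 m.+2) [LHS]/=.
(* The terms of gamma are indexed by the number of entries passed, [decap] by the position k of the
   moved entry; the two add up to m + 1. *)
rewrite big_nat_rev /= add0n; apply: eq_big_seq => k; rewrite mem_index_iota => /andP[_ Hk].
have -> : (m.+2 - k.+1 = m.+1 - k)%N by lia.
have -> : (m.+1 - (m.+1 - k) = k)%N by lia.
have Hk' : (k < size u)%N by rewrite Eu.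
set x := pt u k.
have Hx : all (fun y => x < y)%N (drop k.+1 u).
  have := drop_sorted k Su; rewrite (drop_nth 0%N) // => /= /order_path_min; apply.
  exact: ltn_trans.
have Hx' : all (fun y => y < x)%N (take k u).
  have : sorted ltn (take k u ++ x :: drop k.+1 u) by rewrite -drop_nth // cat_take_drop.
  rewrite (sorted_pairwise ltn_trans) pairwise_cat allrel_consr => /and3P[/andP[+ _] _ _].
  by [].
have EuW : u ++ w = take k u ++ x :: drop k.+1 u ++ w.
  by rewrite -cat_cons catA -drop_nth // cat_take_drop.
rewrite {1}EuW hword_move ?size_drop ?size_takel //; [|lia|lia].
rewrite catA IH; first last.
- rewrite !(sorted_pairwise ltn_trans) in Su *.
  rewrite -[u](cat_take_drop k) (drop_nth 0%N) // in Su.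
  move: Su; rewrite !pairwise_cat allrel_consr /= => /and3P[/andP[_ ->] -> /andP[_ ->]] //.
- by rewrite size_cat size_takel ?size_drop; lia.
rewrite mulr_sumr; apply: eq_big_seq => u' Hu'.
rewrite mulrA -exprD inversions_rcons cat_rcons addnC; congr (s ^+ (_ + _) * _).
rewrite mem_permutations in Hu'; have /seq.permP -> := Hu'.
rewrite count_cat (_ : count _ (take k u) = 0)%N; last first.
  by apply/eqP; rewrite eqn0Ngt -has_count -all_predC; apply: sub_all Hx' => y /=; lia.
by rewrite add0n; move: Hx; rewrite all_count => /eqP ->; rewrite size_drop Eu; lia.
Qed.

(** Entry k is the left endpoint of the strand ending at height k, as in the final list of
    [braid_sim]; hence the inverse of b. *)
Definition arrangement n (b : 'S_n) : seq nat := [seq ((b^-1)%g k : nat) | k <- enum 'I_n].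

Lemma size_arrangement n (b : 'S_n) : size (arrangement b) = n.
Proof. by rewrite size_map size_enum_ord. Qed.

Lemma nth_arrangement n (b : 'S_n) (k : 'I_n) : pt (arrangement b) k = (b^-1)%g k.
Proof. by rewrite (nth_map k) ?size_enum_ord // nth_ord_enum. Qed.

Lemma arrangement_perm n (b : 'S_n) : perm_eq (arrangement b) (iota 0 n).
Proof.
apply: uniq_perm; rewrite ?iota_uniq //.
  by rewrite map_inj_uniq ?enum_uniq // => i j /val_inj /perm_inj.
move=> x; rewrite mem_iota /= add0n; apply/mapP/idP => [[k _ ->]|xn]; first exact: ltn_ord.
by exists (b (Ordinal xn)); rewrite ?mem_enum // permK.
Qed.

Lemma inversions_arrangement n (b : 'S_n) : inversions (arrangement b) = lam b.
Proof.
rewrite inversionsE size_arrangement big_mkord.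
under eq_bigr => k _ do rewrite big_mkord.
rewrite pair_big /= /lam -sum1_card big_mkcond /=.
(* An inversion (i, j) of b is the inversion of its inverse at the positions b j < b i. *)
rewrite (reindex (fun ij : 'I_n * 'I_n => (b ij.2, b ij.1))) /=; last first.
  exists (fun kl => ((b^-1)%g kl.2, (b^-1)%g kl.1)) => [[i j] _|[i j] _] /=;
    by rewrite ?permK ?permKV.
rewrite [RHS]big_mkcond /=; apply: eq_bigr => [[i j] _]; rewrite !inE /= !nth_arrangement !permK.
by rewrite andbC; case: ifP.
Qed.

Lemma sum_arrangement n (h : seq nat -> F) :
  \sum_(b : 'S_n) h (arrangement b) = \sum_(u <- permutations (iota 0 n)) h u.
Proof.
have -> : \sum_(b : 'S_n) h (arrangement b) = \sum_(u <- [seq arrangement b | b <- enum {: 'S_n}]) h u.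
  by rewrite big_map big_enum; apply: eq_bigl => b; rewrite inE.
have inj : injective (@arrangement n).
  move=> a b E; apply: invg_inj; apply/permP => k.
  by apply: val_inj; rewrite /= -!nth_arrangement E.
have U : uniq [seq arrangement b | b <- enum {: 'S_n}].
  by rewrite map_inj_uniq // enum_uniq.
apply: perm_big; apply: uniq_perm => //; first exact: permutations_uniq.
(* Both lists have n! entries, so an inclusion without repetitions is enough. *)
apply: (uniq_min_size U _ _).2.
  by move=> u /mapP[b _ ->]; rewrite mem_permutations arrangement_perm.
rewrite size_map -cardE card_Sn size_permutations ?iota_uniq // size_iota //.
Qed.

Lemma ppb_hword n (b : 'S_n) v g : ppb_word b v ->
  all (fun i => i.+1 < n)%N v /\ hword z v g (iota 0 n) = g (arrangement b).
Proof.
case/and3P => Hv /forallP Ha /forallP Hc; split=> //.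
rewrite hword_reduced ?iota_uniq ?size_iota //.
  congr g; apply: (@eq_from_nth _ 0%N).
    rewrite size_arrangement; elim: (v) (iota 0 n) (size_iota 0 n) => //= i w IH st Est.
    by rewrite IH // size_swap.
  move=> k; have -> : size (braid_sim (iota 0 n) v).2 = n.
    by elim: (v) (iota 0 n) (size_iota 0 n) => //= i w IH st Est; rewrite IH // size_swap.
  move=> kn; rewrite -[k]/(val (Ordinal kn)) nth_arrangement.
  by have /eqP := Ha ((b^-1)%g (Ordinal kn)); rewrite permKV.
move=> a a'; rewrite !mem_iota /= !add0n => an an' aa'.
have := Hc (Ordinal an) => /forallP /(_ (Ordinal an')) /implyP /(_ aa') /eqP /= ->.
have idx x : (x < n)%N -> index x (iota 0 n) = x.
  by move=> xn; rewrite -{1}[x]add0n -(nth_iota 0 0 xn) index_uniq ?size_iota ?iota_uniq.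
by rewrite !idx // [(_ < a)%N]ltnNge (ltnW aa') addn0; case: ltnP.
Qed.

End Symmetrizer.

(** * Orbits of a pairing without block pairs *)

Lemma map_swap (f : nat -> nat) i l : i.+1 < size l ->
  map f (swap_at 0 i l) = swap_at 0 i (map f l).
Proof.
move=> Hi; have [P [x [y [S [E EP ->]]]]] := swap_split 0 Hi.
by rewrite E !map_cat /= -EP -(size_map f P) swap_cat.
Qed.

Section Orbit.
Variables (o n : nat) (q : seq nat).
Hypotheses (Hq : pairing q) (sz : o + n <= size q) (nob : ~~ block_pairs o n q).

(* Strand o + k receives the partner that strand o + r_k has in q. *)
Definition rearrange (r : seq nat) : seq nat :=
  mkseq (fun k => if o <= k < o + n then pt q (o + pt r (k - o))
                  else if o <= pt q k < o + n then o + index (pt q k - o) r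
                  else pt q k) (size q).

Lemma size_rearrange r : size (rearrange r) = size q.
Proof. by rewrite size_mkseq. Qed.

Lemma rearrange_in r i : i < n -> pt (rearrange r) (o + i) = pt q (o + pt r i).
Proof.
by move=> Hi; rewrite nth_mkseq ?addKn; [rewrite ifT //; lia|lia].
Qed.

Lemma rearrange_in_out r k a : k < size q -> ~~ (o <= k < o + n) -> pt q k = o + a -> a < n ->
  pt (rearrange r) k = o + index a r.
Proof.
by move=> Hk /negPf Hko E Ha; rewrite nth_mkseq // Hko E addKn ifT //; lia.
Qed.

Lemma rearrange_out r k : k < size q -> ~~ (o <= k < o + n) -> ~~ (o <= pt q k < o + n) ->
  pt (rearrange r) k = pt q k.
Proof. by move=> Hk /negPf H1 /negPf H2; rewrite nth_mkseq // H1 H2. Qed.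

Lemma partner_out i : i < n -> ~~ (o <= pt q (o + i) < o + n).
Proof.
by move=> Hi; apply: contra nob => H; apply/block_pairsP; exists (o + i); rewrite H; lia.
Qed.

Variant place k : Prop :=
| InBlock i of i < n & k = o + i
| PairedToBlock a of a < n & ~~ (o <= k < o + n) & pt q k = o + a
| Outside of ~~ (o <= k < o + n) & ~~ (o <= pt q k < o + n).

Lemma placeP k : place k.
Proof.
case: (boolP (o <= k < o + n)) => H1; first by apply: (@InBlock _ (k - o)); lia.
case: (boolP (o <= pt q k < o + n)) => H2; last exact: Outside.
by apply: (@PairedToBlock _ (pt q k - o)) => //; lia.
Qed.

Lemma pairing_rearrange r : perm_eq r (iota 0 n) -> pairing (rearrange r).
Proof.
move=> /iota_permP[szr U M].
have rn i : i < n -> pt r i < n by move=> Hi; rewrite -M mem_nth // szr.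
have ixn a : a < n -> index a r < n by move=> Ha; rewrite -szr index_mem M.
have all3 k : k < size q -> [/\ pt (rearrange r) k < size q, pt (rearrange r) k != k &
    pt (rearrange r) (pt (rearrange r) k) = k].
  move=> Hk; case: (placeP k) => [i Hi Ek|a Ha ko E|ko qko].
  - have Hp := partner_out (rn _ Hi); rewrite Ek rearrange_in //.
    have lt : pt q (o + pt r i) < size q by apply: pairing_lt => //; have := rn _ Hi; lia.
    split=> //; first by apply/eqP; move: Hp; lia.
    rewrite (@rearrange_in_out r _ (pt r i)) ?rn //.
      by rewrite index_uniq ?szr.
    by rewrite pairingK //; have := rn _ Hi; lia.
  - rewrite (rearrange_in_out _ Hk ko E Ha); have := ixn _ Ha => Hi.
    rewrite rearrange_in // nth_index ?M // -E pairingK //; split=> //; first lia.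
    by apply/eqP; move: ko; lia.
  - rewrite rearrange_out //; have lt := pairing_lt Hq Hk.
    by split; rewrite ?rearrange_out ?pairingK ?pairing_neq.
by split=> k; rewrite !size_rearrange => /all3[].
Qed.

Lemma block_rearrange r i : perm_eq r (iota 0 n) -> i < n ->
  ~~ (o <= pt (rearrange r) (o + i) < o + n).
Proof.
move=> /iota_permP[szr U M] Hi; rewrite rearrange_in // partner_out // -M mem_nth //.
by rewrite szr.
Qed.

Lemma pswap_rearrange r i : perm_eq r (iota 0 n) -> i.+1 < n ->
  pswap (o + i) (rearrange r) = rearrange (swap_at 0 i r).
Proof.
move=> Hr Hi; have [szr U M] := iota_permP Hr.
have rn j : j < n -> pt r j < n by move=> Hj; rewrite -M mem_nth // szr.
apply: (@eq_from_nth _ 0); rewrite size_pswap !size_rearrange // => k Hk.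
rewrite nth_pswap ?size_rearrange //.
case: (placeP k) => [j Hj Ek|a Ha ko E|ko qko].
- have -> : tr (o + i) k = o + tr i j by rewrite Ek; tr_cases; lia.
  have Htr : tr i j < n by rewrite tr_lt.
  rewrite Ek !rearrange_in // nth_swap ?szr //.
  by have := partner_out (rn _ Htr); tr_cases; lia.
- have -> : tr (o + i) k = k by move: ko; tr_cases; lia.
  rewrite !(rearrange_in_out _ Hk ko E Ha) index_swap ?szr ?M //.
  by tr_cases; lia.
- have -> : tr (o + i) k = k by move: ko; tr_cases; lia.
  by rewrite !rearrange_out //; move: qko; tr_cases; lia.
Qed.

Lemma rearrange_iota : rearrange (iota 0 n) = q.
Proof.
apply: (@eq_from_nth _ 0); rewrite !size_rearrange // => k Hk.
case: (placeP k) => [j Hj ->|a Ha ko E|ko qko].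
- by rewrite rearrange_in // nth_iota.
- rewrite (rearrange_in_out _ Hk ko E Ha) E; congr (_ + _).
  by rewrite -{1}[a]add0n -(nth_iota 0 0 Ha) index_uniq ?size_iota ?iota_uniq.
- exact: rearrange_out.
Qed.

(* Cyclic order of the points outside the block, starting just below it. *)
Definition key a := if pt q (o + a) < o then pt q (o + a) + size q else pt q (o + a).

Lemma key_inj a b : a < n -> b < n -> key a = key b -> a = b.
Proof.
move=> Ha Hb; have := partner_out Ha; have := partner_out Hb.
have la : pt q (o + a) < size q by apply: pairing_lt => //; lia.
have lb : pt q (o + b) < size q by apply: pairing_lt => //; lia.
have Ka : pt q (pt q (o + a)) = o + a by rewrite pairingK //; lia.
have Kb : pt q (pt q (o + b)) = o + b by rewrite pairingK //; lia.
move=> h1 h2; rewrite /key => E.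
have E' : pt q (o + a) = pt q (o + b) by move: E; do ![case: ifP => ?]; lia.
by move: Ka; rewrite E' Kb; lia.
Qed.

(** If both partners lie on the same side of the block, normal means nested; if they lie on
    different sides, normal means that i is paired upwards and i + 1 downwards. In each case the
    partner of i + 1 comes first in the cyclic order. *)
Lemma normal_rearrange r i : perm_eq r (iota 0 n) -> i.+1 < n ->
  normal_at (rearrange r) (o + i) = (key (pt r i.+1) < key (pt r i)).
Proof.
move=> Hr Hi; have [szr U M] := iota_permP Hr; have i1 : i < n by lia.
have ai : pt r i < n by rewrite -M mem_nth // szr.
have bi : pt r i.+1 < n by rewrite -M mem_nth // szr.
have ab : key (pt r i) <> key (pt r i.+1).
  by move/key_inj => /(_ ai bi) /eqP; rewrite nth_uniq ?szr //; lia.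
have := partner_out ai; have := partner_out bi.
have la : pt q (o + pt r i) < size q by apply: pairing_lt => //; lia.
have lb : pt q (o + pt r i.+1) < size q by apply: pairing_lt => //; lia.
rewrite /normal_at /interlaced -addnS !rearrange_in // addnS.
by move: ab; rewrite /key; do ![case: ifP => ?]; lia.
Qed.

Definition by_key : seq nat := sort (fun a b => key a <= key b) (iota 0 n).

Lemma by_key_perm : perm_eq by_key (iota 0 n).
Proof. by rewrite perm_sort. Qed.

Lemma key_mono a b : a < n -> b < n ->
  (key (pt by_key a) < key (pt by_key b)) = (a < b).
Proof.
move=> Ha Hb; have [szr U M] := iota_permP by_key_perm.
have srt : sorted (fun a b => key a <= key b) by_key.
  by apply: sort_sorted => x y; apply: leq_total.
have mono i j : i < n -> j < n -> i < j -> key (pt by_key i) < key (pt by_key j).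
  move=> Hi Hj ij; rewrite ltn_neqAle; apply/andP; split.
    apply/eqP => /key_inj; rewrite -!M !mem_nth ?szr // => /(_ isT isT) /eqP.
    by rewrite nth_uniq ?szr //; lia.
  have tr : transitive (fun a b => key a <= key b) by move=> x y w; apply: leq_trans.
  by apply: (sorted_ltn_nth tr 0 srt); rewrite ?inE ?szr.
case: (ltngtP a b) => [ab|ba|->]; [exact: mono|have := mono _ _ Hb Ha ba; lia|lia].
Qed.

(** Entries are ranks in the cyclic order instead of strands of q, so that comparing keys becomes
    comparing entries. *)
Definition place_ranks (k : seq nat) : seq nat := rearrange (map (nth 0 by_key) k).

Definition ranks : seq nat := [seq index a by_key | a <- iota 0 n].

Lemma ranks_perm : perm_eq ranks (iota 0 n).
Proof.
have [szr U M] := iota_permP by_key_perm.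
have E : [seq index a by_key | a <- by_key] = iota 0 n.
  apply: (@eq_from_nth _ 0); rewrite ?size_map ?size_iota // szr => k Hk.
  by rewrite (nth_map 0) ?szr // index_uniq ?szr // nth_iota.
by rewrite -[X in perm_eq _ X]E; apply: perm_map; rewrite perm_sym by_key_perm.
Qed.

Lemma place_ranksE : place_ranks ranks = q.
Proof.
rewrite /place_ranks /ranks -map_comp map_id_in ?rearrange_iota // => a Ha /=.
by rewrite nth_index // (perm_mem by_key_perm).
Qed.

Lemma map_by_key_perm k : perm_eq k (iota 0 n) -> perm_eq (map (nth 0 by_key) k) (iota 0 n).
Proof.
move=> Hk; apply: perm_trans (perm_map _ Hk) _.
have [szr U M] := iota_permP by_key_perm.
by rewrite -{1}szr map_nth_iota0 // take_size by_key_perm.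
Qed.

Section Transfer.
Local Open Scope ring_scope.
Variables (F : fieldType) (s : F).
Local Notation z := (zz s).

(** Block strands are never paired together here, so the crossing never kills the pairing, and its
    normality is a descent of ranks. *)
Lemma bev_place_ranks i f k : (i.+1 < n)%N -> perm_eq k (iota 0 n) ->
  bev s (Cr (i + o)) f (place_ranks k) = hev z i (f \o place_ranks) k.
Proof.
move=> Hi Hk; have Hr := map_by_key_perm Hk; have [szk _ Mk] := iota_permP Hk.
have i1 : (i < n)%N by lia.
rewrite addnC /place_ranks bev_cr; [|exact: pairing_rearrange|rewrite size_rearrange; lia].
rewrite ifF; last by apply/negbTE; have := block_rearrange Hr i1; lia.
rewrite pswap_rearrange // normal_rearrange // -map_swap ?szk // /hev /= /place_ranks addrC.
rewrite !(nth_map 0%N) ?szk // key_mono -?Mk ?mem_nth ?szk //.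
Qed.

Lemma bword_place_ranks v f k : all (fun i => i.+1 < n)%N v -> perm_eq k (iota 0 n) ->
  bword s (braid_at o v) f (place_ranks k) = hword z v (f \o place_ranks) k.
Proof.
elim: v k => [|i v IH] k // /andP[Hi Hv] Hk.
rewrite -[LHS]/(bev s (Cr (i + o)) (bword s (braid_at o v) f) (place_ranks k)).
rewrite bev_place_ranks // -[RHS]/(hev z i (hword z v (f \o place_ranks)) k) /hev /=.
by rewrite !IH //; apply: swap_iota_perm.
Qed.

Lemma hsym_words m j : (m.+1 < n)%N -> (j < m.+2)%N ->
  all (fun i => i.+1 < n)%N (iota (m.+1 - j) j).
Proof. by move=> Hm Hj; apply/allP => i; rewrite mem_iota; lia. Qed.

Lemma bsym_place_ranks m f k : (m < n)%N -> perm_eq k (iota 0 n) ->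
  bsym s o m f (place_ranks k) = hsym s z m (f \o place_ranks) k.
Proof.
elim: m k => // m IH k Hm Hk; rewrite /= cgammaE //; apply: eq_big_seq => j.
rewrite mem_index_iota /= => Hj; congr (_ * _).
rewrite bword_place_ranks ?hsym_words //.
by apply: (@hword_eq_in F z n) => //; [exact: hsym_words|move=> r' Hr'; apply: IH; lia].
Qed.

Lemma lcomm_hsym m : (m < n)%N -> lcomm z n (hsym s z m).
Proof.
elim: m => [|m IH] Hm j f r Hj Hr //=; rewrite lev_sum; apply: eq_big_seq => i.
rewrite mem_index_iota /= => Hi; congr (_ * _).
have Hw := hsym_words Hm Hi.
rewrite -(lcomm_hword z Hw) //; apply: (@hword_eq_in F z n) => // r' Hr'.
by apply: IH => //; lia.
Qed.

(** Both sides commute with exchanges of values, so it suffices to evaluate at the increasing list.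
    There every front of b, whatever its word, yields [arrangement b], and [hsymE] supplies the
    matching powers of s. *)
Lemma bsym_braids (pb : 'S_n -> seq nat) f : (1 <= n)%N -> (forall b, ppb_word b (pb b)) ->
  bsym s o n.-1 f q = \sum_(b : 'S_n) s ^+ lam b * bword s (braid_at o (pb b)) f q.
Proof.
move=> Hn Hpb; rewrite -[q in LHS]place_ranksE bsym_place_ranks ?ranks_perm //; last lia.
have Hall b : all (fun i => i.+1 < n)%N (pb b).
  by have [] := ppb_hword 0 (fun=> 0 : F) (Hpb b).
transitivity (\sum_(b : 'S_n) s ^+ lam b * hword z (pb b) (f \o place_ranks) ranks); last first.
  by apply: eq_bigr => b _; rewrite -bword_place_ranks ?ranks_perm // place_ranksE.
apply: (lcomm_determined (n := n) (z := z) (X := hsym s z n.-1)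
  (Y := fun g r => \sum_(b : 'S_n) s ^+ lam b * hword z (pb b) g r)).
- by apply: lcomm_hsym; lia.
- move=> j g r Hj Hr; rewrite lev_sum; apply: eq_bigr => b _; congr (_ * _).
  exact: lcomm_hword.
- move=> g; rewrite -[iota 0 n in LHS]cats0 hsymE ?size_iota ?iota_ltn_sorted //; last lia.
  under eq_bigr => u _ do rewrite cats0.
  rewrite -(@sum_arrangement F n (fun u => s ^+ inversions u * g u)).
  by apply: eq_bigr => b _; rewrite (ppb_hword z g (Hpb b)).2 inversions_arrangement.
- exact: ranks_perm.
Qed.

End Transfer.
End Orbit.

(** * Runs of a front *)

#[local] Arguments rstep : simpl never.
#[local] Arguments swap_at : simpl never.

Definition state := (seq nat * seq (option nat))%type.

(** Q is required after each event but not at the initial state, just as [rstep] tests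
    reducedness. *)
Fixpoint through (Q : state -> Prop) (s : state) (x : seq (bool * fev)) (s' : state) : Prop :=
  if x is e :: x' then
    exists s1, [/\ rstep false (Some s) e = Some s1, Q s1 & through Q s1 x' s']
  else s = s'.

Definition passes := through (fun=> True).

Lemma through_cat Q s x y s' :
  through Q s (x ++ y) s' <-> exists s1, through Q s x s1 /\ through Q s1 y s'.
Proof.
elim: x s => [|e x IH] s /=; first by split=> [H|[_ [<-]]]; first by exists s.
split=> [[s1 [H1 H2 /IH[s2 [H3 H4]]]]|[s2 [[s1 [H1 H2 H3]] H4]]].
  by exists s2; split=> //; exists s1.
by exists s1; split=> //; apply/IH; exists s2.
Qed.

Lemma through_sub (Q Q' : state -> Prop) s x s' :
  (forall s1, Q s1 -> Q' s1) -> through Q s x s' -> through Q' s x s'.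
Proof.
by move=> QQ; elim: x s => //= e x IH s [s1 [H1 /QQ H2 /IH H3]]; exists s1.
Qed.

Lemma through_passes Q s x s' : through Q s x s' -> passes s x s'.
Proof. exact: through_sub. Qed.

(** A run is determined by its start and its switches, so the intermediate states given for
    different c coincide. *)
Lemma through_all (I : Type) (Q : I -> state -> Prop) s x s' : passes s x s' ->
  (forall c, through (Q c) s x s') -> through (fun s1 => forall c, Q c s1) s x s'.
Proof.
elim: x s => [|e x IH] s //= [s1 [H1 _ H3]] HQ; exists s1.
have HQ' c : Q c s1 /\ through (Q c) s1 x s'.
  by have /= [s2 [E2 HQ2 H]] := HQ c; move: E2; rewrite H1 => -[->].
by split=> // [c|]; [case: (HQ' c)|apply: IH => // c; case: (HQ' c)].
Qed.

Definition run red (s : rstate) (x : seq (bool * fev)) : rstate := foldl (rstep red) s x.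

Lemma run_None red x : run red None x = None.
Proof. by elim: x. Qed.

Lemma run_passes s x s' : run false (Some s) x = Some s' <-> passes s x s'.
Proof.
elim: x s => [|e x IH] s; first by split=> [[]|/= ->].
rewrite -[run _ _ _]/(run false (rstep false (Some s) e) x) /=.
case E : (rstep false (Some s) e) => [s1|]; last first.
  by rewrite run_None; split=> // -[s2 []]; rewrite E.
by rewrite IH; split=> [H|[s2 [H _ H3]]]; [exists s1|move: H; rewrite E => -[->]].
Qed.

Definition reduced (s : state) : Prop := red_ok s.1 s.2.

Lemma rstep_true s e : rstep true (Some s) e =
  if rstep false (Some s) e is Some s1 then if red_ok s1.1 s1.2 then Some s1 else None else None.
Proof.
case: s => p l; rewrite /rstep; case: e => sw e.
by case: (match e with Cr _ => _ | LC _ _ _ => _ | RC _ => _ | Mk _ _ _ => _ end)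
  => [[p' l']|] //=; case: (red_ok _ _).
Qed.

Lemma run_reduced s x s' : run true (Some s) x = Some s' <-> through reduced s x s'.
Proof.
elim: x s => [|e x IH] s; first by split=> [[]|/= ->].
rewrite -[run _ _ _]/(run true (rstep true (Some s) e) x) rstep_true /=.
case E : (rstep false (Some s) e) => [s1|]; last first.
  by rewrite run_None; split=> // -[s2 []].
case R : (red_ok _ _); last first.
  by rewrite run_None; split=> // -[s2 [[<-]]]; rewrite /reduced R.
by rewrite IH; split=> [H|[s2 [[->]]]] //; exists s1.
Qed.

Lemma through_last Q s x s' : Q s -> through Q s x s' -> Q s'.
Proof.
by elim: x s => [|e x IH] s Hs /=; [move=> <-|case=> s1 [_ H1 /(IH _ H1)]].
Qed.

Definition insert2 (i : nat) (a b : option nat) (l : seq (option nat)) :=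
  take i l ++ a :: b :: drop i l.
Definition remove2 (i : nat) (l : seq (option nat)) := take i l ++ drop i.+2 l.

Lemma insert2K i l : i.+1 < size l -> insert2 i (lb l i) (lb l i.+1) (remove2 i l) = l.
Proof.
move=> Hi; have E : size (take i l) = i by rewrite size_takel //; lia.
rewrite /insert2 /remove2 take_cat drop_cat E ltnn subnn take0 cats0 drop0.
by rewrite -!drop_nth ?cat_take_drop //; lia.
Qed.

Definition wf (s : state) : Prop := pairing s.1 /\ size s.2 = size s.1.

Lemma step_cr i sw s s1 : wf s -> rstep false (Some s) (sw, Cr i) = Some s1 ->
  xrel i s.1 s1.1 /\ s1.2 = swap_at None i s.2.
Proof.
case: s s1 => p l [q m] [/= Hp sz]; rewrite /rstep /=.
case: ifP => // /andP[H1 H2]; case: sw; case: ifP => // H3 [<- <-]; split=> //; split=> //.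
  by left.
by right.
Qed.

Lemma step_lc i a b sw s s1 : rstep false (Some s) (sw, LC i a b) = Some s1 ->
  [/\ i <= size s.1, s1.1 = pins i s.1 & s1.2 = insert2 i a b s.2].
Proof.
by case: s s1 => p l [q m]; rewrite /rstep /=; case: ifP => // /andP[_ H] [<- <-].
Qed.

Lemma step_rc i sw s s1 : rstep false (Some s) (sw, RC i) = Some s1 ->
  [/\ i.+1 < size s.1, pt s.1 i = i.+1, s1.1 = prem i s.1 & s1.2 = remove2 i s.2].
Proof.
by case: s s1 => p l [q m]; rewrite /rstep /=; case: ifP => // /and3P[_ H /eqP E] [<- <-].
Qed.

Lemma step_mk i k o sw s s1 : rstep false (Some s) (sw, Mk i k o) = Some s1 ->
  s1.1 = s.1 /\ s1.2 = take i s.2 ++ nseq k o ++ drop (i + k) s.2.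
Proof. by case: s s1 => p l [q m]; rewrite /rstep /=; case: ifP => // _ [<- <-]. Qed.

Definition lstep (l : seq (option nat)) (e : fev) : seq (option nat) :=
  match e with
  | Cr i => swap_at None i l
  | LC i a b => insert2 i a b l
  | RC i => remove2 i l
  | Mk i k o => take i l ++ nseq k o ++ drop (i + k) l
  end.

Definition geometric (e : fev) : bool := if e is Mk _ _ _ then false else true.

Lemma step_lab sw e s s1 : rstep false (Some s) (sw, e) = Some s1 -> s1.2 = lstep s.2 e.
Proof.
case: s s1 => p l [q m]; case: e => [i|i a b|i|i k o]; rewrite /rstep /=; do ![case: ifP => // _];
  by case=> _ <-.
Qed.

Lemma step_wf sw e s s1 : wf s -> geometric e -> rstep false (Some s) (sw, e) = Some s1 -> wf s1.
Proof.
move=> Hs; have [Hp Hl] := Hs; case: e => [i|i a b|i|i k o] // _.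
- move=> /(step_cr Hs)[H E]; split; first exact: xrel_pairing H.
  by rewrite E size_swap (xrel_size H).
- move=> /step_lc[H E1 E2]; split; rewrite E1 ?E2; first exact: pairing_pins.
  by rewrite size_pins size_cat /= size_take size_drop Hl; case: ifP => ?; lia.
- move=> /step_rc[H1 H2 E1 E2]; split; rewrite E1 ?E2; first exact: pairing_prem.
  by rewrite size_prem size_cat size_take size_drop Hl; case: ifP => ?; lia.
Qed.

Lemma passes_lab s x s' : passes s x s' -> s'.2 = foldl lstep s.2 (unzip2 x).
Proof.
elim: x s => [|[sw e] x IH] s /=; first by move=> ->.
by move=> [s1 [/step_lab E _ /IH]]; rewrite E.
Qed.

Lemma passes_wf s x s' : wf s -> all geometric (unzip2 x) -> passes s x s' -> wf s'.
Proof.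
elim: x s => [|[sw e] x IH] s Hs /=; first by move=> _ <-.
by move=> /andP[He Hx] [s1 [/(step_wf Hs He) H _]]; apply: IH.
Qed.

Definition nopair c (p : seq nat) (l : seq (option nat)) : Prop :=
  forall k, k < size p -> lb l k = c -> lb l (pt p k) = c -> False.

Definition unpaired c (s : state) : Prop := nopair c s.1 s.2.

Lemma reducedP s : wf s -> reduced s <-> forall c, unpaired (Some c) s.
Proof.
case=> Hp Hl; split=> [/allP H c k Hk E1 E2|H].
  have := H k; rewrite mem_iota => /(_ Hk) /orP[/eqP|/eqP]; last by rewrite E1 E2.
  by rewrite E1.
apply/allP => k; rewrite mem_iota => Hk; case E : (lb s.2 k) => [c|//].
by apply/orP; right; apply/eqP => E'; apply: (H c k).
Qed.

Lemma unpaired_notin c s : wf s -> c \notin s.2 -> unpaired c s.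
Proof.
by case=> _ Hl /negP H k Hk E _; apply: H; rewrite -E mem_nth // Hl.
Qed.

Lemma swap_labK i (l : seq (option nat)) : i.+1 < size l -> swap_at None i (swap_at None i l) = l.
Proof.
move=> Hi; apply: (@eq_from_nth _ None); rewrite !size_swap // => k Hk.
by rewrite !nth_swap ?size_swap // trK.
Qed.

(** A non-switch carries the pairs along with the labels. A switch keeps the pairing and moves only
    two labels, neither of which is c. *)
Lemma unpaired_cr c i p q l : pairing p -> size l = size p -> xrel i p q -> lb l i <> c -> lb l i.+1 <> c ->
  nopair c p l -> nopair c q (swap_at None i l).
Proof.
move=> Hp Hl Hx n1 n2 H k; have [Hi Hni Hor] := Hx.
have Hi' : i.+1 < size l by rewrite Hl.
rewrite (xrel_size Hx) !nth_swap // => Hk E1 E2.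
case: Hor => [[Eq _]|Eq]; subst q; last first.
  rewrite (nth_pswap i Hk) trK in E2.
  by apply: (H (tr i k)) => //; rewrite tr_lt.
have out x : lb l (tr i x) = c -> tr i x = x.
  by case: (trP i x).
move: E1 E2; move=> /[dup] /out -> E1 /[dup] /out -> E2; exact: (H k).
Qed.

Lemma unpaired_cr_iff c i p q l : pairing p -> size l = size p -> xrel i p q -> lb l i <> c -> lb l i.+1 <> c ->
  nopair c p l <-> nopair c q (swap_at None i l).
Proof.
move=> Hp Hl Hx n1 n2; split; first exact: unpaired_cr.
have [Hi _ _] := Hx; have Hi' : i.+1 < size l by rewrite Hl.
rewrite -{2}[l](@swap_labK i) //; apply: unpaired_cr.
- exact: xrel_pairing Hx.
- by rewrite size_swap (xrel_size Hx).
- exact: xrel_sym.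
- by rewrite nth_swap // /tr eqxx.
- by rewrite nth_swap // /tr eqxx; case: ifP => // /eqP; lia.
Qed.

Lemma nth_insert2 i a b l k : i <= size l ->
  [/\ lb (insert2 i a b l) i = a, lb (insert2 i a b l) i.+1 = b &
      lb (insert2 i a b l) (lift2 i k) = lb l k].
Proof.
move=> Hi; have E : size (take i l) = i by rewrite size_takel.
split; rewrite nth_cat E; first by rewrite ltnn subnn.
  by rewrite ltnNge leqnSn /= subSnn.
rewrite /lift2; case: (ltnP k i) => H; first by rewrite H nth_take.
rewrite ifF; last lia.
by have -> : k.+2 - i = (k - i).+2; [lia|rewrite /= nth_drop subnKC].
Qed.

Lemma unpaired_pins c i a b p l : pairing p -> size l = size p -> i <= size p ->
  nopair c (pins i p) (insert2 i a b l) -> nopair c p l.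
Proof.
move=> Hp Hl Hi H k Hk E1 E2; have Hi' : i <= size l by rewrite Hl.
have h1 : lift2 i k < size (pins i p) by rewrite size_pins lift2_lt.
have [_ _ e1] := nth_insert2 a b k Hi'; have [_ _ e2] := nth_insert2 a b (pt p k) Hi'.
by apply: (H _ h1); rewrite ?nth_pins_lift // ?e1 ?e2.
Qed.

Lemma unpaired_pins_iff c i a b p l : pairing p -> size l = size p -> i <= size p -> a <> c -> b <> c ->
  nopair c p l <-> nopair c (pins i p) (insert2 i a b l).
Proof.
move=> Hp Hl Hi ac bc; split; last exact: unpaired_pins.
have Hi' : i <= size l by rewrite Hl.
move=> H k; rewrite size_pins => Hk; case: (lift2P i k) => [->|->|[j Ej _]].
- by have [-> _ _] := nth_insert2 a b 0 Hi'.
- by have [_ -> _] := nth_insert2 a b 0 Hi'.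
move: Hk; rewrite Ej lift2_lt // => Hj; rewrite nth_pins_lift //.
have [_ _ ->] := nth_insert2 a b j Hi'; have [_ _ ->] := nth_insert2 a b (pt p j) Hi'.
exact: H.
Qed.

(** Read backwards, a right cusp inserts a pair; facts about left cusps thus apply to it. *)
Lemma rc_state i s s1 sw : wf s -> rstep false (Some s) (sw, RC i) = Some s1 ->
  i <= size s1.1 /\ s = (pins i s1.1, insert2 i (lb s.2 i) (lb s.2 i.+1) s1.2).
Proof.
case: s s1 => p l [q m] [/= Hp Hl] H; have [/= H1 H2 -> ->] := step_rc H.
by rewrite size_prem pinsK ?insert2K ?Hl //; split=> //; lia.
Qed.

(** No event involves a strand labelled c. Markers are excluded because they relabel strands. *)
Fixpoint avoids c (l : seq (option nat)) (w : fword) : Prop :=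
  if w is e :: w' then
    match e with
    | Cr i | RC i => lb l i <> c /\ lb l i.+1 <> c
    | LC i a b => a <> c /\ b <> c
    | Mk _ _ _ => False
    end /\ avoids c (lstep l e) w'
  else True.

Lemma through_avoids c s x s' : wf s -> passes s x s' -> avoids c s.2 (unzip2 x) ->
  (unpaired c s <-> unpaired c s') /\ (unpaired c s -> through (unpaired c) s x s').
Proof.
elim: x s => [|[sw e] x IH] s Hs /=; first by move=> ->.
move=> [s1 [H1 _ H3]] [He Ha].
have Hg : geometric e by case: e He {H1 Ha}.
have Hs1 := step_wf Hs Hg H1.
rewrite -(step_lab H1) in Ha; have [IH1 IH2] := IH _ Hs1 H3 Ha.
suff E : unpaired c s <-> unpaired c s1.
  by split; [rewrite E|move=> /E H; exists s1; split=> //; apply: IH2].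
case: e He H1 {Ha Hg} => [i|i a b|i|//] [n1 n2] H1.
- have [X E] := step_cr Hs H1; rewrite /unpaired E; case: Hs => Hp Hl.
  exact: unpaired_cr_iff.
- have [Hi E1 E2] := step_lc H1; rewrite /unpaired E1 E2; case: Hs => Hp Hl.
  exact: unpaired_pins_iff.
- have [Hi E] := rc_state Hs H1; rewrite E; case: Hs1 => Hp Hl.
  by symmetry; apply: unpaired_pins_iff.
Qed.

(** * Crossing gadgets *)

(** The invariant inside a gadget that carries a-strands down past b-strands. Its second clause
    keeps the a-end of a joining pair on top, which excludes the switches that would produce a pair
    inside the block c. *)
Definition good c a b (p : seq nat) (l : seq (option nat)) : Prop :=
  nopair c p l /\
  forall k, k < size p -> lb l k = a -> lb l (pt p k) = b -> k < pt p k.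

Definition region lo hi a b (l : seq (option nat)) : Prop :=
  forall k, k < size l -> (lo <= k < hi) = ((lb l k == a) || (lb l k == b)).

(* A switch creating a forbidden pair would, by normality, put one partner strictly between the
   crossing and the other partner, hence inside the region, where [good] already rules it out. *)
Lemma good_cr c a b lo hi i p q l : pairing p -> size l = size p -> a <> b ->
  c = a \/ c = b -> region lo hi a b l -> lb l i = a -> lb l i.+1 = b ->
  good c a b p l -> xrel i p q -> good c a b q (swap_at None i l).
Proof.
move=> Hp Hl ab Hc Hr la lb' [Hn Ho] [Hi Hpi [[-> Hnorm]|->]]; last first.
  have Hi' : i.+1 < size l by rewrite Hl.
  split=> k; rewrite size_pswap => Hk; rewrite nth_pswap // !nth_swap // trK => E1 E2.
    by apply: (Hn (tr i k)); rewrite ?tr_lt.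
  have Hk' : tr i k < size p by rewrite tr_lt.
  have := Ho _ Hk' E1 E2; move: Hpi.
  set k' := tr i k in Hk' E1 E2 *; have -> : k = tr i k' by rewrite trK.
  case: (trP i k') => [->|->|h1 h2]; case: (trP i (pt p _)) => ?; lia.
have Hi' : i.+1 < size l by rewrite Hl.
have i1 : i < size p by lia.
set x := pt p i in Hpi *; set y := pt p i.+1.
have xs : x < size p by apply: pairing_lt.
have ys : y < size p by apply: pairing_lt.
have px : pt p x = i by rewrite pairingK.
have py : pt p y = i.+1 by rewrite pairingK.
have xi : x != i by apply: pairing_neq.
have yi : y != i.+1 by apply: pairing_neq.
have yi' : y != i by apply/eqP => E; move: py; rewrite E -/x => /eqP; rewrite (negPf Hpi).
have xy : x != y by apply/eqP => E; move: px; rewrite E py; lia.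
have Ri : lo <= i < hi by rewrite Hr ?Hl // la eqxx.
have Ri' : lo <= i.+1 < hi by rewrite Hr ?Hl // lb' eqxx orbT.
have Hnorm' : ~~ interlaced (minn i x) (maxn i x) (minn i.+1 y) (maxn i.+1 y) by [].
have lx_b : lb l x = b -> i < x by apply: Ho.
have ly_a : lb l y = a -> y < i.+1 by move=> E; have := Ho y ys E; rewrite py; apply.
have no_aa : c = a -> lb l x <> a by move=> Ec E; apply: (Hn i); rewrite ?Ec.
have no_bb : c = b -> lb l y <> b by move=> Ec E; apply: (Hn i.+1); rewrite ?Ec.
(* A partner y in the region above the crossing would, by normality, force x between y and i, where
   either label of x contradicts [good]. *)
have F1 : c = a -> (lb l y == a) || (lb l y == b) -> ~~ (y < i).
  move=> Ec; rewrite -Hr ?Hl // => Ry; apply/negP => iy.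
  have yx : y < x < i by move: Hnorm' Hpi xi xy iy; rewrite /interlaced; lia.
  have : (lb l x == a) || (lb l x == b) by rewrite -Hr ?Hl //; lia.
  case/orP => /eqP Ex; first exact: no_aa Ex.
  by have := lx_b Ex; lia.
have F2 : c = b -> (lb l x == a) || (lb l x == b) -> ~~ (i.+1 < x).
  move=> Ec; rewrite -Hr ?Hl // => Rx; apply/negP => ix.
  have yx : i.+1 < y < x by move: Hnorm' yi yi' xy ix; rewrite /interlaced; lia.
  have : (lb l y == a) || (lb l y == b) by rewrite -Hr ?Hl //; lia.
  case/orP => /eqP Ey; last exact: no_bb Ey.
  by have := ly_a Ey; lia.
have L k : k < size p -> [\/ [/\ k = i & lb (swap_at None i l) k = b],
    [/\ k = i.+1 & lb (swap_at None i l) k = a] |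
    [/\ k <> i, k <> i.+1 & lb (swap_at None i l) k = lb l k]].
  move=> Hk; rewrite nth_swap //.
  by case: (trP i k) => [->|->|/eqP h1 /eqP h2]; [constructor 1|constructor 2|constructor 3].
have ba : b <> a by move/esym.
have Xi : [/\ x <> i, x <> i.+1 & lb (swap_at None i l) x = lb l x].
  by case: (L x xs) => [[E _]|[E _]|//]; move: xi Hpi; rewrite E eqxx.
have Yi : [/\ y <> i, y <> i.+1 & lb (swap_at None i l) y = lb l y].
  by case: (L y ys) => [[E _]|[E _]|//]; move: yi yi'; rewrite E eqxx.
case: Xi Yi => x1 x2 ex [y1 y2 ey].
have Xlt : c = b -> lb l x = a \/ lb l x = b -> x < i.
  by move=> Ec E; have := F2 Ec; case: E => ->; rewrite eqxx ?orbT => /(_ isT); lia.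
have Ygt : c = a -> lb l y = a \/ lb l y = b -> i.+1 < y.
  by move=> Ec E; have := F1 Ec; case: E => ->; rewrite eqxx ?orbT => /(_ isT); lia.
have PL k : k < size p -> pt p k < size p by apply: pairing_lt.
split=> k Hk.
  case: (L k Hk) => [[-> ->]|[-> ->]|[k1 k2 ->]].
  - move=> Ec; rewrite -/x ex -Ec => E.
    by have := Xlt (esym Ec); have := lx_b; rewrite E => /(_ erefl) ? /(_ (or_intror erefl)); lia.
  - move=> Ec; rewrite -/y ey -Ec => E.
    by have := Ygt (esym Ec); have := ly_a; rewrite E => /(_ erefl) ? /(_ (or_introl erefl)); lia.
  move=> E1; case: (L _ (PL _ Hk)) => [[Ek ->] Ec|[Ek ->] Ec|[_ _ ->] E2]; last exact: (Hn k).
  - have kx : k = x by rewrite /x -Ek pairingK.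
    by have := Xlt (esym Ec); have := lx_b; rewrite -kx E1 Ec => /(_ erefl) ? /(_ (or_intror erefl)); lia.
  - have ky : k = y by rewrite /y -Ek pairingK.
    by have := Ygt (esym Ec); have := ly_a; rewrite -ky E1 Ec => /(_ erefl) ? /(_ (or_introl erefl)); lia.
case: (L k Hk) => [[-> ->]|[-> ->]|[k1 k2 ->]]; first by move=> /ba.
  move=> _; rewrite -/y ey => E; case: Hc => Ec; first by apply: Ygt => //; right.
  by case: (no_bb Ec).
move=> E1; case: (L _ (PL _ Hk)) => [[Ek ->] _|[Ek ->] //|[_ _ ->]]; last exact: Ho.
have kx : k = x by rewrite /x -Ek pairingK.
rewrite Ek kx; case: Hc => Ec; first by case: (no_aa Ec); rewrite -kx.
by apply: Xlt => //; left; rewrite -kx.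
Qed.

(** Each crossing takes an a-strand down past a b-strand. Apart from their cusps, all gadgets of the
    n-copy have this form. *)
Fixpoint xword a b (l : seq (option nat)) (w : fword) (l' : seq (option nat)) : Prop :=
  if w is e :: w' then
    if e is Cr i then [/\ i.+1 < size l, lb l i = a, lb l i.+1 = b & xword a b (swap_at None i l) w' l']
    else False
  else l = l'.

Lemma xword_cat a b l w1 l1 w2 l2 :
  xword a b l w1 l1 -> xword a b l1 w2 l2 -> xword a b l (w1 ++ w2) l2.
Proof.
elim: w1 l => [|e w1 IH] l /=; first by move=> ->.
by case: e => // i [H1 H2 H3 H4] H5; split=> //; apply: IH.
Qed.

Lemma xword_cons a b P S w l' :
  xword a b (P ++ b :: a :: S) w l' -> xword a b (P ++ a :: b :: S) (Cr (size P) :: w) l'.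
Proof.
move=> H; split; rewrite ?swap_cat ?nth_cat //.
- by rewrite size_cat /=; lia.
- by rewrite ltnn subnn.
- by rewrite ltnNge leqnSn /= subSnn.
Qed.

Lemma xword_up a b P S m :
  xword a b (P ++ nseq m a ++ b :: S) [seq Cr (size P + m.-1 - k) | k <- iota 0 m]
    (P ++ b :: nseq m a ++ S).
Proof.
elim: m S => [|m IH] S //.
have -> : nseq m.+1 a = nseq m a ++ [:: a] by rewrite -addn1 nseqD.
rewrite -!catA /=.
have -> : size P + m - 0 = size (P ++ nseq m a) by rewrite size_cat size_nseq; lia.
rewrite catA; apply: xword_cons; rewrite -catA.
have := IH (a :: S); rewrite (iotaDl 1 0) -map_comp.
rewrite (eq_in_map _ (fun k => Cr (size P + m - (1 + k))) _).1 // => k.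
by rewrite mem_iota => Hk /=; congr Cr; lia.
Qed.

Lemma xword_down a b P S m :
  xword a b (P ++ a :: nseq m b ++ S) [seq Cr (size P + k) | k <- iota 0 m]
    (P ++ nseq m b ++ a :: S).
Proof.
elim: m P => [|m IH] P //.
rewrite -[iota 0 m.+1]/(0 :: iota 1 m) map_cons addn0; apply: xword_cons.
have := IH (rcons P b); rewrite !cat_rcons (iotaDl 1 0) -map_comp size_rcons.
rewrite (eq_in_map _ ((fun k => Cr (size P + k)) \o addn 1) _).1 // => k _ /=.
by congr Cr; lia.
Qed.

Lemma xword_cross a b P S n i : size P = i * n ->
  xword a b (P ++ nseq n a ++ nseq n b ++ S) (cross_gadget n i) (P ++ nseq n b ++ nseq n a ++ S).
Proof.
move=> EP; rewrite /cross_gadget -EP.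
(* Q absorbs the d b-strands that have already climbed; r of them remain. *)
suff H r d Q : size Q = size P + d -> xword a b (Q ++ nseq n a ++ nseq r b ++ S)
    (flatten [seq [seq Cr (size P + n.-1 + d - k) | k <- iota 0 n] | d <- iota d r])
    (Q ++ nseq r b ++ nseq n a ++ S).
  by apply: H; rewrite addn0.
elim: r d Q => [|r IH] d Q EQ //=.
apply: xword_cat; last first.
  rewrite -[_ ++ b :: _]cat_rcons; apply: IH; rewrite size_rcons EQ addnS //.
rewrite cat_rcons; have := xword_up a b Q (nseq r b ++ S) n.
rewrite (eq_map (g := fun k => Cr (size P + n.-1 + d - k))) // => k.
by rewrite EQ; congr Cr; lia.
Qed.

(** The labels next to n stacked cusps, before the upper and lower branches are separated. *)
Definition alternate (n : nat) (a b : option nat) := flatten (nseq n [:: a; b]).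

#[local] Arguments alternate : simpl never.

Lemma alternateS n a b : alternate n.+1 a b = a :: b :: alternate n a b.
Proof. by []. Qed.

Lemma alternate_rcons n a b : alternate n.+1 a b = alternate n a b ++ [:: a; b].
Proof. by rewrite /alternate -addn1 nseqD flatten_cat. Qed.

Lemma size_alternate n a b : size (alternate n a b) = 2 * n.
Proof. by elim: n => // n IH; rewrite alternateS /= IH; lia. Qed.

Lemma xword_unzip a b P S n i : size P = i * n -> 0 < n ->
  xword b a (P ++ alternate n a b ++ S)
    (flatten [seq [seq Cr (i * n + 2 * d - 1 - k) | k <- iota 0 d] | d <- iota 1 n.-1])
    (P ++ nseq n a ++ nseq n b ++ S).
Proof.
move=> EP; rewrite -EP; case: n {EP} => // n _; rewrite [n.+1.-1]/=.
(* The first d cusps are already sorted into upper and lower branches; r cusps are still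
   alternating. *)
suff H r d : xword b a (P ++ nseq d a ++ nseq d b ++ alternate r a b ++ S)
    (flatten [seq [seq Cr (size P + 2 * d - 1 - k) | k <- iota 0 d] | d <- iota d r])
    (P ++ nseq (d + r) a ++ nseq (d + r) b ++ S).
  by have := H n 1; rewrite add1n.
elim: r d => [|r IH] d; first by rewrite addn0.
rewrite addnS -addSn /=; apply: xword_cat (IH d.+1).
have := xword_up b a (P ++ nseq d a) (b :: alternate r a b ++ S) d.
rewrite (eq_in_map _ (fun k => Cr (size P + 2 * d - 1 - k)) _).1; last first.
  by move=> k; rewrite mem_iota size_cat size_nseq => Hk; congr Cr; lia.
rewrite -!catA -/(alternate r a b).
have -> : nseq d.+1 a = nseq d a ++ [:: a] by rewrite -addn1 nseqD.
have -> : nseq d.+1 b = nseq d b ++ [:: b] by rewrite -addn1 nseqD.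
by rewrite -!catA /=.
Qed.

Lemma xword_zip a b P S n i : size P = i * n -> 0 < n ->
  xword a b (P ++ nseq n a ++ nseq n b ++ S)
    (flatten [seq [seq Cr (i * n + d + k) | k <- iota 0 d] | d <- rev (iota 1 n.-1)])
    (P ++ alternate n a b ++ S).
Proof.
move=> EP; rewrite -EP; case: n {EP} => // n _; rewrite [n.+1.-1]/=.
elim: n S => [|n IH] S //.
rewrite -[X in iota 1 X]addn1 iotaD rev_cat add1n -[rev (iota n.+1 1)]/[:: n.+1] cat1s map_cons -[flatten (_ :: _)]/(_ ++ flatten _).
apply: xword_cat; last first.
  by rewrite alternate_rcons -!catA; apply: IH.
have := xword_down a b (P ++ nseq n.+1 a) ([:: b] ++ S) n.+1.
rewrite (eq_map (g := fun k => Cr (size P + n.+1 + k))); last first.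
  by move=> k; rewrite size_cat size_nseq.
have -> : nseq n.+2 a = nseq n.+1 a ++ [:: a] by rewrite -(addn1 n.+1) nseqD.
have -> : nseq n.+2 b = nseq n.+1 b ++ [:: b] by rewrite -(addn1 n.+1) nseqD.
by rewrite -!catA.
Qed.

Lemma region_swap lo hi a b i l : i.+1 < size l -> lb l i = a -> lb l i.+1 = b ->
  region lo hi a b l -> region lo hi a b (swap_at None i l).
Proof.
move=> Hi Ea Eb H k; rewrite size_swap nth_swap // => Hk.
rewrite -H; last by rewrite tr_lt.
have := H i (ltnW Hi); have := H _ Hi.
by rewrite Ea Eb !eqxx orbT /=; tr_cases; lia.
Qed.

Lemma region_sym lo hi a b l : region lo hi a b l -> region lo hi b a l.
Proof. by move=> H k Hk; rewrite H // orbC. Qed.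

Lemma region_blocks (P S : seq (option nat)) (a b : option nat) n : a \notin P -> b \notin P -> a \notin S -> b \notin S ->
  region (size P) (size P + 2 * n) a b (P ++ nseq n a ++ nseq n b ++ S).
Proof.
move=> aP bP aS bS k; rewrite !size_cat !size_nseq => Hk.
have nin (x : option nat) (T : seq (option nat)) j : x \notin T -> j < size T -> (lb T j == x) = false.
  by move=> /negP H Hj; apply/negP => /eqP E; apply: H; rewrite -E mem_nth.
rewrite !nth_cat !size_nseq !nth_nseq.
case: (ltnP k (size P)) => H1; first by rewrite !nin //; lia.
case: (ltnP (k - size P) n) => H2 /=; first by rewrite eqxx; lia.
case: (ltnP (k - size P - n) n) => H3 /=; first by rewrite eqxx orbT; lia.
by rewrite !nin //; lia.
Qed.

Lemma region_alternate (P S : seq (option nat)) (a b : option nat) n :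
  a \notin P -> b \notin P -> a \notin S -> b \notin S ->
  region (size P) (size P + 2 * n) a b (P ++ alternate n a b ++ S).
Proof.
move=> aP bP aS bS k; rewrite !size_cat size_alternate => Hk.
have nin (x : option nat) (T : seq (option nat)) j : x \notin T -> j < size T -> (lb T j == x) = false.
  by move=> /negP H Hj; apply/negP => /eqP E; apply: H; rewrite -E mem_nth.
rewrite !nth_cat size_alternate.
case: (ltnP k (size P)) => H1; first by rewrite !nin //; lia.
case: (ltnP (k - size P) (2 * n)) => H2; last by rewrite !nin //; lia.
have alt m j : j < 2 * m -> (lb (alternate m a b) j == a) || (lb (alternate m a b) j == b).
  elim: m j => // m IH [|[|j]] Hj; rewrite alternateS /= ?eqxx ?orbT //.
  by apply: IH; lia.
by rewrite alt //; lia.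
Qed.

Lemma xword_geometric a b l w l' : xword a b l w l' -> all geometric w.
Proof. by elim: w l => //= e w IH l; case: e => // i [_ _ _ /IH]. Qed.

Lemma xword_lab a b l w l' : xword a b l w l' -> foldl lstep l w = l'.
Proof. by elim: w l => //= e w IH l; case: e => // i [_ _ _ /IH]. Qed.

Lemma xword_avoids a b c l w l' : a <> c -> b <> c -> xword a b l w l' -> avoids c l w.
Proof.
move=> ac bc; elim: w l => //= e w IH l; case: e => // i [_ -> -> /IH H].
by split.
Qed.

Definition good_at c a b (s : state) := good c a b s.1 s.2.

Lemma xword_forward c a b lo hi s x s' l' : wf s -> passes s x s' -> a <> b -> c = a \/ c = b ->
  region lo hi a b s.2 -> xword a b s.2 (unzip2 x) l' ->
  good_at c a b s -> good_at c a b s' /\ through (unpaired c) s x s'.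
Proof.
move=> Hw Hx ab Hc; elim: x s Hw Hx => [|[sw e] x IH] s Hw /=; first by move=> -> _ _ Hg.
move=> [s1 [H1 _ H3]] Hr; case: e H1 => // i H1 [Hi la lb' Hx] Hg.
have [X E] := step_cr Hw H1; have Hw1 : wf s1 by apply: step_wf H1.
have Hg1 : good_at c a b s1.
  by rewrite /good_at E; case: Hw => Hp Hl; apply: (good_cr Hp Hl ab Hc Hr la lb' Hg X).
rewrite -E in Hx; have [|IH1 IH2] := IH _ Hw1 H3 _ Hx Hg1.
  by rewrite E; apply: region_swap.
by split=> //; exists s1; split=> //; case: Hg1.
Qed.

(** From right to left the crossings take b-strands down past a-strands, so [good_cr] applies with a
    and b exchanged. *)
Lemma xword_backward c a b lo hi s x s' l' : wf s -> passes s x s' -> a <> b -> c = a \/ c = b ->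
  region lo hi a b s.2 -> xword a b s.2 (unzip2 x) l' ->
  good_at c b a s' -> good_at c b a s /\ through (unpaired c) s x s'.
Proof.
move=> Hw Hx ab Hc; elim: x s Hw Hx => [|[sw e] x IH] s Hw /=; first by move=> -> _ _ Hg.
move=> [s1 [H1 _ H3]] Hr; case: e H1 => // i H1 [Hi la lb' Hx] Hg.
have [X E] := step_cr Hw H1; have Hw1 : wf s1 by apply: step_wf H1.
have Hr1 : region lo hi a b s1.2 by rewrite E; apply: region_swap.
rewrite -E in Hx; have [IH1 IH2] := IH _ Hw1 H3 Hr1 Hx Hg.
split; last by exists s1; split=> //; case: IH1.
have [Hp Hl] := Hw; have [Hp1 Hl1] := Hw1.
rewrite /good_at -[s.2](swap_labK Hi) -E.
apply: (good_cr (lo := lo) (hi := hi) Hp1 Hl1) IH1 (xrel_sym Hp X).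
- by move/esym.
- by case: Hc; [right|left].
- exact: region_sym.
- by rewrite E nth_swap // trLo.
- by rewrite E nth_swap // trHi.
Qed.

(** When the whole a-block stands above the b-block, the order clause of [good] holds for free. Both
    ends of a crossing gadget are of this form. *)
Lemma good_above c a b (P S : seq (option nat)) n p : size (P ++ nseq n a ++ nseq n b ++ S) = size p ->
  a <> b -> a \notin P -> b \notin P -> a \notin S -> b \notin S ->
  nopair c p (P ++ nseq n a ++ nseq n b ++ S) -> pairing p ->
  good c a b p (P ++ nseq n a ++ nseq n b ++ S).
Proof.
move=> Hl ab aP bP aS bS Hn Hp; split=> // k Hk Ea Eb.
have loc (x : option nat) (T : seq (option nat)) j : x \notin T -> lb T j = x -> j < size T -> False.
  by move=> /negP H E Hj; apply: H; rewrite -E mem_nth.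
have ha : k < size P + n.
  rewrite ltnNge; apply/negP => H; move: Ea; rewrite -Hl !size_cat !size_nseq in Hk.
  have -> : lb (P ++ nseq n a ++ nseq n b ++ S) k = lb (nseq n b ++ S) (k - size P - n).
    rewrite [LHS]nth_cat ifF; last lia.
    by rewrite [LHS]nth_cat size_nseq ifF //; lia.
  rewrite nth_cat size_nseq nth_nseq.
  case: (ltnP (k - size P - n) n) => H3; first by move/esym.
  by move/loc; apply=> //; lia.
have hb : size P + n <= pt p k; last lia.
rewrite leqNgt; apply/negP => H; move: Eb.
rewrite nth_cat; case: ifP => H1; first by move/loc; apply.
have H2 : pt p k - size P < n by lia.
by rewrite nth_cat size_nseq nth_nseq H2.
Qed.

Lemma unzip2_cat (x : seq (bool * fev)) u v : unzip2 x = u ++ v ->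
  exists x1 x2, [/\ x = x1 ++ x2, unzip2 x1 = u & unzip2 x2 = v].
Proof.
move=> E; exists (take (size u) x), (drop (size u) x); split; first by rewrite cat_take_drop.
  by rewrite /unzip2 map_take -/(unzip2 x) E take_size_cat.
by rewrite /unzip2 map_drop -/(unzip2 x) E drop_size_cat.
Qed.

(** * Cusps: strands paired among themselves *)

Definition closed_on lo hi (p : seq nat) : Prop :=
  forall k, lo <= k < hi -> lo <= pt p k < hi.

Lemma closed_xrel lo hi i p q : pairing p -> hi <= size p -> lo <= i -> i.+1 < hi ->
  xrel i p q -> closed_on lo hi p -> closed_on lo hi q.
Proof.
move=> Hp Hs Hlo Hhi Hx H k Hk; have trin j : (lo <= tr i j < hi) = (lo <= j < hi).
  by tr_cases; lia.
case: Hx => _ _ [[-> _]|->]; first exact: H.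
by rewrite nth_pswap; [rewrite trin H // trin|lia].
Qed.

Lemma closed_pins lo i p : lo <= i -> i <= size p -> closed_on lo i p ->
  closed_on lo i.+2 (pins i p).
Proof.
move=> Hlo Hi H k Hk; have [e1 e2] := nth_pins_new Hi.
case: (lift2P i k) => [->|->|[j Ek ne]]; rewrite ?e1 ?e2; try lia.
have Ej : k = j /\ j < i by move: Ek ne Hk; rewrite /lift2; case: ifP; lia.
have Hj : lo <= pt p j < i by apply: H; lia.
by rewrite Ek nth_pins_lift //; [rewrite /lift2; case: ifP|]; lia.
Qed.

Lemma xword_closed lo hi a b s x s' l' : wf s -> passes s x s' -> hi <= size s.1 ->
  region lo hi a b s.2 -> xword a b s.2 (unzip2 x) l' ->
  closed_on lo hi s.1 <-> closed_on lo hi s'.1.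
Proof.
elim: x s => [|[sw e] x IH] s Hw /=; first by move=> ->.
move=> [s1 [H1 _ H3]] Hs Hr; case: e H1 => // i H1 [Hi la lb' Hx].
have [X E] := step_cr Hw H1; have Hw1 : wf s1 by apply: step_wf H1.
have Hr1 : region lo hi a b s1.2 by rewrite E; apply: region_swap.
have Hs1 : hi <= size s1.1 by rewrite (xrel_size X).
rewrite -E in Hx; rewrite -(IH _ Hw1 H3 Hs1 Hr1 Hx).
have := Hr i (ltnW Hi); have := Hr _ Hi; rewrite la lb' !eqxx orbT => /= R1 R2.
have [Hp _] := Hw; have [Hp1 _] := Hw1.
split; first by apply: (closed_xrel Hp Hs _ _ X); lia.
by apply: (closed_xrel Hp1 Hs1 _ _ (xrel_sym Hp X)); lia.
Qed.

(** A pairing is injective, so mapping n strands into an interval of n strands it fills that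
    interval. *)
Lemma matched_intervals p x y n : pairing p -> x + n <= size p ->
  (forall k, x <= k < x + n -> y <= pt p k < y + n) ->
  forall k, y <= k < y + n -> x <= pt p k < x + n.
Proof.
move=> Hp Hx H k Hk.
have inj : {in iota x n &, injective (fun j => pt p j)}.
  move=> i j; rewrite !mem_iota => Hi Hj E.
  by rewrite -[i](pairingK Hp) ?E ?pairingK //; lia.
have U : uniq [seq pt p j | j <- iota x n] by rewrite map_inj_in_uniq ?iota_uniq.
have sub : {subset [seq pt p j | j <- iota x n] <= iota y n}.
  by move=> _ /mapP[j + ->]; rewrite !mem_iota => /H.
have [|_ E] := uniq_min_size U sub; first by rewrite size_map !size_iota.
have : k \in [seq pt p j | j <- iota x n] by rewrite E mem_iota.
by case/mapP=> j; rewrite mem_iota => Hj ->; rewrite pairingK //; lia.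
Qed.

Lemma block_label (P S : seq (option nat)) a b n k : a <> b ->
  a \notin P -> b \notin P -> a \notin S -> b \notin S ->
  k < size (P ++ nseq n a ++ nseq n b ++ S) ->
  ((lb (P ++ nseq n a ++ nseq n b ++ S) k = a) <-> (size P <= k < size P + n)) /\
  ((lb (P ++ nseq n a ++ nseq n b ++ S) k = b) <-> (size P + n <= k < size P + n + n)).
Proof.
move=> ab aP bP aS bS Hk.
have nin (x : option nat) (T : seq (option nat)) j : x \notin T -> j < size T -> lb T j <> x.
  by move=> /negP H Hj E; apply: H; rewrite -E mem_nth.
rewrite !size_cat !size_nseq in Hk; rewrite !nth_cat !size_nseq !nth_nseq.
case: (ltnP k (size P)) => H1 /=.
  split; split=> [E|]; try lia; first by case: (nin _ _ _ aP H1 E).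
  by case: (nin _ _ _ bP H1 E).
case: (ltnP (k - size P) n) => H2 /=; first by split; split=> E //; try lia; case: ab.
case: (ltnP (k - size P - n) n) => H3 /=; first by split; split=> E //; try lia; case: ab.
have H4 : k - size P - n - n < size S by lia.
split; split=> [E|]; try lia; first by case: (nin _ _ _ aS H4 E).
by case: (nin _ _ _ bS H4 E).
Qed.

(** If the 2n strands are paired among themselves and no pair lies in one block, that block is
    matched with the other, which then has no inner pair either. *)
Lemma closed_unpaired (P S : seq (option nat)) a b n p : pairing p ->
  size (P ++ nseq n a ++ nseq n b ++ S) = size p -> a <> b ->
  a \notin P -> b \notin P -> a \notin S -> b \notin S ->
  closed_on (size P) (size P + 2 * n) p ->
  nopair a p (P ++ nseq n a ++ nseq n b ++ S) <-> nopair b p (P ++ nseq n a ++ nseq n b ++ S).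
Proof.
move=> Hp Hl ab aP bP aS bS Hc; set l := P ++ _ in Hl *.
have L k : k < size p -> ((lb l k = a) <-> (size P <= k < size P + n)) /\
    ((lb l k = b) <-> (size P + n <= k < size P + n + n)).
  by rewrite -Hl; apply: block_label.
have sz : size P + 2 * n <= size p by rewrite -Hl !size_cat !size_nseq; lia.
have Lp k : k < size p -> pt p k < size p by apply: pairing_lt.
have La k (Hk : k < size p) := (L k Hk).1.
have Lb k (Hk : k < size p) := (L k Hk).2.
split=> H k Hk.
  move=> /(Lb _ Hk) R1 /(Lb _ (Lp _ Hk)) R2.
  have M : forall j, size P + n <= j < size P + n + n -> size P <= pt p j < size P + n.
    apply: matched_intervals => //; first lia.
    move=> j Hj; have jp : j < size p by lia.
    have Nj : ~~ (size P <= pt p j < size P + n).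
      by apply/negP => R; apply: (H j jp); [apply/La|apply/La => //; apply: Lp].
    by have := Hc j; lia.
  by have := M k R1; lia.
move=> /(La _ Hk) R1 /(La _ (Lp _ Hk)) R2.
have M : forall j, size P <= j < size P + n -> size P + n <= pt p j < size P + n + n.
  apply: matched_intervals => //; first lia.
  move=> j Hj; have jp : j < size p by lia.
  have Nj : ~~ (size P + n <= pt p j < size P + n + n).
    by apply/negP => R; apply: (H j jp); [apply/Lb|apply/Lb => //; apply: Lp].
  by have := Hc j; lia.
by have := M k R1; lia.
Qed.

(** * Passage through the n-copy of one event *)

Definition lab (n : nat) (A : seq nat) : seq (option nat) :=
  flatten [seq nseq n (Some a) | a <- A].

Lemma lab_cat n A B : lab n (A ++ B) = lab n A ++ lab n B.
Proof. by rewrite /lab map_cat flatten_cat. Qed.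

Lemma lab_cons n a A : lab n (a :: A) = nseq n (Some a) ++ lab n A.
Proof. by []. Qed.

Lemma size_lab n A : size (lab n A) = size A * n.
Proof. by elim: A => // a A IH; rewrite lab_cons size_cat size_nseq IH. Qed.

Lemma lab_notin n c A : c \notin A -> Some c \notin lab n A.
Proof.
elim: A => // a A IH; rewrite inE negb_or => /andP[ca cA].
rewrite lab_cons mem_cat negb_or IH // andbT; apply/negP => /nseqP[[E] _].
by rewrite E eqxx in ca.
Qed.

Definition transparent c s x s' := (unpaired c s <-> unpaired c s') /\
  (unpaired c s -> through (unpaired c) s x s').

Lemma uniq_blocks (T : eqType) (A1 A2 : seq T) a b : uniq (A1 ++ a :: b :: A2) ->
  [/\ a != b, a \notin A1, b \notin A1, a \notin A2 & b \notin A2].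
Proof.
rewrite cat_uniq /= inE !negb_or => /and3P[_ /and3P[-> -> _] /and3P[/andP[-> ->] -> _]] //.
Qed.

(** Labels other than a and b never meet the gadget. For a and b the blocks are sorted at both ends,
    so the order clause comes for free and each direction can be started. *)
Lemma cross_gadget_unpaired n A1 a b A2 s x s' : wf s -> s.2 = lab n (A1 ++ a :: b :: A2) ->
  uniq (A1 ++ a :: b :: A2) -> unzip2 x = cross_gadget n (size A1) -> passes s x s' ->
  [/\ wf s', s'.2 = lab n (A1 ++ b :: a :: A2) & forall c, transparent (Some c) s x s'].
Proof.
move=> Hw; rewrite !lab_cat !lab_cons; set P := lab n A1; set S := lab n A2.
move=> Es /uniq_blocks[ab aA1 bA1 aA2 bA2] Ex Hx.
have {}ab : Some a <> Some b by move=> [E]; rewrite E eqxx in ab.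
have aP := lab_notin n aA1; have bP := lab_notin n bA1.
have aS := lab_notin n aA2; have bS := lab_notin n bA2.
have X := @xword_cross (Some a) (Some b) P S n (size A1) (size_lab n A1).
rewrite -Ex -Es in X; have Hw' := passes_wf Hw (xword_geometric X) Hx.
have Es' := passes_lab Hx; rewrite (xword_lab X) in Es'.
have Hr : region (size P) (size P + 2 * n) (Some a) (Some b) s.2.
  by rewrite Es; apply: region_blocks.
split=> // c; have [Ec|nc] := boolP ((c == a) || (c == b)); last first.
  case/norP: nc => ca cb; apply: through_avoids => //; apply: xword_avoids X.
    by move=> [E]; rewrite E eqxx in ca.
  by move=> [E]; rewrite E eqxx in cb.
have Hc : Some c = Some a \/ Some c = Some b by case/orP: Ec => /eqP ->; [left|right].
have [Hp Hl] := Hw; have [Hp' Hl'] := Hw'.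
have F : unpaired (Some c) s -> good_at (Some c) (Some a) (Some b) s' /\
    through (unpaired (Some c)) s x s'.
  move=> H; apply: (xword_forward Hw Hx ab Hc Hr X).
  by move: H; rewrite /unpaired /good_at Es => H; apply: good_above; rewrite // -Es.
have B : unpaired (Some c) s' -> good_at (Some c) (Some b) (Some a) s.
  move=> H; apply: (proj1 (xword_backward Hw Hx ab Hc Hr X _)).
  move: H; rewrite /unpaired /good_at Es' => H; apply: good_above; rewrite // -?Es' //.
  by move/esym.
by split; [split=> [/F[[]]|/B[]]|move=> /F[]].
Qed.

Lemma lc_stage_lab a b n Q S :
  foldl lstep (Q ++ S) [seq LC (size Q + 2 * c) a b | c <- iota 0 n] = Q ++ alternate n a b ++ S /\
  forall c, a <> c -> b <> c ->
    avoids c (Q ++ S) [seq LC (size Q + 2 * c) a b | c <- iota 0 n].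
Proof.
elim: n Q => [|n IH] Q //.
have Q2 : size (Q ++ [:: a; b]) = size Q + 2 by rewrite size_cat.
have E : [seq LC (size Q + 2 * c) a b | c <- iota 0 n.+1] =
    LC (size Q) a b :: [seq LC (size (Q ++ [:: a; b]) + 2 * c) a b | c <- iota 0 n].
  rewrite /= (iotaDl 1 0) -map_comp Q2 muln0 addn0; congr (_ :: _).
  by apply: eq_map => c /=; congr (LC _ _ _); lia.
have E2 : lstep (Q ++ S) (LC (size Q) a b) = (Q ++ [:: a; b]) ++ S.
  by rewrite /= /insert2 take_size_cat // drop_size_cat // -catA.
have [IH1 IH2] := IH (Q ++ [:: a; b]).
rewrite E; split=> [|c ac bc]; first by rewrite -[LHS]/(foldl lstep (lstep (Q ++ S) (LC (size Q) a b)) _) E2 IH1 -catA.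
by split; [split|rewrite E2; apply: IH2].
Qed.

Lemma lc_stage_closed u l n lo c s x s' : wf s -> passes s x s' -> lo + 2 * c <= size s.1 ->
  unzip2 x = [seq LC (lo + 2 * d) u l | d <- iota c n] ->
  closed_on lo (lo + 2 * c) s.1 -> closed_on lo (lo + 2 * (c + n)) s'.1.
Proof.
elim: n c s x => [|n IH] c s [|[sw e] x] //= Hw; first by move=> ->; rewrite addn0.
move=> [s1 [H1 _ H3]] Hs [Ee Ex] Hc; subst e; have [Hi E1 E2] := step_lc H1.
rewrite addnS -addSn; apply: (IH c.+1 s1 x) => //.
- exact: step_wf H1.
- by rewrite E1 size_pins; lia.
- by rewrite E1; have -> : lo + 2 * c.+1 = (lo + 2 * c).+2; [lia|apply: closed_pins => //; lia].
Qed.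

Lemma lc_stage_backward c s x s' : wf s -> passes s x s' ->
  all (fun e => if e is LC _ _ _ then true else false) (unzip2 x) ->
  unpaired c s' -> unpaired c s /\ through (unpaired c) s x s'.
Proof.
elim: x s => [|[sw e] x IH] s Hw /=; first by move=> ->.
move=> [s1 [H1 _ H3]] /andP[He Hx] H; case: e He H1 => // i u l _ H1.
have Hw1 : wf s1 by apply: step_wf H1.
have [IH1 IH2] := IH _ Hw1 H3 Hx H; split; last by exists s1.
have [Hi E1 E2] := step_lc H1; move: IH1; rewrite /unpaired E1 E2.
by case: Hw => *; apply: unpaired_pins; eassumption.
Qed.

Lemma avoids_cat c l u v : avoids c l (u ++ v) <-> avoids c l u /\ avoids c (foldl lstep l u) v.
Proof.
elim: u l => [|e u IH] l /=; first by split=> [|[]].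
by rewrite IH; split=> [[H1 [H2 H3]]|[[H1 H2] H3]].
Qed.

(** The labels u and l are absent on the left, so for them the property is propagated leftwards from
    the right end. The new strands start out paired among themselves, which remains true through the
    sorting crossings and links u with l. *)
Lemma lc_gadget_unpaired n A1 A2 u l s x s' : 0 < n -> wf s -> s.2 = lab n (A1 ++ A2) ->
  uniq (A1 ++ u :: l :: A2) -> unzip2 x = lc_gadget n (size A1) u l -> passes s x s' ->
  [/\ wf s', s'.2 = lab n (A1 ++ u :: l :: A2),
      forall c, c != u -> c != l -> transparent (Some c) s x s',
      unpaired (Some u) s' <-> unpaired (Some l) s' &
      forall c, c = u \/ c = l -> unpaired (Some c) s' -> through (unpaired (Some c)) s x s'].
Proof.
move=> n0 Hw; rewrite !lab_cat !lab_cons; set P := lab n A1; set S := lab n A2.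
move=> Es /uniq_blocks[ab aA1 bA1 aA2 bA2] Ex Hx.
have {}ab : Some u <> Some l by move=> [E]; rewrite E eqxx in ab.
have aP := lab_notin n aA1; have bP := lab_notin n bA1.
have aS := lab_notin n aA2; have bS := lab_notin n bA2.
have szP : size P = size A1 * n by rewrite size_lab.
have [x1 [x2 [E Ex1 Ex2]]] := unzip2_cat Ex.
rewrite -szP in Ex1.
move: Hx; rewrite E => /through_cat[s1 [Hx1 Hx2]].
have [L1 L2] := lc_stage_lab (Some u) (Some l) n P S.
have G1 : all geometric (unzip2 x1) by rewrite Ex1 all_map; apply/allP.
have Hw1 := passes_wf Hw G1 Hx1.
have Es1 : s1.2 = P ++ alternate n (Some u) (Some l) ++ S.
  by rewrite (passes_lab Hx1) Ex1 Es L1.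
have X := xword_unzip (Some u) (Some l) S szP n0; rewrite -Ex2 -Es1 in X.
have Hw' := passes_wf Hw1 (xword_geometric X) Hx2.
have Es' := passes_lab Hx2; rewrite (xword_lab X) in Es'.
have [Hp Hl] := Hw; have [Hp1 Hl1] := Hw1; have [Hp' Hl'] := Hw'.
have Hr : region (size P) (size P + 2 * n) (Some l) (Some u) s1.2.
  apply: region_sym; rewrite Es1; apply: region_alternate => //.
have Hc1 : closed_on (size P) (size P + 2 * n) s1.1.
  rewrite -[n in 2 * n]add0n; apply: (lc_stage_closed Hw Hx1 _ Ex1) => //.
    by rewrite muln0 addn0 -Hl Es size_cat leq_addr.
  by move=> k; rewrite muln0; lia.
have sz1 : size P + 2 * n <= size s1.1.
  by rewrite -Hl1 Es1 !size_cat size_alternate; lia.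
have Hc' : closed_on (size P) (size P + 2 * n) s'.1.
  by apply/(xword_closed Hw1 Hx2 sz1 Hr X).
split=> //.
- move=> c cu cl; have nu : Some u <> Some c by move=> [F]; rewrite F eqxx in cu.
  have nl : Some l <> Some c by move=> [F]; rewrite F eqxx in cl.
  apply: through_avoids => //; first by apply/through_cat; exists s1.
  rewrite /unzip2 map_cat -!/(unzip2 _) avoids_cat -(passes_lab Hx1); split.
    by rewrite Ex1 Es; apply: L2.
  exact: xword_avoids X.
- by rewrite /unpaired Es'; apply: closed_unpaired; rewrite // -Es'.
move=> c Hc H.
have Hc2 : Some c = Some l \/ Some c = Some u by case: Hc => ->; [right|left].
have [|[H1 _] H2] := xword_backward Hw1 Hx2 (not_eq_sym ab) Hc2 Hr X (c := Some c).
  move: H; rewrite /unpaired /good_at Es' => H; apply: good_above; rewrite // -?Es' //.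
have LCs : all (fun e => if e is LC _ _ _ then true else false) (unzip2 x1).
  by rewrite Ex1 all_map; apply/allP.
have [_ H3] := lc_stage_backward Hw Hx1 LCs H1.
by apply/through_cat; exists s1.
Qed.

Lemma rev_iota0S n : rev (iota 0 n.+1) = n :: rev (iota 0 n).
Proof. by rewrite -addn1 iotaD rev_cat. Qed.

Lemma rc_stage_lab a b n P S :
  foldl lstep (P ++ alternate n a b ++ S) [seq RC (size P + 2 * c) | c <- rev (iota 0 n)] = P ++ S /\
  forall c, a <> c -> b <> c ->
    avoids c (P ++ alternate n a b ++ S) [seq RC (size P + 2 * c) | c <- rev (iota 0 n)].
Proof.
elim: n S => [|n IH] S //; rewrite rev_iota0S map_cons.
set Q := P ++ alternate n a b.
have EQ : size P + 2 * n = size Q by rewrite size_cat size_alternate.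
have E : P ++ alternate n.+1 a b ++ S = Q ++ a :: b :: S.
  by rewrite alternate_rcons /Q -!catA.
have E2 : lstep (Q ++ a :: b :: S) (RC (size Q)) = P ++ alternate n a b ++ S.
  rewrite /= /remove2 take_size_cat // /Q -catA; congr (_ ++ (_ ++ _)).
  by rewrite -/Q drop_cat ifF ?subSn ?subSnn ?subnn /= ?drop0 //; lia.
have [IH1 IH2] := IH S.
rewrite E EQ; split=> [|c ac bc].
  by rewrite -[LHS]/(foldl lstep (lstep (Q ++ a :: b :: S) (RC (size Q))) _) E2 IH1.
split; last by rewrite E2; apply: IH2.
by rewrite !nth_cat ltnn subnn ltnNge leqnSn /= subSnn.
Qed.

Lemma rc_stage_closed n lo s x s' : wf s -> passes s x s' ->
  unzip2 x = [seq RC (lo + 2 * d) | d <- rev (iota 0 n)] -> closed_on lo (lo + 2 * n) s.1.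
Proof.
elim: n s x => [|n IH] s x Hw Hx Ex; first by move=> k; lia.
move: Ex Hx; rewrite rev_iota0S map_cons; case: x => [|[sw e] x] //= [-> Ex].
move=> [s1 [H1 _ H3]]; have Hw1 : wf s1 by apply: step_wf H1.
have [Hi E] := rc_state Hw H1; rewrite E /=.
have -> : lo + 2 * n.+1 = (lo + 2 * n).+2 by lia.
by apply: closed_pins => //; [lia|apply: IH H3 Ex].
Qed.

Lemma rc_stage_forward c s x s' : wf s -> passes s x s' ->
  all (fun e => if e is RC _ then true else false) (unzip2 x) ->
  unpaired c s -> unpaired c s' /\ through (unpaired c) s x s'.
Proof.
elim: x s => [|[sw e] x IH] s Hw /=; first by move=> ->.
move=> [s1 [H1 _ H3]] /andP[He Hx] H; case: e He H1 => // i _ H1.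
have Hw1 : wf s1 by apply: step_wf H1.
have Hs1 : unpaired c s1.
  have [Hi E] := rc_state Hw H1; move: H; rewrite /unpaired E.
  by case: Hw1 => *; apply: unpaired_pins; eassumption.
by have [IH1 IH2] := IH _ Hw1 H3 Hx Hs1; split=> //; exists s1.
Qed.

Lemma rc_gadget_unpaired n A1 A2 a b s x s' : 0 < n -> wf s -> s.2 = lab n (A1 ++ a :: b :: A2) ->
  uniq (A1 ++ a :: b :: A2) -> unzip2 x = rc_gadget n (size A1) -> passes s x s' ->
  [/\ wf s', s'.2 = lab n (A1 ++ A2),
      forall c, c != a -> c != b -> transparent (Some c) s x s',
      unpaired (Some a) s <-> unpaired (Some b) s &
      forall c, c = a \/ c = b -> unpaired (Some c) s -> through (unpaired (Some c)) s x s'].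
Proof.
move=> n0 Hw; rewrite !lab_cat !lab_cons; set P := lab n A1; set S := lab n A2.
move=> Es /uniq_blocks[ab aA1 bA1 aA2 bA2] Ex Hx.
have {}ab : Some a <> Some b by move=> [E]; rewrite E eqxx in ab.
have aP := lab_notin n aA1; have bP := lab_notin n bA1.
have aS := lab_notin n aA2; have bS := lab_notin n bA2.
have szP : size P = size A1 * n by rewrite size_lab.
have [x1 [x2 [E Ex1 Ex2]]] := unzip2_cat Ex.
rewrite -szP in Ex2.
move: Hx; rewrite E => /through_cat[s1 [Hx1 Hx2]].
have X := xword_zip (Some a) (Some b) S szP n0; rewrite -Ex1 -Es in X.
have Hw1 := passes_wf Hw (xword_geometric X) Hx1.
have Es1 := passes_lab Hx1; rewrite (xword_lab X) in Es1.
have [L1 L2] := rc_stage_lab (Some a) (Some b) n P S.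
have G2 : all geometric (unzip2 x2) by rewrite Ex2 all_map; apply/allP.
have Hw' := passes_wf Hw1 G2 Hx2.
have Es' : s'.2 = P ++ S by rewrite (passes_lab Hx2) Ex2 Es1 L1.
have [Hp Hl] := Hw; have [Hp1 Hl1] := Hw1; have [Hp' Hl'] := Hw'.
have Hr : region (size P) (size P + 2 * n) (Some a) (Some b) s.2.
  by rewrite Es; apply: region_blocks.
have sz : size P + 2 * n <= size s.1.
  by rewrite -Hl Es !size_cat !size_nseq; lia.
have Hc : closed_on (size P) (size P + 2 * n) s.1.
  by apply/(xword_closed Hw Hx1 sz Hr X); apply: rc_stage_closed Hw1 Hx2 Ex2.
split=> //.
- move=> c ca cb; have na : Some a <> Some c by move=> [F]; rewrite F eqxx in ca.
  have nb : Some b <> Some c by move=> [F]; rewrite F eqxx in cb.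
  apply: through_avoids => //; first by apply/through_cat; exists s1.
  rewrite /unzip2 map_cat -!/(unzip2 _) avoids_cat -(passes_lab Hx1); split.
    exact: xword_avoids X.
  by rewrite Ex2 Es1; apply: L2.
- by rewrite /unpaired Es; apply: closed_unpaired; rewrite // -Es.
move=> c Hc0 H.
have Hc2 : Some c = Some a \/ Some c = Some b by case: Hc0 => ->; [left|right].
have [|[H1 _] H2] := xword_forward Hw Hx1 ab Hc2 Hr X (c := Some c).
  by move: H; rewrite /unpaired /good_at Es => H; apply: good_above; rewrite // -?Es.
have RCs : all (fun e => if e is RC _ then true else false) (unzip2 x2).
  by rewrite Ex2 all_map; apply/allP.
have [_ H3] := rc_stage_forward Hw1 Hx2 RCs H1.
by apply/through_cat; exists s1.
Qed.

(** * Passage through the box at J *)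

Definition braid_box (o n a : nat) (v : seq nat) : fword :=
  Mk o n None :: braid_at o v ++ [:: Mk o n (Some a)].

Lemma box_label (P S : seq (option nat)) n (x : option nat) k : size P <= k < size P + n ->
  lb (P ++ nseq n x ++ S) k = x.
Proof.
move=> Hk; have H2 : k - size P < n by lia.
by rewrite nth_cat ifF; [rewrite nth_cat size_nseq H2 nth_nseq H2|lia].
Qed.

Lemma box_label_out (P S : seq (option nat)) n (x y : option nat) k :
  ~~ (size P <= k < size P + n) -> lb (P ++ nseq n x ++ S) k = lb (P ++ nseq n y ++ S) k.
Proof.
move=> Hk; rewrite !nth_cat !size_nseq; case: (ltnP k (size P)) => // H1.
by have -> : (k - size P < n) = false by lia.
Qed.

Lemma box_relabel (P S : seq (option nat)) n x y c p : x <> c -> y <> c ->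
  nopair c p (P ++ nseq n x ++ S) -> nopair c p (P ++ nseq n y ++ S).
Proof.
move=> xc yc H k Hk.
have E j : lb (P ++ nseq n y ++ S) j = c -> lb (P ++ nseq n x ++ S) j = c.
  case: (boolP (size P <= j < size P + n)) => Hj; first by rewrite !box_label.
  by rewrite (box_label_out _ x y).
by move=> /E H1 /E H2; apply: (H k).
Qed.

Lemma box_unpaired (P S : seq (option nat)) n x p : pairing p ->
  size (P ++ nseq n x ++ S) = size p -> x \notin P -> x \notin S ->
  nopair x p (P ++ nseq n x ++ S) <-> ~~ block_pairs (size P) n p.
Proof.
move=> Hp Hl xP xS.
have out j : j < size p -> ~~ (size P <= j < size P + n) -> lb (P ++ nseq n x ++ S) j <> x.
  rewrite -Hl !size_cat size_nseq => Hj1 Hj; rewrite !nth_cat !size_nseq.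
  case: (ltnP j (size P)) => H1.
    by move=> E; move/negP: xP; apply; rewrite -E mem_nth.
  have -> : (j - size P < n) = false by lia.
  have H2 : j - size P - n < size S by lia.
  by move=> E; move/negP: xS; apply; rewrite -E mem_nth.
have sz : size P + n <= size p by rewrite -Hl !size_cat size_nseq; lia.
split=> [H|/negP H k Hk E1 E2].
  apply/negP => /block_pairsP[k [Hk Hpk]]; apply: (H k); rewrite ?box_label //; lia.
apply: H; apply/block_pairsP; exists k.
split; apply/negPn/negP => /out; [by apply|apply => //; exact: pairing_lt].
Qed.

Lemma braid_box_inner n P S v s x s' : wf s -> s.2 = P ++ nseq n None ++ S ->
  all (fun i => i.+1 < n) v -> unzip2 x = braid_at (size P) v -> passes s x s' ->
  [/\ wf s', s'.2 = P ++ nseq n None ++ S,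
      block_pairs (size P) n s'.1 = block_pairs (size P) n s.1 &
      forall c, transparent (Some c) s x s'].
Proof.
elim: v s x => [|i v IH] s [|[sw e] x] //= Hw Es; first by move=> _ _ <-; split=> // c; split.
move=> /andP[Hi Hv] [-> Ex] [s1 [H1 _ H3]]; have Hw1 : wf s1 by apply: step_wf H1.
have [Hp Hl] := Hw.
have sz : size P + n <= size s.1 by rewrite -Hl Es !size_cat size_nseq; lia.
have [X E] := step_cr Hw H1.
have n1 : lb s.2 (i + size P) = None by rewrite Es box_label //; lia.
have n2 : lb s.2 (i + size P).+1 = None by rewrite Es box_label //; lia.
have E1 : s1.2 = s.2.
  rewrite E; apply: (@eq_from_nth _ None); rewrite size_swap // => k Hk.
  by rewrite nth_swap ?Hl; [case: (trP (i + size P) k) => [->|->|]; rewrite ?n1 ?n2|lia].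
have bp : block_pairs (size P) n s1.1 = block_pairs (size P) n s.1.
  case: X => _ _ [[-> _] //|->]; rewrite block_pairs_pswap //; lia.
rewrite -E1 in Es; have [R1 R2 R3 R4] := IH _ _ Hw1 Es Hv Ex H3; split=> //.
  by rewrite R3.
move=> c; have [T1 T2] := R4 c.
have T : unpaired (Some c) s <-> unpaired (Some c) s1.
  by rewrite /unpaired E; apply: unpaired_cr_iff; rewrite // ?n1 ?n2.
by split; [rewrite T|move=> /T H; exists s1; split=> //; apply: T2].
Qed.

(** The label a is erased on entry and restored on exit. What carries the information across is
    [block_pairs], which the crossings preserve. *)
Lemma braid_box_unpaired n A1 a A2 v s x s' : wf s -> s.2 = lab n (A1 ++ a :: A2) ->
  uniq (A1 ++ a :: A2) -> all (fun i => i.+1 < n) v ->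
  unzip2 x = braid_box (size A1 * n) n a v -> passes s x s' ->
  [/\ wf s', s'.2 = lab n (A1 ++ a :: A2),
      unpaired (Some a) s <-> ~~ block_pairs (size A1 * n) n s.1 &
      forall c, transparent (Some c) s x s'].
Proof.
move=> Hw; rewrite lab_cat lab_cons; set P := lab n A1; set S := lab n A2.
rewrite -(size_lab n) -/P.
move=> Es U Hv; have [aA1 aA2] : a \notin A1 /\ a \notin A2.
  by move: U; rewrite cat_uniq /= negb_or => /and3P[_ /andP[-> _] /andP[-> _]].
have aP := lab_notin n aA1; have aS := lab_notin n aA2.
case: x => [|[sw e] x] //= [-> Ex] [s1 [H1 _ H3]].
case/unzip2_cat: Ex => x1 [x2 [Ex12 Ex1 Ex2]]; subst x.
case/through_cat: H3 => s2 [Hx1 Hx2].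
case: x2 Ex2 Hx2 => [|[sw' e'] [|]] //= [->] [s3 [H4 _ E3]]; subst s3.
have [E1p E1l] := step_mk H1; have [E3p E3l] := step_mk H4.
have [Hp Hl] := Hw.
have box (y z : option nat) : take (size P) (P ++ nseq n y ++ S) ++ nseq n z ++
    drop (size P + n) (P ++ nseq n y ++ S) = P ++ nseq n z ++ S.
  by rewrite take_size_cat // [in drop _ _]catA drop_size_cat ?size_cat ?size_nseq.
rewrite Es box in E1l.
have szE (y : option nat) : size (P ++ nseq n y ++ S) = size s.1.
  by rewrite -Hl Es !size_cat !size_nseq.
have Hw1 : wf s1 by split; rewrite ?E1p ?E1l.
have [Hw2 E2l E2b T2] := braid_box_inner Hw1 E1l Hv Ex1 Hx1.
rewrite E2l box in E3l.
have [Hp2 Hl2] := Hw2.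
have szE' (y : option nat) : size (P ++ nseq n y ++ S) = size s2.1.
  by rewrite -Hl2 E2l !size_cat !size_nseq.
have Hw' : wf s' by split; rewrite ?E3p ?E3l.
have B : unpaired (Some a) s <-> ~~ block_pairs (size P) n s.1.
  by rewrite /unpaired Es; apply: box_unpaired.
have B' : unpaired (Some a) s' <-> ~~ block_pairs (size P) n s'.1.
  by rewrite /unpaired E3l E3p; apply: box_unpaired.
split=> // c; have [T2a T2b] := T2 c.
have V1 : unpaired (Some c) s -> unpaired (Some c) s1.
  have [->|ca] := eqVneq c a.
    move=> _; apply: unpaired_notin => //; rewrite E1l !mem_cat !negb_or aP aS andbT /=.
    by apply/negP => /nseqP[].
  rewrite /unpaired Es E1l E1p; apply: box_relabel => // -[E]; by rewrite E eqxx in ca.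
have V2 : unpaired (Some c) s2 -> c != a -> unpaired (Some c) s'.
  move=> H ca; move: H; rewrite /unpaired E2l E3l E3p; apply: box_relabel => // -[E].
  by rewrite E eqxx in ca.
have V3 : unpaired (Some c) s' -> c != a -> unpaired (Some c) s2.
  move=> H ca; move: H; rewrite /unpaired E2l E3l E3p; apply: box_relabel => // -[E].
  by rewrite E eqxx in ca.
have V4 : unpaired (Some c) s1 -> c != a -> unpaired (Some c) s.
  move=> H ca; move: H; rewrite /unpaired Es E1l E1p; apply: box_relabel => // -[E].
  by rewrite E eqxx in ca.
have T : unpaired (Some c) s <-> unpaired (Some c) s'.
  have [->|ca] := eqVneq c a; first by rewrite B B' E3p E2b E1p.
  by split=> H; [apply: V2 => //; apply/T2a; apply: V1|apply: V4 => //; apply/T2a; apply: V3].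
split=> // H; exists s1; split=> //; first exact: V1.
apply/through_cat; exists s2; split; first by apply: T2b; apply: V1.
by exists s'; split=> //; apply/T.
Qed.

(** * Slices of the satellite *)

Lemma indexedE w : Defs.indexed w = [seq (m, nth ev0 w m) | m <- iota 0 (size w)].
Proof.
have sz : size (Defs.indexed w) = size w by rewrite /Defs.indexed size_zip size_iota minnn.
apply: (@eq_from_nth _ (0, ev0)) => [|i]; rewrite sz; first by rewrite size_map size_iota.
by move=> Hi; rewrite nth_zip ?size_iota // (nth_map 0) ?size_iota // nth_iota.
Qed.

Lemma arcs_atE w t : t <= size w ->
  arcs_at w t = foldl arc_step [::] [seq (m, nth ev0 w m) | m <- iota 0 t].
Proof. by move=> Ht; rewrite /arcs_at indexedE -map_take take_iota (minn_idPl Ht). Qed.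

Lemma arcs_atS w t : t < size w -> arcs_at w t.+1 = arc_step (arcs_at w t) (t, nth ev0 w t).
Proof.
move=> Ht; rewrite !arcs_atE //; last exact: ltnW.
by rewrite -[X in iota 0 X]addn1 iotaD map_cat foldl_cat.
Qed.

Lemma split2 (T : Type) (x0 : T) i l : i.+1 < size l ->
  exists A1 a b A2, [/\ l = A1 ++ a :: b :: A2, size A1 = i, a = nth x0 l i & b = nth x0 l i.+1].
Proof.
move=> Hi; exists (take i l), (nth x0 l i), (nth x0 l i.+1), (drop i.+2 l); split=> //.
  by rewrite -!drop_nth ?cat_take_drop //; lia.
by rewrite size_takel //; lia.
Qed.

Section Arcs.
Variable w : fword.
Hypothesis Hw : closed_front w.

Lemma count_None v : foldl step_count None v = None.
Proof. by elim: v. Qed.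

Lemma count_arcs t : t <= size w -> count_after 0 (take t w) = Some (size (arcs_at w t)).
Proof.
elim: t => [|t IH] Ht; first by rewrite /arcs_at take0 take0.
have Et : take t.+1 w = rcons (take t w) (nth ev0 w t) by rewrite -take_nth.
have : count_after 0 (take t.+1 w) != None.
  move/eqP: Hw; rewrite -{1}[w](cat_take_drop t.+1) /count_after foldl_cat.
  by case: (foldl _ _ (take t.+1 w)) => // ; rewrite count_None.
rewrite Et /count_after foldl_rcons -/(count_after 0 (take t w)) (IH (ltnW Ht)) arcs_atS //=.
case: (nth ev0 w t) => [i|i a b|i|i k o]; case: ifP => //= H _.
- by rewrite size_swap.
- by rewrite size_cat /= size_take size_drop; case: ifP => ?; congr Some; lia.
- by rewrite size_cat size_take size_drop; case: ifP => ?; congr Some; lia.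
Qed.

Lemma step_valid t : t < size w ->
  step_count (Some (size (arcs_at w t))) (nth ev0 w t) != None.
Proof.
move=> Ht; have := count_arcs Ht; rewrite (take_nth ev0 Ht) /count_after foldl_rcons.
by rewrite -/(count_after 0 (take t w)) (count_arcs (ltnW Ht)) => ->.
Qed.

Variant arc_event t : fev -> seq nat -> seq nat -> Prop :=
| ArcCr A1 a b A2 : arc_event t (Cr (size A1)) (A1 ++ a :: b :: A2) (A1 ++ b :: a :: A2)
| ArcLC A1 A2 x y : arc_event t (LC (size A1) x y) (A1 ++ A2) (A1 ++ (2 * t) :: (2 * t).+1 :: A2)
| ArcRC A1 a b A2 : arc_event t (RC (size A1)) (A1 ++ a :: b :: A2) (A1 ++ A2)
| ArcMk i k o A : arc_event t (Mk i k o) A A.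

Lemma arc_eventP t : t < size w -> arc_event t (nth ev0 w t) (arcs_at w t) (arcs_at w t.+1).
Proof.
move=> Ht; have := step_valid Ht; rewrite arcs_atS //.
case: (nth ev0 w t) => [i|i x y|i|i k o] /=; case: ifP => // H _.
- have [A1 [a [b [A2 [E Ei _ _]]]]] := split2 0 H.
  by rewrite E -Ei swap_cat; constructor.
- have Ei : size (take i (arcs_at w t)) = i by rewrite size_takel.
  by rewrite -{1}[arcs_at w t](cat_take_drop i) -{1}Ei; constructor.
- have [A1 [a [b [A2 [E Ei _ _]]]]] := split2 0 H.
  rewrite E -Ei take_size_cat // drop_cat ifF; last lia.
  have -> : (size A1).+2 - size A1 = 2 by lia.
  by rewrite /= drop0; constructor.
- by constructor.
Qed.

Lemma arcs_props t : t <= size w -> uniq (arcs_at w t) /\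
  forall c, c \in arcs_at w t -> c./2 < t /\ is_lc_at w c./2.
Proof.
elim: t => [|t IH] Ht; first by rewrite /arcs_at take0.
have [U P] := IH (ltnW Ht); have Ht' : t < size w by [].
have [e lc] : exists e, nth ev0 w t = e by exists (nth ev0 w t).
have := arc_eventP Ht'; rewrite lc => H.
case: H lc U P => [A1 a b A2|A1 A2 x y|A1 a b A2|i k o A] lc U P.
- have pe : perm_eq (A1 ++ b :: a :: A2) (A1 ++ a :: b :: A2).
    by rewrite perm_cat2l; apply/permPl; apply: (perm_catCA [:: b] [:: a] A2).
  split; first by rewrite (perm_uniq pe).
  by move=> c; rewrite (perm_mem pe) => /P[]; split=> //; lia.
- have nin d : d \in A1 ++ A2 -> d./2 < t by move/P=> [].
  have n1 d : d./2 = t -> d \notin A1 ++ A2 by move=> Ed; apply/negP => /nin; lia.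
  have e1 : (2 * t)./2 = t by lia.
  have e2 : (2 * t).+1./2 = t by lia.
  split.
    have := n1 _ e1; have := n1 _ e2; move: U; rewrite !mem_cat !cat_uniq /= !inE.
    rewrite !negb_or => /and3P[-> /= -> ->] /andP[-> ->] /andP[-> ->] /=.
    by rewrite andbT; lia.
  move=> c; rewrite mem_cat !inE => Hc.
  have [Ec|[Ec|Ec]] : c = 2 * t \/ c = (2 * t).+1 \/ c \in A1 ++ A2.
    by case/orP: Hc => [H|/or3P[/eqP->|/eqP->|H]]; rewrite ?mem_cat ?H ?orbT; auto.
  + by rewrite Ec e1; split; [lia|rewrite /is_lc_at lc].
  + by rewrite Ec e2; split; [lia|rewrite /is_lc_at lc].
  by have [] := P _ Ec; split=> //; lia.
- split; first by move: U; apply: subseq_uniq; rewrite cat_subseq // -[A2 in subseq A2 _]cat0s;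
    apply: (@cat_subseq _ [::] _ [:: a; b]).
  move=> c Hc; have [] := P c; last by split=> //; lia.
  by move: Hc; rewrite !mem_cat !inE => /orP[->|->]; rewrite ?orbT.
- by split=> // c /P[]; split=> //; lia.
Qed.

Variable n : nat.
Hypothesis n0 : 0 < n.

(** An arc present on both sides of an event is not a branch of a cusp there, so its state is simply
    transmitted; the two branches of a cusp are compared in the slice where both exist. *)
Lemma front_event k s x s' : k < size w -> wf s -> s.2 = lab n (arcs_at w k) ->
  unzip2 x = ncopy_ev n (k, nth ev0 w k) -> passes s x s' ->
  [/\ wf s' /\ s'.2 = lab n (arcs_at w k.+1),
    forall c, c \in arcs_at w k -> c \in arcs_at w k.+1 ->
      (unpaired (Some c) s <-> unpaired (Some c) s'),
    forall c, unpaired (Some c) s -> unpaired (Some c) s' -> through (unpaired (Some c)) s x s',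
    is_lc_at w k -> [/\ 2 * k \in arcs_at w k.+1, (2 * k).+1 \in arcs_at w k.+1 &
      unpaired (Some (2 * k)) s' <-> unpaired (Some (2 * k).+1) s'] &
    forall i, nth ev0 w k = RC i -> let a := nth 0 (arcs_at w k) i in
      let b := nth 0 (arcs_at w k) i.+1 in [/\ a \in arcs_at w k, b \in arcs_at w k &
      unpaired (Some a) s <-> unpaired (Some b) s]].
Proof.
move=> Hk Hs; have [U P] := arcs_props (ltnW Hk); have [U' P'] := arcs_props Hk.
rewrite /is_lc_at.
move: U P U' P'; case: (arc_eventP Hk) => [A1 a b A2|A1 A2 y z|A1 a b A2|i j o A] U P U' P' Es Ex Hx.
- have [H1 H2 H3] := cross_gadget_unpaired Hs Es U Ex Hx; split=> //.
    by move=> c _ _; case: (H3 c).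
  by move=> c H _; case: (H3 c) => _; apply.
- have [H1 H2 H3 H4 H5] := lc_gadget_unpaired n0 Hs Es U' Ex Hx.
  have nk c : c \in A1 ++ A2 -> c != 2 * k /\ c != (2 * k).+1.
    by move=> /P[H _]; split; apply/eqP => E; move: H; rewrite E; lia.
  split=> //.
  + by move=> c /nk[c1 c2] _; case: (H3 c c1 c2).
  + move=> c Ha Hb; have [E|c1] := eqVneq c (2 * k); first by apply: H5 => //; left.
    have [E|c2] := eqVneq c (2 * k).+1; first by apply: H5 => //; right.
    by case: (H3 c c1 c2) => _; apply.
  + by move=> _; rewrite !mem_cat !inE !eqxx !orbT.
- have [H1 H2 H3 H4 H5] := rc_gadget_unpaired n0 Hs Es U Ex Hx; have [ab aA1 bA1 aA2 bA2] := uniq_blocks U.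
  have nk c : c \in A1 ++ A2 -> c != a /\ c != b.
    rewrite mem_cat => H; split; apply/eqP => E; move: H; rewrite E.
      by rewrite (negPf aA1) (negPf aA2).
    by rewrite (negPf bA1) (negPf bA2).
  split=> //.
  + by move=> c _ /nk[c1 c2]; case: (H3 c c1 c2).
  + move=> c Ha Hb; have [E|c1] := eqVneq c a; first by apply: H5 => //; left.
    have [E|c2] := eqVneq c b; first by apply: H5 => //; right.
    by case: (H3 c c1 c2) => _; apply.
  + move=> i [<-]; rewrite !nth_cat ltnn subnn ltnNge leqnSn /= subSnn /=.
    by rewrite !mem_cat !inE !eqxx !orbT.
- by case: x Ex Hx => // _ <-; split.
Qed.

End Arcs.

Lemma passes_fun s x s1 s2 : passes s x s1 -> passes s x s2 -> s1 = s2.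
Proof. by move=> /run_passes H1 /run_passes; rewrite H1 => -[]. Qed.

Lemma passes_flatten (g : nat -> fword) M s x s' :
  unzip2 x = flatten [seq g m | m <- iota 0 M] -> passes s x s' ->
  exists sg xs, [/\ sg 0 = s, sg M = s', x = flatten [seq xs m | m <- iota 0 M] &
    forall m, m < M -> unzip2 (xs m) = g m /\ passes (sg m) (xs m) (sg m.+1)].
Proof.
elim: M x s' => [|M IH] x s'.
  by case: x => // _ <-; exists (fun=> s), (fun=> [::]).
rewrite -addn1 iotaD map_cat flatten_cat /= cats0 => /unzip2_cat[x1 [x2 [-> E1 E2]]].
case/through_cat => s1 [H1 H2]; have [sg [xs [S0 SM EX HX]]] := IH _ _ E1 H1.
exists (fun m => if m <= M then sg m else s'), (fun m => if m < M then xs m else x2).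
split=> //.
- by rewrite addn1 ltnn.
- rewrite map_cat flatten_cat /= cats0 ltnn EX; congr (flatten _ ++ _).
  by apply/eq_in_map => m; rewrite mem_iota => /andP[_ ->].
move=> m; rewrite addn1 ltnS => Hm; rewrite Hm; case: (ltnP m M) => Hm'; first exact: HX.
by have -> : m = M; [lia|rewrite SM].
Qed.

Lemma through_flatten Q sg (xs : nat -> seq (bool * fev)) M :
  (forall m, m < M -> through Q (sg m) (xs m) (sg m.+1)) ->
  through Q (sg 0) (flatten [seq xs m | m <- iota 0 M]) (sg M).
Proof.
elim: M => // M IH H; rewrite -addn1 iotaD map_cat flatten_cat /= cats0 addn1.
apply/through_cat; exists (sg M); split; last exact: H.
by apply: IH => m Hm; apply: H; apply: ltnW.
Qed.

Section Satellite.
Variables (w : fword) (n t p : nat) (v : seq nat).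
Hypotheses (Hw : closed_front w) (Hconn : connected_front w) (n0 : 0 < n).
Hypotheses (Ht : t <= size w) (Hp : p < size (arcs_at w t)).
Hypothesis Hv : all (fun i => i.+1 < n) v.

Definition box_arc := nth 0 (arcs_at w t) p.

(* The box J counts as one extra event, at index t, among those of the front of K. *)
Definition slice_time m := if m <= t then m else m.-1.
Definition slice_arcs m := arcs_at w (slice_time m).
Definition slice_word m : fword :=
  if m == t then braid_box (p * n) n box_arc v
  else ncopy_ev n (let k := slice_time m in (k, nth ev0 w k)).
Definition event_index k := if k < t then k else k.+1.

Lemma slice_event k : k < size w ->
  [/\ slice_word (event_index k) = ncopy_ev n (k, nth ev0 w k),
      slice_arcs (event_index k) = arcs_at w k,
      slice_arcs (event_index k).+1 = arcs_at w k.+1 & event_index k < (size w).+1].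
Proof.
move=> Hk; rewrite /slice_word /slice_arcs /slice_time /event_index.
case: (ltnP k t) => H.
  have -> : (k == t) = false by lia.
  by rewrite (ltnW H) H; split=> //; lia.
have -> : (k.+1 == t) = false by lia.
have -> : (k < t) = false by lia.
by have -> : (k.+1 < t) = false by lia.
Qed.

Lemma event_indexP m : m < (size w).+1 -> m != t ->
  exists2 k, m = event_index k & k < size w.
Proof.
move=> Hm mt; rewrite /event_index; case: (ltnP m t) => H.
  by exists m; [rewrite H|lia].
by exists m.-1; [have -> : (m.-1 < t) = false; lia|lia].
Qed.

Lemma slice_wordE : flatten [seq slice_word m | m <- iota 0 (size w).+1] =
  satellite n w t p (map Cr v).
Proof.
have -> : (size w).+1 = t + (1 + (size w - t)) by lia.
rewrite !iotaD !map_cat !flatten_cat /= cats0 /satellite shift_braid /ncopy_part !indexedE.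
rewrite -!map_take -!map_drop take_iota drop_iota (minn_idPl Ht) -!map_comp add0n.
rewrite {2}/slice_word eqxx /braid_box /= -!catA /=; congr (flatten _ ++ _ :: _ ++ _ :: flatten _).
  apply/eq_in_map => m; rewrite mem_iota => Hm /=.
  have mt : m < t by lia.
  by rewrite /slice_word /slice_time (ltn_eqF mt) (ltnW mt).
rewrite addn1 (iotaDl 1 t) -map_comp; apply/eq_in_map => m; rewrite mem_iota => Hm /=.
have tm : t < m.+1 by lia.
by rewrite /slice_word /slice_time (gtn_eqF tm) leqNgt tm.
Qed.

Lemma prefix_wordE : flatten [seq slice_word m | m <- iota 0 t] =
  ncopy_part n (take t (Defs.indexed w)).
Proof.
rewrite /ncopy_part indexedE -map_take take_iota (minn_idPl Ht) -map_comp.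
congr flatten; apply/eq_in_map => m; rewrite mem_iota => Hm /=.
have mt : m < t by lia.
by rewrite /slice_word /slice_time (ltn_eqF mt) (ltnW mt).
Qed.

Lemma slice_transport m s x s' : m < (size w).+1 -> wf s -> s.2 = lab n (slice_arcs m) ->
  unzip2 x = slice_word m -> passes s x s' ->
  [/\ wf s' /\ s'.2 = lab n (slice_arcs m.+1),
    forall c, c \in slice_arcs m -> c \in slice_arcs m.+1 ->
      (unpaired (Some c) s <-> unpaired (Some c) s') &
    forall c, unpaired (Some c) s -> unpaired (Some c) s' -> through (unpaired (Some c)) s x s'].
Proof.
move=> Hm Hs Es; have [Emt|mt] := eqVneq m t; last first.
  have [k Ek Hk] := event_indexP Hm mt.
  have [E1 E2 E3 _] := slice_event Hk; rewrite Ek E2 in Es; rewrite Ek E1 E2 E3 => Ex Hx.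
  by have [H1 H2 H3 _ _] := front_event Hw n0 Hk Hs Es Ex Hx; split.
subst m.
have [A1 [A2 [EA szA]]] : exists A1 A2, arcs_at w t = A1 ++ box_arc :: A2 /\ size A1 = p.
  exists (take p (arcs_at w t)), (drop p.+1 (arcs_at w t)).
  by rewrite -drop_nth // cat_take_drop size_takel // ltnW.
have E1 : slice_arcs t = arcs_at w t by rewrite /slice_arcs /slice_time leqnn.
have E2 : slice_arcs t.+1 = arcs_at w t by rewrite /slice_arcs /slice_time ltnn.
rewrite E1 EA in Es; rewrite E1 E2 EA /slice_word eqxx -{1}szA => Ex Hx.
have U : uniq (A1 ++ box_arc :: A2) by rewrite -EA; case: (arcs_props Hw Ht).
have [H1 H2 _ H3] := braid_box_unpaired Hs Es U Hv Ex Hx; split=> //.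
  by move=> c _ _; case: (H3 c).
by move=> c H _; case: (H3 c) => _; apply.
Qed.

Lemma box_slice s : wf s -> s.2 = lab n (arcs_at w t) ->
  [/\ pairing s.1, p * n + n <= size s.1 &
      unpaired (Some box_arc) s <-> ~~ block_pairs (p * n) n s.1].
Proof.
move=> [Hps Hl] Es.
have [A1 [A2 [EA szA]]] : exists A1 A2, arcs_at w t = A1 ++ box_arc :: A2 /\ size A1 = p.
  exists (take p (arcs_at w t)), (drop p.+1 (arcs_at w t)).
  by rewrite -drop_nth // cat_take_drop size_takel // ltnW.
have U : uniq (A1 ++ box_arc :: A2) by rewrite -EA; case: (arcs_props Hw Ht).
have [aA1 aA2] : box_arc \notin A1 /\ box_arc \notin A2.
  by move: U; rewrite cat_uniq /= negb_or => /and3P[_ /andP[-> _] /andP[-> _]].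
move: Es; rewrite EA lab_cat lab_cons => Es; split=> //.
  by rewrite -Hl Es !size_cat size_nseq size_lab szA addnA leq_addr.
rewrite -szA -(size_lab n) /unpaired Es; apply: box_unpaired; rewrite -?Es //; exact: lab_notin.
Qed.

Section Slices.
Variables (sg : nat -> state) (xs : nat -> seq (bool * fev)).
Hypothesis sg0 : sg 0 = ([::], [::]).
Hypothesis sgx : forall m, m < (size w).+1 ->
  unzip2 (xs m) = slice_word m /\ passes (sg m) (xs m) (sg m.+1).

Lemma slice_wf m : m <= (size w).+1 -> wf (sg m) /\ (sg m).2 = lab n (slice_arcs m).
Proof.
elim: m => [|m IH] Hm; first by rewrite sg0 /slice_arcs /slice_time leq0n /arcs_at take0.
have [H1 H2] := IH (ltnW Hm); have [Ex Hx] := sgx Hm.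
by have [] := slice_transport Hm H1 H2 Ex Hx.
Qed.

Let unp c m := unpaired (Some c) (sg m).

Lemma unp_vacuous c m : m <= (size w).+1 -> c \notin slice_arcs m -> unp c m.
Proof.
by move=> /slice_wf[H1 H2] Hc; apply: unpaired_notin; rewrite // H2 lab_notin.
Qed.

Lemma unp_step c m : m < (size w).+1 -> c \in slice_arcs m -> c \in slice_arcs m.+1 ->
  unp c m <-> unp c m.+1.
Proof.
move=> Hm; have [H1 H2] := slice_wf (ltnW Hm); have [Ex Hx] := sgx Hm.
by have [_ H _] := slice_transport Hm H1 H2 Ex Hx; apply: H.
Qed.

Lemma slice_arcs_props c m : m <= (size w).+1 -> c \in slice_arcs m -> c./2 < slice_time m.
Proof.
move=> Hm; have Hk : slice_time m <= size w by rewrite /slice_time; case: ifP; lia.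
by move=> Hc; have [_ /(_ c Hc)[]] := arcs_props Hw Hk.
Qed.

(** Arcs are numbered by the event that creates them, so one that has ended never reappears. *)
Lemma dead_step c m : m < (size w).+1 -> c./2 < slice_time m -> c \notin slice_arcs m ->
  c \notin slice_arcs m.+1.
Proof.
move=> Hm Hc; have [->|mt] := eqVneq m t.
  by rewrite /slice_arcs /slice_time leqnn ltnn.
have [k Ek Hk] := event_indexP Hm mt.
have [_ E2 E3 _] := slice_event Hk.
have Ek' : slice_time m = k.
  rewrite Ek /event_index /slice_time; case: (ltnP k t) => H; first by rewrite (ltnW H).
  by rewrite ifF //; lia.
rewrite Ek' in Hc; rewrite Ek E2 E3.
case: (arc_eventP Hw Hk) => [A1 a b A2|A1 A2 y z|A1 a b A2|i j o A] //.
- by rewrite !mem_cat !inE; rewrite (orbCA (c == a)).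
- rewrite !mem_cat !inE => /norP[/negPf -> /negPf ->]; rewrite orbF /=.
  by apply/norP; split; apply/eqP => E; move: Hc; rewrite E; lia.
- by rewrite !mem_cat !inE !negb_or => /and4P[-> _ _ ->].
Qed.

Lemma slice_time_mono m m' : m <= m' -> slice_time m <= slice_time m'.
Proof. by rewrite /slice_time; do ![case: ifP => ?]; lia. Qed.

Lemma dead_after c m d : m + d <= (size w).+1 -> c./2 < slice_time m -> c \notin slice_arcs m ->
  c \notin slice_arcs (m + d).
Proof.
elim: d => [|d IH] Hm Hc Hn; first by rewrite addn0.
rewrite addnS; apply: dead_step; first by rewrite -addnS.
  by apply: leq_trans Hc _; apply: slice_time_mono; apply: leq_addr.
by apply: IH => //; lia.
Qed.

Definition free c := forall m, m <= (size w).+1 -> unp c m.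

(** The slices containing c are consecutive. Among them the condition is transmitted from neighbour
    to neighbour, and elsewhere it is vacuous. *)
Lemma free_propagate c m : m <= (size w).+1 -> c \in slice_arcs m -> unp c m -> free c.
Proof.
move=> Hm Hc Hu; have Hlt := slice_arcs_props Hm Hc.
have fwd d : m + d <= (size w).+1 -> unp c (m + d).
  elim: d => [|d IH] Hd; first by rewrite addn0.
  have Hd' : m + d < (size w).+1 by rewrite -addnS.
  rewrite addnS; case: (boolP (c \in slice_arcs (m + d).+1)) => H1; last exact: unp_vacuous.
  apply/(unp_step Hd') => //; last exact: IH (ltnW Hd').
  apply/negPn/negP => H2.
  have Hc2 : c./2 < slice_time (m + d).
    by apply: leq_trans Hlt _; apply: slice_time_mono; apply: leq_addr.
  by have := dead_step Hd' Hc2 H2; rewrite H1.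
have bwd d : d <= m -> unp c (m - d).
  elim: d => [|d IH] Hd; first by rewrite subn0.
  have E : m - d = (m - d.+1).+1 by lia.
  have Hd' : m - d.+1 < (size w).+1 by lia.
  case: (boolP (c \in slice_arcs (m - d.+1))) => H1; last by apply: unp_vacuous; lia.
  apply/(unp_step Hd') => //; last by rewrite -E; apply: IH; lia.
  apply/negPn/negP => H2.
  have Hc2 : c./2 < slice_time (m - d.+1).+1.
    exact: leq_trans (slice_arcs_props (ltnW Hd') H1) (slice_time_mono (leqnSn _)).
  have Em : (m - d.+1).+1 + d = m by lia.
  by have := @dead_after c (m - d.+1).+1 d; rewrite Em Hc => /(_ Hm Hc2 H2).
move=> m' Hm'; case: (leqP m m') => H.
  by rewrite -(subnKC H); apply: fwd; rewrite subnKC.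
by have -> : m' = m - (m - m') by [lia]; apply: bwd; lia.
Qed.

Lemma event_facts k : k < size w ->
  [/\ is_lc_at w k -> [/\ 2 * k \in slice_arcs (event_index k).+1,
         (2 * k).+1 \in slice_arcs (event_index k).+1 &
         unp (2 * k) (event_index k).+1 <-> unp (2 * k).+1 (event_index k).+1] &
      forall i, nth ev0 w k = RC i -> let a := nth 0 (arcs_at w k) i in
        let b := nth 0 (arcs_at w k) i.+1 in [/\ a \in slice_arcs (event_index k),
        b \in slice_arcs (event_index k) & unp a (event_index k) <-> unp b (event_index k)]].
Proof.
move=> Hk; have [E1 E2 E3 Hi] := slice_event Hk.
have [H1 H2] := slice_wf (ltnW Hi); have [Ex Hx] := sgx Hi.
rewrite E2 in H2; rewrite E1 in Ex; rewrite E2 E3.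
by have [_ _ _ T4 T5] := front_event Hw n0 Hk H1 H2 Ex Hx.
Qed.

(** Both arcs are present in the slice on the open side of the cusp that joins them, and there the
    two conditions are equivalent. *)
Lemma free_edge a b : arc_edge w a b -> free a -> free b.
Proof.
have lcs k a' b' : k < size w -> is_lc_at w k -> a'./2 = k -> b'./2 = k -> free a' -> free b'.
  move=> Hk /(event_facts Hk).1[m1 m2 E] Ha Hb Fa.
  have Hi : (event_index k).+1 <= (size w).+1 by have [] := slice_event Hk.
  have Ha' : a' = 2 * k \/ a' = (2 * k).+1 by lia.
  have Hb' : b' = 2 * k \/ b' = (2 * k).+1 by lia.
  have := Fa _ Hi; case: Ha' => ->; case: Hb' => -> H; apply: (free_propagate Hi) => //; exact/E.
have rcs a' b' : (a', b') \in rc_joins w -> (free a' <-> free b').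
  rewrite /rc_joins indexedE -map_comp => /flattenP[l /mapP[k]]; rewrite mem_iota => Hk -> /=.
  case Ee : (nth ev0 w k) => [i|i y z|i|i j o] //; rewrite inE => /eqP[-> ->].
  have [m1 m2 E] := (event_facts Hk).2 i Ee.
  have Hi : event_index k <= (size w).+1 by have [_ _ _] := slice_event Hk; apply: ltnW.
  by split=> F; apply: (free_propagate Hi) => //; apply/E; apply: F.
case/or3P => [/andP[/andP[/eqP H1 _] H2]|/rcs[]|/rcs[]] //.
apply: (@lcs a./2) => //.
by move: H2; rewrite /is_lc_at ltnNge; case: leqP => // H; rewrite nth_default.
Qed.

Lemma all_free : unp box_arc t -> forall c m, m <= (size w).+1 -> unp c m.
Proof.
move=> Hu c m Hm; case: (boolP (c \in slice_arcs m)) => Hc; last exact: unp_vacuous.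
suff : free c by apply.
have Ht' : t <= (size w).+1 by apply: leqW.
have Hb : box_arc \in slice_arcs t by rewrite /slice_arcs /slice_time leqnn mem_nth.
have Fb : free box_arc by apply: (free_propagate Ht').
have lcP d : d \in slice_arcs m \/ d = box_arc -> d < 2 * size w /\ is_lc_at w d./2.
  have Hk : slice_time m <= size w by rewrite /slice_time; case: ifP; lia.
  have [_ P1] := arcs_props Hw Hk; have [_ P2] := arcs_props Hw Ht.
  case=> [/P1[H1 H2]|->]; first by split=> //; lia.
  by have [|H1 H2] := P2 box_arc; [rewrite mem_nth|split=> //; lia].
have [c1 c2] := lcP c (or_introl Hc); have [b1 b2] := lcP _ (or_intror erefl).
have /andP[_ /forallP/(_ (Ordinal b1))/forallP/(_ (Ordinal c1))/implyP] := Hconn.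
rewrite /= b2 c2 => /(_ isT)/connectP[q Hq Ec].
have : free (last (Ordinal b1) q).
  have Fb1 : free (Ordinal b1) by [].
  elim: q (Ordinal b1) Hq Fb1 {Ec} => // d q IH e Hq Fe.
  by case/andP: Hq => He Hq; apply: IH Hq _; apply: free_edge He Fe.
by rewrite -Ec.
Qed.

Lemma slices_reduced m : m < (size w).+1 -> unp box_arc t -> through reduced (sg m) (xs m) (sg m.+1).
Proof.
move=> Hm Hu; have [Hs Es] := slice_wf (ltnW Hm); have [Ex Hx] := sgx Hm.
have [_ _ T3] := slice_transport Hm Hs Es Ex Hx.
apply: (@through_sub (fun s => forall c, unpaired (Some c) s)).
  move=> s1 H; apply/allP => k; rewrite mem_iota => Hk.
  case E : (nth None s1.2 k) => [c|] //=; apply/eqP => E'.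
  by apply: (H c k).
apply: through_all => // c; apply: T3; apply: all_free => //; exact: ltnW.
Qed.

End Slices.

(** The test is read at the entrance of J, where the block still carries its label. A reduced run
    passes it there; conversely, passing it frees every arc in every slice and hence inside every
    gadget. *)
Lemma reduced_run x1 x2 s1 s' :
  unzip2 x1 = ncopy_part n (take t (Defs.indexed w)) ->
  unzip2 (x1 ++ x2) = satellite n w t p (map Cr v) ->
  passes ([::], [::]) x1 s1 -> passes s1 x2 s' ->
  (~~ block_pairs (p * n) n s1.1) <-> through reduced ([::], [::]) (x1 ++ x2) s'.
Proof.
move=> Ex1 Ex Hx1 Hx2; have Hx : passes ([::], [::]) (x1 ++ x2) s'.
  by apply/through_cat; exists s1.
rewrite -slice_wordE in Ex; have [sg [xs [S0 SM EX HX]]] := passes_flatten Ex Hx.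
(* Both decompositions of the run cut at the same word length, so the given prefix consists of the
   first t pieces. *)
have E1 : x1 = flatten [seq xs m | m <- iota 0 t].
  have sz : size x1 = size (flatten [seq xs m | m <- iota 0 t]).
    rewrite -[LHS](size_map snd) -[RHS](size_map snd) -!/(unzip2 _) Ex1 -prefix_wordE.
    rewrite /unzip2 map_flatten -map_comp; congr (size (flatten _)).
    apply/eq_in_map => m; rewrite mem_iota => Hm /=.
    have Hm' : m < (size w).+1 by lia.
    by have [<- _] := HX m Hm'.
  have := congr1 (take (size x1)) EX; rewrite take_size_cat // => ->.
  have -> : (size w).+1 = t + ((size w).+1 - t) by lia.
  by rewrite iotaD map_cat flatten_cat take_size_cat.
have Est : s1 = sg t.
  apply: (passes_fun Hx1); rewrite E1 -S0; apply: through_flatten => m Hm.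
  have Hm' : m < (size w).+1 by lia.
  by have [] := HX m Hm'.
have [Hs Es] := slice_wf S0 HX (leqW Ht).
have Ea : slice_arcs t = arcs_at w t by rewrite /slice_arcs /slice_time leqnn.
rewrite Ea in Es; have [_ _ B] := box_slice Hs Es.
rewrite Est -B; split=> [Hu|].
  rewrite EX -SM -S0; apply: through_flatten => m Hm.
  exact: (slices_reduced S0 HX Hm Hu).
case/through_cat => s2 [H1 _]; have E2 := passes_fun (through_passes H1) Hx1.
have R : reduced s2 by apply: through_last H1.
by rewrite E2 Est in R; move/(reducedP Hs): R; apply.
Qed.

Lemma prefix_state x1 s1 : unzip2 x1 = ncopy_part n (take t (Defs.indexed w)) ->
  passes ([::], [::]) x1 s1 -> pairing s1.1 /\ p * n + n <= size s1.1.
Proof.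
rewrite -prefix_wordE => Ex Hx; have [sg [xs [S0 SM EX HX]]] := passes_flatten Ex Hx.
have H m : m <= t -> wf (sg m) /\ (sg m).2 = lab n (slice_arcs m).
  elim: m => [|m IH] Hm; first by rewrite S0 /slice_arcs /slice_time leq0n /arcs_at take0.
  have [H1 H2] := IH (ltnW Hm); have [E1 E2] := HX _ Hm.
  have Hm' : m < (size w).+1 by lia.
  by have [] := slice_transport Hm' H1 H2 E1 E2.
have [H1 H2] := H t (leqnn t); rewrite SM in H1 H2.
have Ea : slice_arcs t = arcs_at w t by rewrite /slice_arcs /slice_time leqnn.
by rewrite Ea in H2; have [] := box_slice H1 H2.
Qed.

End Satellite.

(** * Sums over rulings *)

Section Masks.
Local Open Scope ring_scope.
Variable F : fieldType.

(** Summation over switch masks in a recursive form, so that it unfolds together with [bword]. *)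
Fixpoint msum (m : nat) (G : seq bool -> F) : F :=
  if m is m'.+1 then msum m' (fun bs => G (true :: bs)) + msum m' (fun bs => G (false :: bs))
  else G [::].

Lemma eq_msum m G G' : (forall bs, size bs = m -> G bs = G' bs) -> msum m G = msum m G'.
Proof.
elim: m G G' => [|m IH] G G' H /=; first exact: H.
by congr (_ + _); apply: IH => bs Hbs; apply: H; rewrite /= Hbs.
Qed.

Lemma msum0 m : msum m (fun=> 0) = 0.
Proof. by elim: m => //= m ->; rewrite addr0. Qed.

Lemma mulr_msum x m G : x * msum m G = msum m (fun bs => x * G bs).
Proof. by elim: m G => //= m IH G; rewrite mulrDr !IH. Qed.

Lemma msumD m1 m2 G :
  msum (m1 + m2) G = msum m1 (fun b1 => msum m2 (fun b2 => G (b1 ++ b2))).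
Proof. by elim: m1 G => //= m IH G; rewrite !IH. Qed.

Lemma sum_tuples m (G : seq bool -> F) : \sum_(t : m.-tuple bool) G t = msum m G.
Proof.
elim: m G => [|m IH] G.
  by rewrite (big_pred1 [tuple]) // => t; apply/esym/eqP; apply: tuple0.
rewrite -[RHS]/(msum m (fun bs => G (true :: bs)) + msum m (fun bs => G (false :: bs))).
rewrite -!IH -(big_bool _ (fun b => \sum_(t : m.-tuple bool) G (b :: t))) pair_big /=.
rewrite (reindex (fun bt : bool * m.-tuple bool => [tuple of bt.1 :: bt.2])) //=.
exists (fun t : m.+1.-tuple bool => (thead t, [tuple of behead t])) => [[b t] _|t _].
  by congr (_, _); apply: val_inj.
by rewrite [RHS]tuple_eta.
Qed.

Lemma sum_sets m (G : seq bool -> F) :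
  \sum_(S : {set 'I_m}) G [seq i \in S | i <- enum 'I_m] = msum m G.
Proof.
rewrite -sum_tuples (reindex (fun t : m.-tuple bool => [set i | tnth t i])) /=; last first.
  exists (fun S : {set 'I_m} => [tuple i \in S | i < m]) => [t _|S _].
    by apply: eq_from_tnth => i; rewrite tnth_mktuple inE.
  by apply/setP => i; rewrite inE tnth_mktuple.
apply: eq_bigr => t _; congr G.
by rewrite -[RHS]map_tnth_enum; apply: eq_map => i; rewrite inE.
Qed.

End Masks.

Section Rulings.
Local Open Scope ring_scope.
Variables (F : fieldType) (s : F).
Hypothesis z0 : zz s != 0.
Local Notation z := (zz s).

Definition event_weight (e : bool * fev) : F :=
  (if e.1 then z else 1) * (if e.2 is RC _ then z^-1 else 1).

Definition weight (x : seq (bool * fev)) : F := \prod_(e <- x) event_weight e.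

Lemma weightE bs w : size bs = size w ->
  weight (zip bs w) = z ^ ((count id bs)%:Z - (num_rc w)%:Z).
Proof.
move=> Hs; rewrite expfzDr // -exprnN -exprVn -exprnP.
elim: bs w Hs => [|b bs IH] [|e w] //=; first by rewrite /weight big_nil mulr1.
move=> [/IH {}IH]; rewrite /weight big_cons -/(weight _) IH /event_weight /num_rc /= !exprD.
by rewrite mulrACA; congr (_ * _ * (_ * _)); [case: b|case: e].
Qed.

Definition start : state := ([::], [::]).

Definition closes (s' : rstate) : bool := if s' is Some (p, _) then p == [::] else false.

Lemma ruling_polyE red w : ruling_poly s red w =
  msum (size w) (fun bs => if closes (run red (Some start) (zip bs w)) then weight (zip bs w) else 0).
Proof.
rewrite (@eq_msum _ _ _ (fun bs => if closes (run red (Some start) (zip bs w))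
  then z ^ ((count id bs)%:Z - (num_rc w)%:Z) else 0)); last by move=> bs Hbs; rewrite weightE.
rewrite -sum_sets /ruling_poly big_mkcond /=; apply: eq_bigr => S _.
rewrite count_map; congr (if _ then z ^ (Posz _ - _) else 0).
by rewrite [LHS]cardE {1}/enum_mem size_filter enumT; apply: eq_count.
Qed.

Lemma bword_msum w st f : bword s w f st.1 =
  msum (size w) (fun bs => if run false (Some st) (zip bs w) is Some s' then
     weight (zip bs w) * f s'.1 else 0).
Proof.
elim: w st => [|e w IH] st /=; first by rewrite /weight big_nil mul1r.
have step sw : msum (size w) (fun bs =>
    if run false (Some st) ((sw, e) :: zip bs w) is Some s'
    then weight ((sw, e) :: zip bs w) * f s'.1 else 0) =
    if rstep false (Some st) (sw, e) is Some s1 then event_weight (sw, e) * bword s w f s1.1 else 0.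
  case E : (rstep false (Some st) (sw, e)) => [s1|].
    rewrite IH mulr_msum; apply: eq_msum => bs _.
    rewrite -[run _ _ (_ :: _)]/(run false (rstep false (Some st) (sw, e)) (zip bs w)) E.
    by case: (run _ _ _) => [s'|]; rewrite ?mulr0 // /weight big_cons mulrA.
  rewrite -[RHS](msum0 _ (size w)); apply: eq_msum => bs _.
  rewrite -[run _ _ (_ :: _)]/(run false (rstep false (Some st) (sw, e)) (zip bs w)) E.
  by rewrite run_None.
rewrite !step /event_weight; case: st {step} => p l; rewrite /rstep /=.
case: e => [i|i a b|i|i k o] /=; rewrite ?mul1r ?mulr1 ?add0r //.
- case: ifP => _; rewrite ?addr0 //; congr (_ + _); case: ifP => _ //=; by rewrite ?mul1r ?mulr1.
- by case: ifP => _ /=; rewrite ?mul1r.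
- by case: ifP => _ /=; rewrite ?mul1r.
Qed.

(** The block identities hold only at genuine pairings, so functions may be exchanged only at states
    that a run can reach. *)
Lemma bword_reachable w st f g : (forall x s', unzip2 x = w -> passes st x s' -> f s'.1 = g s'.1) ->
  bword s w f st.1 = bword s w g st.1.
Proof.
move=> H; rewrite !bword_msum; apply: eq_msum => bs Hbs.
case E : (run _ _ _) => [s'|] //; congr (_ * _); apply: (H (zip bs w)).
  by rewrite unzip2_zip ?Hbs.
exact/run_passes.
Qed.

Definition empty_val (q : seq nat) : F := if q == [::] then 1 else 0.

Lemma ruling_poly_false w : ruling_poly s false w = bword s w empty_val [::].
Proof.
rewrite ruling_polyE -[[::] in RHS]/(start.1) bword_msum; apply: eq_msum => bs _.
by case: (run _ _ _) => [[q l]|] //=; rewrite /empty_val; case: ifP; rewrite ?mulr1 ?mulr0.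
Qed.

(** If reducedness of a run amounts to a test at the cut, the constrained sum is an unconstrained
    one with that test inserted between the two words. *)
Lemma ruling_poly_reduced u r (good : seq nat -> bool) :
  (forall x1 x2 s1 s', unzip2 x1 = u -> unzip2 (x1 ++ x2) = u ++ r ->
     passes start x1 s1 -> passes s1 x2 s' ->
     good s1.1 <-> through reduced start (x1 ++ x2) s') ->
  ruling_poly s true (u ++ r) =
  bword s u (fun q => if good q then bword s r empty_val q else 0) [::].
Proof.
move=> H; rewrite ruling_polyE size_cat msumD -[[::] in RHS]/(start.1) bword_msum.
apply: eq_msum => b1 Hb1.
have Ex1 : unzip2 (zip b1 u) = u by rewrite unzip2_zip ?Hb1.
case E1 : (run _ _ (zip b1 u)) => [s1|]; last first.
  rewrite -[RHS](msum0 _ (size r)); apply: eq_msum => b2 Hb2; rewrite zip_cat //.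
  case E : (run true _ _) => [s'|] //=.
  have /through_passes/through_cat[s1 [/run_passes]] := (run_reduced _ _ _).1 E.
  by rewrite E1.
transitivity (msum (size r) (fun b2 => weight (zip b1 u) * (if good s1.1 then
    if run false (Some s1) (zip b2 r) is Some s' then weight (zip b2 r) * empty_val s'.1 else 0
    else 0))); last by rewrite -mulr_msum; case: ifP => _; rewrite ?bword_msum ?msum0.
apply: eq_msum => b2 Hb2; rewrite zip_cat //.
have Ex2 : unzip2 (zip b2 r) = r by rewrite unzip2_zip ?Hb2.
have Hx1 := (run_passes _ _ _).1 E1.
have Ex : unzip2 (zip b1 u ++ zip b2 r) = u ++ r by rewrite /unzip2 map_cat -!/(unzip2 _) Ex1 Ex2.
case E2 : (run false (Some s1) (zip b2 r)) => [s'|]; last first.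
  rewrite (_ : run true _ _ = None); first by rewrite /= if_same mulr0.
  case E : (run true _ _) => [s'|] //.
  have /through_passes/through_cat[s2 [H1 /run_passes]] := (run_reduced _ _ _).1 E.
  by rewrite (passes_fun H1 Hx1) E2.
have Hx2 := (run_passes _ _ _).1 E2; have := H _ _ _ _ Ex1 Ex Hx1 Hx2.
case: (good s1.1) => [[/(_ isT)/run_reduced -> _]|[_ N]].
  case: s' {E2 Hx2} => q l /=; rewrite /empty_val /weight big_cat /=.
  by case: ifP; rewrite ?mulr1 ?mulr0.
case E : (run true _ _) => [s2|]; last by rewrite /= mulr0.
have R := (run_reduced _ _ _).1 E.
have Es : s2 = s'.
  by apply: passes_fun (through_passes R) _; apply/through_cat; exists s1.
by move: R; rewrite Es => /N.
Qed.

End Rulings.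

(** * Comparison of both sides at the entrance of J *)

Local Open Scope ring_scope.

Theorem theorem2p8
  (F : fieldType) (s : F) (hs0 : s != 0)
  (hs : forall k : nat, (0 < k)%N -> s ^+ k - s ^- k != 0)
  (w : fword) (hclosed : closed_front w) (hconn : connected_front w)
  (t p : nat) (ht : (t <= size w)%N) (hp : (p < size (arcs_at w t))%N)
  (n : nat) (hn : (1 <= n)%N)
  (pb : 'S_n -> seq nat) (hpb : forall b : 'S_n, ppb_word b (pb b)) :
  R1n s w t p pb = (c_n s n)^-1 * R1sat s n w t p (cL s n).
Proof.
have z0 : zz s != 0 by have := hs 1 isT; rewrite expr1.
have Hall b : all (fun i => i.+1 < n)%N (pb b).
  by have [] := ppb_hword 0 (fun=> 0 : F) (hpb b).
congr (_ * _); set o := (p * n)%N.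
set u := ncopy_part n (take t (Defs.indexed w)).
set g := bword s (ncopy_part n (drop t (Defs.indexed w))) (empty_val F).
(* Both sides become the operator of the common prefix u, applied to a function of the pairing at
   the entrance of J. *)
transitivity (bword s u (fun q => \sum_(b : 'S_n) s ^+ lam b *
    (if ~~ block_pairs o n q then bword s (braid_at o (pb b)) g q else 0)) [::]).
  rewrite bword_lin; apply: eq_bigr => b _; congr (_ * _).
  rewrite /satellite -/u (ruling_poly_reduced z0 (good := fun q => ~~ block_pairs o n q)).
    apply: bword_ext => q; congr (if _ then _ else _).
    by rewrite -/o /= shift_braid bword_cat.
  move=> x1 x2 s1 s' Ex1 Ex Hx1 Hx2.
  exact: (reduced_run hclosed hconn hn ht hp (Hall b) Ex1 Ex Hx1 Hx2).
transitivity (bword s u (bcomb s o (cL s n) g) [::]); last first.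
  rewrite /bcomb bword_lin; apply: eq_bigr => x _; congr (_ * _).
  by rewrite ruling_poly_false // /satellite bword_cat /= -/o bword_cat.
(* It remains to compare the two functions at pairings reached by the prefix, which contain the
   block. *)
apply: (@bword_reachable _ s u start) => x s1 Ex Hx.
have [Hp Hsz] := prefix_state hclosed hconn hn ht hp (Hall 1%g) Ex Hx.
have En : n = n.-1.+1 by rewrite prednK.
rewrite /cL cL_auxE // -?En //.
case: (boolP (block_pairs o n s1.1)) => Hb /=.
  by rewrite big1 // => b _; rewrite mulr0.
by rewrite (bsym_braids Hp Hsz Hb s g hn hpb).
Qed.
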